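(* Let $k\ge 1$ be an integer, $\mathbf{x},\mathbf{y}\in\mathbb{C}^k$, $\mathbf{a},\mathbf{b}\in\mathbb{C}^k$ and $c,d\in\mathbb{C}$ with $\Re(\mathbf{a})>\mathbf{0}$, $\Re(c)>\Re(\langle\mathbf{a}\rangle)$, $\Re(\mathbf{b})>\mathbf{0}$, $\Re(d)>\Re(\langle\mathbf{b}\rangle)$. Then the following two formulas hold. (1) For all $g,h\in\mathbb{C}$ with $\Re(g)>\Re(h)>0$, $$\Phi_2^{(k)}\big[\mathbf{a};c;\mathbf{x}\big]\,\Phi_2^{(k)}\big[\mathbf{b};d;\mathbf{y}\big]=\int_{E_k\times E_k}\int_{0}^{1}{}_{1}F_{1}\left[\begin{matrix}g\\ h\end{matrix};t\langle\mathbf{x}\circ\mathbf{u}+\mathbf{y}\circ\mathbf{v}\rangle\right]\mathrm{d}\mu_{(\mathbf{a},c-\langle\mathbf{a}\rangle)}(\mathbf{u})\,\mathrm{d}\mu_{(\mathbf{b},d-\langle\mathbf{b}\rangle)}(\mathbf{v})\,\mathrm{d}\mu_{h,g-h}(t).$$ (2) For all $g\in\mathbb{C}$ and $\mathbf{h}\in\mathbb{C}^k$ with $\Re(\mathbf{h})>\mathbf{0}$ and $\Re(g)>\Re(\langle\mathbf{h}\rangle)$, $$\Phi_2^{(k)}\big[\mathbf{a};c;\mathbf{x}\big]\,\Phi_2^{(k)}\big[\mathbf{b};d;\mathbf{y}\big]=\int_{E_k\times E_k\times E_k}\Psi_2^{(k)}\big[g;\mathbf{h};(\mathbf{x}\c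irc\mathbf{u}+\mathbf{y}\circ\mathbf{v})\circ\mathbf{t}\big]\,\mathrm{d}\mu_{(\mathbf{a},c-\langle\mathbf{a}\rangle)}(\mathbf{u})\,\mathrm{d}\mu_{(\mathbf{b},d-\langle\mathbf{b}\rangle)}(\mathbf{v})\,\mathrm{d}\mu_{(\mathbf{h},g-\langle\mathbf{h}\rangle)}(\mathbf{t}).$$
   Context: Boldface letters denote vectors of dimension $k$. For $\mathbf{x},\mathbf{y}\in\mathbb{C}^k$ and $\mathbf{m}\in\mathbb{Z}_{\ge0}^k$: $\langle\mathbf{x}\rangle:=x_1+\cdots+x_k$, $\mathbf{x}\circ\mathbf{y}:=(x_1y_1,\dots,x_ky_k)$, $\mathbf{x}^{\mathbf{m}}:=x_1^{m_1}\cdots x_k^{m_k}$, $\mathbf{m}!:=m_1!\cdots m_k!$; $\Re(\mathbf{a})>\mathbf{0}$ means $\Re(a_i)>0$ for all $i$. $(a)_n=a(a+1)\cdots(a+n-1)$, $(a)_0=1$. Sums $\sum_{\mathbf{m}=\mathbf{0}}^\infty$ run over all $\mathbf{m}\in\mathbb{Z}_{\ge0}^k$. Functions (lower parameters not in $\mathbb{Z}_{\le0}$, arguments in $\mathbb{C}$ or $\mathbb{C}^k$): $${}_{1}F_{1}\left[\begin{matrix}a\\ c\end{matrix};x\right]=\sum_{n=0}^\infty\frac{(a)_n}{(c)_n}\frac{x^n}{n!},\qquad \Phi_2^{(k)}[\mathbf{b};c;\mathbf{x}]=\sum_{\mathbf{m}=\mathbf{0}}^\infty\frac{(b_1)_{m_1}\cdots(b_k)_{m_k}}{(c)_{\langle\mathbf{m}\rangle}}\frac{\mathbf{x}^{\mathbf{m}}}{\mathbf{m}!},\qquad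 \Psi_2^{(k)}[a;\mathbf{c};\mathbf{x}]=\sum_{\mathbf{m}=\mathbf{0}}^\infty\frac{(a)_{\langle\mathbf{m}\rangle}}{(c_1)_{m_1}\cdots(c_k)_{m_k}}\frac{\mathbf{x}^{\mathbf{m}}}{\mathbf{m}!}.$$ Measures: for $\Re(\alpha),\Re(\beta)>0$, on $[0,1]$, $$\mathrm{d}\mu_{\alpha,\beta}(t)=\frac{\Gamma(\alpha+\beta)}{\Gamma(\alpha)\Gamma(\beta)}t^{\alpha-1}(1-t)^{\beta-1}\,\mathrm{d}t.$$ For $\boldsymbol{\lambda}\in\mathbb{C}^k$ with $\Re(\boldsymbol{\lambda})>\mathbf{0}$ and $\alpha\in\mathbb{C}$ with $\Re(\alpha)>0$, the (complex) Dirichlet measure on the standard simplex $E_k=\{\mathbf{s}\in\mathbb{R}^k: s_i\ge0,\ s_1+\cdots+s_k\le1\}$ is $$\mathrm{d}\mu_{(\boldsymbol{\lambda},\alpha)}(\mathbf{s})=\frac{\Gamma(\langle\boldsymbol{\lambda}\rangle+\alpha)}{\Gamma(\lambda_1)\cdots\Gamma(\lambda_k)\Gamma(\alpha)}\,s_1^{\lambda_1-1}\cdots s_k^{\lambda_k-1}(1-\langle\mathbf{s}\rangle)^{\alpha-1}\,\mathrm{d}\mathbf{s}.$$ *)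

(* Defs.v *)
From HB Require Import structures.
From mathcomp Require Import all_boot all_order all_algebra.
From mathcomp Require Import all_classical all_reals all_analysis.
From mathcomp Require Import summability.
From mathcomp Require Import complex.

Set Implicit Arguments.
Unset Strict Implicit.
Unset Printing Implicit Defensive.

Import Order.TTheory GRing.Theory Num.Theory numFieldNormedType.Exports.

Local Open Scope classical_set_scope.
Local Open Scope ring_scope.
Local Open Scope complex_scope.

(* The numFieldType annotation gives access to the norm topology on R[i]; *)
(* Cplx R ^o is the normed module of complex numbers over itself.         *)
Definition Cplx (R : realType) : numFieldType := R[i].

Section vectors.
Variables (R : realType) (k : nat).
Local Notation C := (Cplx R).

Definition vsum (x : 'rV[C]_k) : C := \sum_(i < k) x 0 i.

Definition hadamard (x y : 'rV[C]_k) : 'rV[C]_k := \row_i (x 0 i * y 0 i).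

Definition cvec (u : k.-tuple (measurableTypeR R)) : 'rV[C]_k :=
  \row_i ((tnth u i : R)%:C : C).

End vectors.

Section hypergeometric.
Variable R : realType.
Local Notation C := (Cplx R).

Definition poch (a : C) (n : nat) : C := \prod_(j < n) (a + j%:R).

Definition hyp1F1 (a c x : C) : C :=
  limn (series (fun n : nat =>
    poch a n / poch c n * (x ^+ n / n`!%:R) : C^o)).

(* The sums over all multi-indices are unordered: limits of the partial    *)
(* sums along the directed set of finite sets of multi-indices.            *)
Definition Phi2 (k : nat) (b : 'rV[C]_k) (c : C) (x : 'rV[C]_k) : C :=
  summability.sum (fun m : {ffun 'I_k -> nat} =>
    (\prod_(i < k) poch (b 0 i) (m i)) / poch c (\sum_(i < k) m i)%N *
    ((\prod_(i < k) x 0 i ^+ m i) / (\prod_(i < k) (m i)`!)%N%:R) : C^o).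

Definition Psi2 (k : nat) (a : C) (c : 'rV[C]_k) (x : 'rV[C]_k) : C :=
  summability.sum (fun m : {ffun 'I_k -> nat} =>
    poch a (\sum_(i < k) m i)%N / (\prod_(i < k) poch (c 0 i) (m i)) *
    ((\prod_(i < k) x 0 i ^+ m i) / (\prod_(i < k) (m i)`!)%N%:R) : C^o).

End hypergeometric.

Section complex_integral.
Variable R : realType.
Local Notation C := (Cplx R).
Context (d : measure_display) (T : measurableType d).
Variable mu : {measure set T -> \bar R}.

Definition cintegrable (D : set T) (f : T -> C) : Prop :=
  mu.-integrable D (fun t => (complex.Re (f t))%:E) /\
  mu.-integrable D (fun t => (complex.Im (f t))%:E).

Definition cintegral (D : set T) (f : T -> C) : C :=
  (\int[mu]_(t in D) complex.Re (f t)) +i* (\int[mu]_(t in D) complex.Im (f t)).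

End complex_integral.

(* Lebesgue measure on R^n, with R^n represented by n.-tuple R: the image  *)
(* of lebesgue_measure \x (Lebesgue measure on R^n) under (x, s) |-> x :: s *)
Section lebesgue_tuple.
Variable R : realType.
Local Notation RM := (measurableTypeR R).

Definition tcons n (p : RM * n.-tuple RM) : n.+1.-tuple RM := [tuple of p.1 :: p.2].

Lemma measurable_tcons n : measurable_fun [set: RM * n.-tuple RM] (@tcons n).
Proof. exact: measurable_cons. Qed.

Section step.
Variables (n : nat) (m : {sigma_finite_measure set (n.-tuple RM) -> \bar R}).

Definition leb_step : set (n.+1.-tuple RM) -> \bar R :=
  pushforward (@lebesgue_measure R \x m)%E (@tcons n).

Let leb_step_preimage (A : set (n.+1.-tuple RM)) :
  measurable A -> measurable (@tcons n @^-1` A).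
Proof. by move=> mA; rewrite -[X in measurable X]setTI; exact: measurable_tcons. Qed.

Let leb_step0 : leb_step set0 = 0%E.
Proof. by rewrite /leb_step /pushforward preimage_set0 measure0. Qed.

Let leb_step_ge0 A : (0 <= leb_step A)%E.
Proof. by rewrite /leb_step /pushforward measure_ge0. Qed.

Let leb_step_sigma_additive : semi_sigma_additive leb_step.
Proof.
move=> F mF tF mUF; rewrite /leb_step /pushforward preimage_bigcup.
apply: measure_semi_sigma_additive.
- by move=> i; exact: leb_step_preimage.
- apply/trivIsetP => /= i j _ _ ij; rewrite -preimage_setI.
  by move/trivIsetP : tF => /(_ _ _ _ _ ij) ->//; rewrite preimage_set0.
- by rewrite -preimage_bigcup; exact: leb_step_preimage.
Qed.

HB.instance Definition _ := isMeasure.Build _ _ _ leb_step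
  leb_step0 leb_step_ge0 leb_step_sigma_additive.

Let leb_step_sigma_finite : sigma_finite setT leb_step.
Proof.
have /sigma_finiteP[F [FT ndF Foo]] := sigma_finiteT (@lebesgue_measure R).
have /sigma_finiteP[G [GT ndG Goo]] := sigma_finiteT m.
pose uncons (s : n.+1.-tuple RM) : RM * n.-tuple RM :=
  (thead s, [tuple of behead s]).
have munc : measurable_fun setT uncons.
  apply: measurable_fun_pair; last exact: measurable_behead.
  exact: (measurable_tnth ord0).
have unconsK p : uncons (tcons p) = p.
  by case: p => x s; congr pair; apply/val_inj.
exists (fun i => uncons @^-1` (F i `*` G i)).
  apply/esym/seteqP; split=> // s _.
  have [i _ Fi] : (\bigcup_i F i) (thead s) by rewrite -FT.
  have [j _ Gj] : (\bigcup_i G i) [tuple of behead s] by rewrite -GT.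
  exists (maxn i j) => //; split => /=.
  - by move: Fi; exact/subsetPset/ndF/leq_maxl.
  - by move: Gj; exact/subsetPset/ndG/leq_maxr.
move=> i; have [mFi Fioo] := Foo i; have [mGi Gioo] := Goo i.
have mFG : measurable (F i `*` G i) by exact: measurableX.
split; first by rewrite -[X in measurable X]setTI; exact: munc.
rewrite /leb_step /pushforward -comp_preimage.
rewrite (_ : uncons \o _ = id) ?preimage_id; last exact/funext.
by rewrite product_measure1E// lte_mul_pinfty// ge0_fin_numE.
Qed.

HB.instance Definition _ := Measure_isSigmaFinite.Build _ _ _ leb_step
  leb_step_sigma_finite.

End step.

Fixpoint leb (n : nat) : {sigma_finite_measure set (n.-tuple RM) -> \bar R} :=
  if n is n'.+1 then leb_step (leb n')
  else \d_ ([tuple] : 0.-tuple RM).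

End lebesgue_tuple.
Arguments leb : clear implicits.

Lemma measurable_box (R : realType) n (A : 'I_n -> set (measurableTypeR R)) :
  (forall i, measurable (A i)) ->
  measurable [set s : n.-tuple (measurableTypeR R) | forall i, A i (tnth s i)].
Proof.
move=> mA.
rewrite (_ : [set _ | _] = \bigcap_(i in [set: 'I_n])
  ((fun s : n.-tuple (measurableTypeR R) => tnth s i) @^-1` A i)); last first.
  by apply/seteqP; split => s /= h i => [_|]; exact: h.
apply: fin_bigcap_measurable => // i _.
by rewrite -[X in measurable X]setTI; apply: measurable_tnth.
Qed.

Lemma leb_box (R : realType) n (A : 'I_n -> set (measurableTypeR R)) :
  (forall i, measurable (A i)) ->
  leb R n [set s | forall i, A i (tnth s i)] = (\prod_(i < n) lebesgue_measure (A i))%E.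
Proof.
elim: n A => [|n IH] A mA.
  by rewrite big_ord0 /= diracE mem_set// => -[].
rewrite big_ord_recl -(IH (fun i => A (lift ord0 i)))// /= /leb_step /pushforward.
rewrite -product_measure1E//=; last first.
  by apply: (@measurable_box R n (fun i => A (lift ord0 i))) => i.
congr ((_ \x _)%E _); apply/seteqP; split=> -[x s] /=.
  move=> h; split; first exact: (h ord0).
  by move=> i; move: (h (lift ord0 i)); rewrite tnthS.
move=> [h0 h] i; case: (unliftP ord0 i) => [j|] -> //.
by rewrite tnthS; exact: h.
Qed.

Section special_measures.
Variable R : realType.
Local Notation C := (Cplx R).
Local Notation RM := (measurableTypeR R).

(* t ^ z for t > 0, i.e. exp (z ln t), with modulus t `^ Re z *)
Definition cpow (t : R) (z : C) : C :=
  (t `^ complex.Re z * cos (complex.Im z * ln t)) +i*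
  (t `^ complex.Re z * sin (complex.Im z * ln t)).

(* Euler's integral; only meaningful for Re z > 0 *)
Definition cGamma (z : C) : C :=
  cintegral (@lebesgue_measure R) `]0, +oo[
    (fun t : RM => cpow t (z - 1) * ((expR (- t))%:C : C)).

Definition simplex (k : nat) : set (k.-tuple RM) :=
  [set s | (forall i, 0 <= (tnth s i : R)) /\ \sum_(i < k) (tnth s i : R) <= 1].

(* The complex measures are represented by their densities with respect to *)
(* Lebesgue measure.                                                       *)
Definition beta_density (al be : C) (t : R) : C :=
  cGamma (al + be) / (cGamma al * cGamma be) *
  (cpow t (al - 1) * cpow (1 - t) (be - 1)).

Definition dirichlet_density (k : nat) (la : 'rV[C]_k) (al : C)
    (s : k.-tuple RM) : C :=
  cGamma (vsum la + al) / ((\prod_(i < k) cGamma (la 0 i)) * cGamma al) *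
  ((\prod_(i < k) cpow (tnth s i) (la 0 i - 1)) *
   cpow (1 - \sum_(i < k) (tnth s i : R)) (al - 1)).

End special_measures.
Arguments simplex : clear implicits.

(* Main.v *)
(* Phi_2[a; c; x] is the Dirichlet average of exp <x o u>, so the product of   *)
(* the two Phi_2 is the average of exp <x o u + y o v> over E_k x E_k.         *)
(* Conversely exp z is the beta average over t of 1F1[g; h; t z], and exp <w>  *)
(* is the Dirichlet average over t of Psi_2[g; h; w o t]; substituting z or w  *)
(* and applying Fubini gives both formulas. All three averages are computed    *)
(* termwise, from the Dirichlet moments                                        *)
(*   int s^m dmu_(la,al) = prod (la_i)_(m_i) / (<la> + al)_<m>,                *)
(* which reduce by induction on k to B(a,b) Gamma(a+b) = Gamma(a) Gamma(b).    *)
(* Normalizing the moments uses Gamma <> 0 on Re z > 0, which holds for Re z   *)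
(* large and is brought back by Gamma(z + 1) = z Gamma(z).                     *)

From HB Require Import structures.
Require Import Defs.
From mathcomp Require Import all_boot all_order all_algebra.
From mathcomp Require Import all_classical all_reals all_analysis.
From mathcomp Require Import complex measurable_realfun summability finmap ring lra.

Set Implicit Arguments.
Unset Strict Implicit.
Unset Printing Implicit Defensive.

Import Order.TTheory GRing.Theory Num.Theory numFieldNormedType.Exports.

Local Open Scope classical_set_scope.
Local Open Scope ring_scope.
Local Open Scope complex_scope.

(** Every function involved is a power series [hyper_term coef w], with terms coef(m) w^m / m!, and
    averaging it over s at the argument w o s against a density multiplies coef(m) by the moment of
    s^m. The exponential of <w> is the series with all coefficients 1. Its Dirichlet average at w =
    x o u therefore has the coefficients of [Phi2] ([Phi2_integral]). In the other direction the
    coefficients of [Psi2] and [hyp1F1] are the inverses of the moments of the density over t, so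
    their averages are the exponential again ([Psi2_integral], [hyp1F1_integral]). Additivity
    [cexpD] merges exp <x o u> and exp <y o v> into one exponential, to which these representations
    apply.

    Exchanging sum and average rests on growth bounds: the coefficients grow at most geometrically
    in <m> ([Phi2_coef_le], [Psi2_coef_le], [poch_ratio]), so partial sums over the boxes [0, N[^k
    are bounded uniformly on the support of the density and dominated convergence applies
    ([hyper_sum_density], [hyp1F1_density]). [box_sum_cvg] identifies the limit of the box sums with
    the unordered sum.

    The moments come from [dirichlet_integral]: slicing off one coordinate leaves a Dirichlet
    integral of lower dimension on a smaller simplex, and the slices are assembled by a beta
    integral, evaluated by [cGammaM]. Dividing by Gamma factors is justified by [cGamma_neq0]. *)

Notation cabs := ComplexField.Normc.normc.

(** * Complex modulus and convergence *)

Section complex_modulus.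
Variable R : realType.
Local Notation C := (Cplx R).
Implicit Types x y z : C.

Lemma CReD x y : complex.Re (x + y) = complex.Re x + complex.Re y.
Proof. by case: x y => [a b] [c d]. Qed.

Lemma CImD x y : complex.Im (x + y) = complex.Im x + complex.Im y.
Proof. by case: x y => [a b] [c d]. Qed.

Lemma CReN x : complex.Re (- x) = - complex.Re x.
Proof. by case: x. Qed.

Lemma CImN x : complex.Im (- x) = - complex.Im x.
Proof. by case: x. Qed.

Lemma CReB x y : complex.Re (x - y) = complex.Re x - complex.Re y.
Proof. by rewrite CReD CReN. Qed.

Lemma CImB x y : complex.Im (x - y) = complex.Im x - complex.Im y.
Proof. by rewrite CImD CImN. Qed.

Lemma CReM x y : complex.Re (x * y) =
  complex.Re x * complex.Re y - complex.Im x * complex.Im y.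
Proof. by case: x y => [a b] [c d]. Qed.

Lemma CImM x y : complex.Im (x * y) =
  complex.Re x * complex.Im y + complex.Im x * complex.Re y.
Proof. by case: x y => [a b] [c d]. Qed.

Lemma CRe_sum I (r : seq I) (P : pred I) (F : I -> C) :
  complex.Re (\sum_(i <- r | P i) F i) = \sum_(i <- r | P i) complex.Re (F i).
Proof. by elim/big_ind2: _ => // x a y b <- <-; rewrite CReD. Qed.

Lemma CIm_sum I (r : seq I) (P : pred I) (F : I -> C) :
  complex.Im (\sum_(i <- r | P i) F i) = \sum_(i <- r | P i) complex.Im (F i).
Proof. by elim/big_ind2: _ => // x a y b <- <-; rewrite CImD. Qed.

Lemma CRe_nat n : complex.Re (n%:R : C) = n%:R.
Proof. by elim: n => // n IH; rewrite -natr1 CReD IH -natr1. Qed.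

Lemma CIm_nat n : complex.Im (n%:R : C) = 0.
Proof. by elim: n => // n IH; rewrite -natr1 CImD IH add0r. Qed.

Lemma Ceq x y : complex.Re x = complex.Re y -> complex.Im x = complex.Im y -> x = y.
Proof. by case: x y => [a b] [c d] /= -> ->. Qed.

Lemma cabsE z : cabs z = Num.sqrt (complex.Re z ^+ 2 + complex.Im z ^+ 2).
Proof. by case: z. Qed.

Lemma cabs_ge0 z : 0 <= cabs z.
Proof. by rewrite cabsE sqrtr_ge0. Qed.

Lemma cabsM x y : cabs (x * y) = cabs x * cabs y.
Proof. exact: ComplexField.Normc.normcM. Qed.

Lemma cabsV x : cabs x^-1 = (cabs x)^-1.
Proof. exact: ComplexField.Normc.normcV. Qed.

Lemma cabs0 : cabs (0 : C) = 0.
Proof. exact: ComplexField.Normc.normc0. Qed.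

Lemma cabs1 : cabs (1 : C) = 1.
Proof. exact: ComplexField.Normc.normc1. Qed.

Lemma cabsD x y : cabs (x + y) <= cabs x + cabs y.
Proof. exact: le_normcD. Qed.

Lemma cabsN x : cabs (- x) = cabs x.
Proof. exact: normcN. Qed.

Lemma cabs_eq0 x : cabs x = 0 -> x = 0.
Proof. exact: ComplexField.Normc.eq0_normc. Qed.

Lemma cabs_prod I (r : seq I) (P : pred I) (F : I -> C) :
  cabs (\prod_(i <- r | P i) F i) = \prod_(i <- r | P i) cabs (F i).
Proof.
elim/big_ind2: _ => [|x a y b <- <-|//]; first exact: cabs1.
by rewrite cabsM.
Qed.

Lemma cabs_sum I (r : seq I) (P : pred I) (F : I -> C) :
  cabs (\sum_(i <- r | P i) F i) <= \sum_(i <- r | P i) cabs (F i).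
Proof.
elim/big_ind2: _ => [|x a y b xa yb|//]; first by rewrite cabs0.
by rewrite (le_trans (cabsD _ _))// lerD.
Qed.

Lemma cabsX z n : cabs (z ^+ n) = cabs z ^+ n.
Proof. by elim: n => [|n IH]; rewrite ?expr0 ?cabs1// !exprS cabsM IH. Qed.

Lemma cabs_real (r : R) : cabs (r%:C : C) = `|r|.
Proof. by rewrite cabsE /= expr0n addr0 sqrtr_sqr. Qed.

Lemma creal_nat n : ((n%:R : R)%:C : C) = n%:R.
Proof. by apply: Ceq; rewrite ?CRe_nat ?CIm_nat. Qed.

Lemma cabs_nat n : cabs (n%:R : C) = n%:R.
Proof. by rewrite -creal_nat cabs_real ger0_norm. Qed.

Lemma Re_le_cabs z : `|complex.Re z| <= cabs z.
Proof. by rewrite -sqrtr_sqr cabsE; apply: ler_wsqrtr; rewrite lerDl sqr_ge0. Qed.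

Lemma Im_le_cabs z : `|complex.Im z| <= cabs z.
Proof. by rewrite -sqrtr_sqr cabsE; apply: ler_wsqrtr; rewrite lerDr sqr_ge0. Qed.

Lemma cabs_le z : cabs z <= `|complex.Re z| + `|complex.Im z|.
Proof.
rewrite cabsE -[leRHS]ger0_norm ?addr_ge0// -[leRHS]sqrtr_sqr.
apply: ler_wsqrtr; rewrite sqrrD !real_normK ?num_real// addrAC lerDl mulrn_wge0//.
Qed.

Lemma crealM (r s : R) : ((r * s)%:C : C) = r%:C * s%:C.
Proof. exact: (rmorphM (real_complex R)). Qed.

Lemma crealD (r s : R) : ((r + s)%:C : C) = r%:C + s%:C.
Proof. exact: (rmorphD (real_complex R)). Qed.

Lemma crealX (r : R) n : ((r ^+ n)%:C : C) = r%:C ^+ n.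
Proof. exact: (rmorphXn (real_complex R)). Qed.

Lemma creal_prod I (r : seq I) (P : pred I) (F : I -> R) :
  ((\prod_(i <- r | P i) F i)%:C : C) = \prod_(i <- r | P i) (F i)%:C.
Proof. exact: (rmorph_prod (real_complex R)). Qed.

End complex_modulus.

Section complex_convergence.
Variable R : realType.
Local Notation C := (Cplx R).

(** The norm of C takes its values in C, as the embedded real modulus, and a positive element of C
    is a positive real. Hence the C-valued epsilons of the norm topology reduce to real ones. *)
Lemma ccvgP T (F : set_system T) (FF : Filter F) (u : T -> C) (l : C) :
  ((u : T -> C^o) @ F --> (l : C^o)) <->
  ((fun t => complex.Re (u t)) @ F --> complex.Re l /\
   (fun t => complex.Im (u t)) @ F --> complex.Im l).
Proof.
split.
  move/cvgrPdist_lt => h.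
  have {}h (e : R) : 0 < e -> \forall t \near F, cabs (l - u t) < e.
    move=> e0; have e0' : 0 < (e%:C : C) by rewrite ltcR.
    apply: filterS (h _ e0') => t.
    by rewrite -(ltcR (cabs _)).
  split; apply/cvgrPdist_lt => e e0; apply: filterS (h _ e0) => t; apply: le_lt_trans.
    by rewrite -CReB; exact: Re_le_cabs.
  by rewrite -CImB; exact: Im_le_cabs.
move=> [/cvgrPdist_lt hr /cvgrPdist_lt hi]; apply/cvgrPdist_lt => e e0.
have [r0 er] : 0 < complex.Re e /\ e = (complex.Re e)%:C.
  by move: e0; case: (e) => a b; rewrite ltcE /= => /andP[/eqP -> ?].
have r20 : 0 < complex.Re e / 2 by rewrite divr_gt0.
near=> t.
suff : cabs (l - u t) < complex.Re e by rewrite er -(ltcR (cabs _)).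
apply: (le_lt_trans (cabs_le _)); rewrite CReB CImB.
rewrite [ltRHS]splitr ltrD//; near: t; [exact: hr|exact: hi].
Unshelve. all: by end_near. Qed.

Lemma ccvg_cabs T (F : set_system T) (FF : Filter F) (u : T -> C) (l : C) :
  (fun t => cabs (u t - l)) @ F --> (0 : R) -> (u : T -> C^o) @ F --> (l : C^o).
Proof.
move=> /cvgrPdist_lt h; apply/ccvgP; split; apply/cvgrPdist_lt => e e0;
  apply: filterS (h _ e0) => t; rewrite sub0r normrN ger0_norm ?cabs_ge0//;
  apply: le_lt_trans; rewrite distrC.
  by rewrite -CReB Re_le_cabs.
by rewrite -CImB Im_le_cabs.
Qed.

Lemma cabs_cvg T (F : set_system T) (FF : Filter F) (u : T -> C) (l : C) :
  (u : T -> C^o) @ F --> (l : C^o) -> (fun t => cabs (u t - l)) @ F --> (0 : R).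
Proof.
move=> /ccvgP[/cvgrPdist_lt hr /cvgrPdist_lt hi]; apply/cvgrPdist_lt => e e0.
have e20 : 0 < e / 2 by rewrite divr_gt0.
near=> t; rewrite sub0r normrN ger0_norm ?cabs_ge0// -cabsN opprB.
apply: (le_lt_trans (cabs_le _)); rewrite CReB CImB.
by rewrite [ltRHS]splitr ltrD//; near: t; [exact: hr|exact: hi].
Unshelve. all: by end_near. Qed.

Lemma ccvg_eq (u : nat -> C) (l l' : C) :
  ((u : nat -> C^o) @ \oo --> (l : C^o)) ->
  ((u : nat -> C^o) @ \oo --> (l' : C^o)) -> l = l'.
Proof. by move=> h h'; exact: (cvg_unique (@norm_hausdorff _ _) h h'). Qed.

End complex_convergence.

(** * Complex-valued integrals *)

Section complex_measurability.
Variable R : realType.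
Local Notation C := (Cplx R).
Context d (T : measurableType d).
Implicit Types f g : T -> C.

Definition cmeasurable f : Prop :=
  measurable_fun setT (fun t => complex.Re (f t)) /\
  measurable_fun setT (fun t => complex.Im (f t)).

Lemma cmeasurable_cst (c : C) : cmeasurable (fun=> c).
Proof. by split; exact: measurable_cst. Qed.

Lemma cmeasurable_real (f : T -> R) :
  measurable_fun setT f -> cmeasurable (fun t => (f t)%:C).
Proof. by move=> mf; split => //=; exact: measurable_cst. Qed.

Lemma cmeasurableD f g : cmeasurable f -> cmeasurable g ->
  cmeasurable (fun t => f t + g t).
Proof.
move=> [rf jf] [rg jg]; split.
  by under eq_fun do rewrite CReD; exact: measurable_funD.
by under eq_fun do rewrite CImD; exact: measurable_funD.
Qed.

Lemma cmeasurableM f g : cmeasurable f -> cmeasurable g ->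
  cmeasurable (fun t => f t * g t).
Proof.
move=> [rf jf] [rg jg]; split.
  by under eq_fun do rewrite CReM; apply: measurable_funB; exact: measurable_funM.
by under eq_fun do rewrite CImM; apply: measurable_funD; exact: measurable_funM.
Qed.

Lemma cmeasurableX f n : cmeasurable f -> cmeasurable (fun t => f t ^+ n).
Proof.
move=> mf; elim: n => [|n IH].
  by under eq_fun do rewrite expr0; exact: cmeasurable_cst.
by under eq_fun do rewrite exprS; exact: cmeasurableM.
Qed.

Lemma cmeasurable_sum I (r : seq I) (F : I -> T -> C) :
  (forall i, cmeasurable (F i)) -> cmeasurable (fun t => \sum_(i <- r) F i t).
Proof.
move=> mF; elim: r => [|i r IH].
  by under eq_fun do rewrite big_nil; exact: cmeasurable_cst.
by under eq_fun do rewrite big_cons; exact: cmeasurableD.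
Qed.

Lemma cmeasurable_prod I (r : seq I) (F : I -> T -> C) :
  (forall i, cmeasurable (F i)) -> cmeasurable (fun t => \prod_(i <- r) F i t).
Proof.
move=> mF; elim: r => [|i r IH].
  by under eq_fun do rewrite big_nil; exact: cmeasurable_cst.
by under eq_fun do rewrite big_cons; exact: cmeasurableM.
Qed.

Lemma measurable_cabs f : cmeasurable f -> measurable_fun setT (fun t => cabs (f t)).
Proof.
move=> [rf jf]; under eq_fun do rewrite cabsE.
apply: (@measurableT_comp _ _ _ _ _ _ (@Num.sqrt R)).
  by apply: continuous_measurable_fun; exact: sqrt_continuous.
by apply: measurable_funD; exact: measurable_funX.
Qed.

Lemma cmeasurable_comp d' (S : measurableType d') (f : S -> C) (phi : T -> S) :
  measurable_fun setT phi ->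
  measurable_fun setT (fun s => complex.Re (f s)) ->
  measurable_fun setT (fun s => complex.Im (f s)) ->
  cmeasurable (fun t => f (phi t)).
Proof.
move=> mphi rf jf.
by split; [exact: (measurableT_comp rf)|exact: (measurableT_comp jf)].
Qed.

End complex_measurability.

Section complex_integral_theory.
Variable R : realType.
Local Notation C := (Cplx R).
Context d (T : measurableType d) (mu : {measure set T -> \bar R}).
Implicit Types f g : T -> C.

Local Notation cintg f := (cintegrable mu setT f).
Local Notation I f := (cintegral mu setT f).

Lemma cintg_meas f : cintg f -> cmeasurable f.
Proof. by move=> [/measurable_int/measurable_EFinP ? /measurable_int/measurable_EFinP]. Qed.

Lemma cintg_le f (g : T -> R) : cmeasurable f ->
  mu.-integrable setT (fun t => (g t)%:E) -> (forall t, cabs (f t) <= g t) ->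
  cintg f.
Proof.
move=> [rf jf] ig fg; split; apply: (le_integrable _ _ _ ig) => //.
- exact/measurable_EFinP.
- move=> t _; rewrite lee_fin (le_trans (Re_le_cabs _))// (le_trans (fg t))//.
  exact: ler_norm.
- exact/measurable_EFinP.
- move=> t _; rewrite lee_fin (le_trans (Im_le_cabs _))// (le_trans (fg t))//.
  exact: ler_norm.
Qed.

Lemma cintg_cabs f : cintg f -> mu.-integrable setT (fun t => (cabs (f t))%:E).
Proof.
move=> iF; have mf := cintg_meas iF; case: iF => rf jf.
have := integrableD measurableT (integrable_norm rf) (integrable_norm jf).
apply: le_integrable => //; first by apply/measurable_EFinP; exact: measurable_cabs.
move=> t _ /=; rewrite lee_fin ger0_norm ?cabs_ge0//.
by rewrite ger0_norm ?addr_ge0// cabs_le.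
Qed.

Lemma cintg_dom f g (M : R) : cmeasurable f -> cintg g ->
  (forall t, cabs (f t) <= M * cabs (g t)) -> cintg f.
Proof.
move=> mf ig fg; apply: cintg_le (fg) => //.
under eq_fun do rewrite EFinM.
by apply: integrableZl => //; exact: cintg_cabs.
Qed.

Lemma cintg0 : cintg (fun=> 0).
Proof. by split; exact: integrable0. Qed.

Lemma cintegral0 : I (fun=> 0) = 0.
Proof. by apply: Ceq; rewrite /= /Rintegral integral0. Qed.

Lemma cintgD f g : cintg f -> cintg g -> cintg (fun t => f t + g t).
Proof.
move=> [rf jf] [rg jg]; split.
  by under eq_fun do rewrite CReD EFinD; exact: integrableD.
by under eq_fun do rewrite CImD EFinD; exact: integrableD.
Qed.

Lemma cintegralD f g : cintg f -> cintg g -> I (fun t => f t + g t) = I f + I g.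
Proof.
move=> [rf jf] [rg jg]; apply: Ceq; rewrite ?CReD ?CImD /=.
  by under eq_Rintegral do rewrite CReD; rewrite RintegralD.
by under eq_Rintegral do rewrite CImD; rewrite RintegralD.
Qed.

Lemma cintgZ (c : C) f : cintg f -> cintg (fun t => c * f t).
Proof.
move=> iF; apply: (@cintg_dom _ f (cabs c)) => //.
  by apply: cmeasurableM (cintg_meas iF); exact: cmeasurable_cst.
by move=> t; rewrite cabsM.
Qed.

Lemma cintegralZ (c : C) f : cintg f -> I (fun t => c * f t) = c * I f.
Proof.
move=> [rf jf].
have iZ r (g : T -> R) : mu.-integrable setT (fun t => (g t)%:E) ->
    mu.-integrable setT (EFin \o (fun t => r * g t)).
  by move=> ig; rewrite /comp; under eq_fun do rewrite EFinM; exact: integrableZl.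
apply: Ceq; rewrite ?CReM ?CImM /=.
  under eq_Rintegral do rewrite CReM.
  by rewrite RintegralB ?RintegralZl//; exact: iZ.
under eq_Rintegral do rewrite CImM.
by rewrite RintegralD ?RintegralZl//; exact: iZ.
Qed.

Lemma cintegralZr (c : C) f : cintg f -> I (fun t => f t * c) = I f * c.
Proof.
move=> iF; rewrite [RHS]mulrC -cintegralZ//; congr (I _).
by apply/funext => t; rewrite mulrC.
Qed.

Lemma cintg_sum J (r : seq J) (F : J -> T -> C) :
  (forall i, cintg (F i)) -> cintg (fun t => \sum_(i <- r) F i t).
Proof.
move=> mF; elim: r => [|i r IH].
  by under eq_fun do rewrite big_nil; exact: cintg0.
by under eq_fun do rewrite big_cons; exact: cintgD.
Qed.

Lemma cintegral_sum J (r : seq J) (F : J -> T -> C) :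
  (forall i, cintg (F i)) ->
  I (fun t => \sum_(i <- r) F i t) = \sum_(i <- r) I (F i).
Proof.
move=> mF; elim: r => [|i r IH].
  by rewrite big_nil; under eq_fun do rewrite big_nil; exact: cintegral0.
rewrite big_cons -IH -cintegralD//; last exact: cintg_sum.
by congr (I _); apply/funext => t; rewrite big_cons.
Qed.

(** The exceptional set is explicit because it is always known: the boundary of a simplex or the
    endpoints of an interval, where truncated kernels and actual densities may disagree. *)
Lemma cintegral_ae f g (N : set T) : cmeasurable f -> cmeasurable g ->
  measurable N -> mu N = 0%E -> (forall t, ~ N t -> f t = g t) -> I f = I g.
Proof.
move=> [rf jf] [rg jg] mN N0 fg.
have Nae P : (forall t, ~ N t -> P t) -> {ae mu, forall t, P t}.
  by move=> NP; exists N; split => // t /= Pt; apply: contrapT => /NP.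
apply: Ceq => /=; congr fine; apply: ae_eq_integral => //.
- exact/measurable_EFinP.
- exact/measurable_EFinP.
- by apply: Nae => t /fg ->.
- exact/measurable_EFinP.
- exact/measurable_EFinP.
- by apply: Nae => t /fg ->.
Qed.

Lemma cintg_ae f g (N : set T) : cmeasurable f -> cintg g ->
  measurable N -> mu N = 0%E -> (forall t, ~ N t -> f t = g t) -> cintg f.
Proof.
move=> mf ig mN N0 fg; have mg := cintg_meas ig.
apply: (cintg_le (g := fun t => cabs (f t))) => //.
apply/integrableP; split; first by apply/measurable_EFinP; exact: measurable_cabs.
have /integrableP[_] := cintg_cabs ig; congr (_ < _)%E.
apply: ae_eq_integral => //.
- by do 2 apply: measurableT_comp => //; exact: measurable_cabs.
- by do 2 apply: measurableT_comp => //; exact: measurable_cabs.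
- by exists N; split => // t /= ft; apply: contrapT => /fg fgt; apply: ft => _; rewrite fgt.
Qed.

Lemma cdominated_cvg (u : nat -> T -> C) f (g : T -> R) :
  (forall n, cmeasurable (u n)) ->
  (forall t, ((fun n => u n t) : nat -> C^o) @ \oo --> (f t : C^o)) ->
  mu.-integrable setT (fun t => (g t)%:E) ->
  (forall n t, cabs (u n t) <= g t) ->
  cintg f /\ ((fun n => I (u n)) : nat -> C^o) @ \oo --> (I f : C^o).
Proof.
move=> mu_ uf ig ug.
(* [p] stands for the real or the imaginary part; both are bounded by the modulus, so one real
   dominated convergence argument serves twice. *)
have real_case (p : C -> R) : (forall z, `|p z| <= cabs z) ->
    (forall n, measurable_fun setT (fun t => p (u n t))) ->
    (forall t, (fun n => p (u n t)) @ \oo --> p (f t)) ->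
  mu.-integrable setT (fun t => (p (f t))%:E) /\
  (fun n => \int[mu]_(t in setT) p (u n t)) @ \oo --> \int[mu]_(t in setT) p (f t).
  move=> pc mp pf.
  have mpf : measurable_fun setT (fun t => p (f t)).
    exact: (measurable_fun_cvg mp).
  have [|||||ipf _ cf] := @dominated_convergence _ _ _ mu setT measurableT
      (fun n t => (p (u n t))%:E) (fun t => (p (f t))%:E) (fun t => (g t)%:E).
  - by move=> n; exact/measurable_EFinP.
  - exact/measurable_EFinP.
  - by apply: aeW => t _; apply: cvg_EFin; [exact: nearW|exact: pf].
  - exact: ig.
  - by apply: aeW => t n _; rewrite lee_fin (le_trans (pc _)).
  split => //; apply: fine_cvg; rewrite fineK//.
  exact: integrable_fin_num.
have [rf rc] := real_case (@complex.Re R) (@Re_le_cabs R)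
  (fun n => (mu_ n).1) (fun t => ((ccvgP _ _ _).1 (uf t)).1).
have [jf jc] := real_case (@complex.Im R) (@Im_le_cabs R)
  (fun n => (mu_ n).2) (fun t => ((ccvgP _ _ _).1 (uf t)).2).
by split => //; apply/ccvgP; split.
Qed.

End complex_integral_theory.

(** * Change of variables along a pushforward *)

Section complex_pushforward.
Variable R : realType.
Local Notation C := (Cplx R).
Context d1 d2 (X : measurableType d1) (Y : measurableType d2).
Variables (mu : {measure set X -> \bar R}) (phi : X -> Y).
Hypothesis mphi : measurable_fun setT phi.
Variable nu : {measure set Y -> \bar R}.
Hypothesis nuE : forall A, measurable A -> nu A = pushforward mu phi A.

Lemma cintg_pushforward (f : Y -> C) : cmeasurable f ->
  cintegrable mu setT (fun x => f (phi x)) -> cintegrable nu setT f.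
Proof.
move=> mf iF; apply: (cintg_le (g := fun t => cabs (f t))) => //.
apply/integrableP; split; first by apply/measurable_EFinP; exact: measurable_cabs.
have /integrableP[_] := cintg_cabs iF; congr (_ < _)%E; apply/esym.
rewrite (eq_measure_integral (pushforward mu phi)); last first.
  by move=> A mA _; exact: nuE.
rewrite ge0_integral_pushforward ?preimage_setT//.
by do 2 apply: measurableT_comp => //; exact: measurable_cabs.
Qed.

Lemma cintegral_pushforward (f : Y -> C) : cmeasurable f ->
  cintegrable mu setT (fun x => f (phi x)) ->
  cintegral nu setT f = cintegral mu setT (fun x => f (phi x)).
Proof.
move=> [rf jf] [irf ijf]; apply: Ceq => /=; congr fine.
  rewrite (eq_measure_integral (pushforward mu phi)); last first.
    by move=> A mA _; exact: nuE.
  rewrite (@integral_pushforward _ _ _ _ _ _ mphi) ?preimage_setT//.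
  exact/measurable_EFinP.
rewrite (eq_measure_integral (pushforward mu phi)); last first.
  by move=> A mA _; exact: nuE.
rewrite (@integral_pushforward _ _ _ _ _ _ mphi) ?preimage_setT//.
exact/measurable_EFinP.
Qed.

End complex_pushforward.

(** * Fubini and Tonelli for complex functions *)

Section complex_fubini.
Variable R : realType.
Local Notation C := (Cplx R).
Context d1 d2 (T1 : measurableType d1) (T2 : measurableType d2).
Variables (m1 : {sigma_finite_measure set T1 -> \bar R})
          (m2 : {sigma_finite_measure set T2 -> \bar R}).

(** The real inner integral replaces an infinite section integral by 0, so it can differ from
    [fubini_F] only where the latter is infinite. Integrability makes that set null. *)
Lemma Rfubini (f : T1 * T2 -> R) :
  (m1 \x m2)%E.-integrable setT (fun z => (f z)%:E) ->
  m1.-integrable setT (fun x => (\int[m2]_(y in setT) f (x, y))%:E) /\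
  \int[(m1 \x m2)%E]_(z in setT) f z =
  \int[m1]_(x in setT) \int[m2]_(y in setT) f (x, y).
Proof.
move=> iF; have iff := integrable_fubini_F iF.
have mF : measurable_fun setT (fun x => (\int[m2]_(y in setT) f (x, y))%:E).
  apply/measurable_EFinP; apply: (@measurableT_comp _ _ _ _ _ _ (@fine R)).
    exact: fine_measurable.
  exact: (measurable_int _ iff).
split.
  apply: le_integrable (iff) => // x _; rewrite /Rintegral /fubini_F.
  by case: (integral _ _ _) => [r| |]//=; rewrite normr0 leey.
rewrite /Rintegral -integral12_prod_meas1//; congr fine.
apply: ae_eq_integral => //; first exact: (measurable_int _ iff).
apply: filterS (integrable_ae measurableT iff) => x /(_ I) /= h _.
by rewrite /Rintegral fineK.
Qed.

Lemma cfubini (f : T1 * T2 -> C) : cintegrable (m1 \x m2)%E setT f ->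
  cintegrable m1 setT (fun x => cintegral m2 setT (fun y => f (x, y))) /\
  cintegral (m1 \x m2)%E setT f =
  cintegral m1 setT (fun x => cintegral m2 setT (fun y => f (x, y))).
Proof.
by move=> [/Rfubini[irf rf] /Rfubini[ijf jf]]; split => //; apply: Ceq.
Qed.

Lemma cintg_prod12 (f : T1 * T2 -> C) : cmeasurable f ->
  (\int[m1]_x \int[m2]_y (cabs (f (x, y)))%:E < +oo)%E ->
  cintegrable (m1 \x m2)%E setT f.
Proof.
move=> mf h; apply: (cintg_le (g := fun t => cabs (f t))) => //.
apply/integrable12ltyP; first by apply/measurable_EFinP; exact: measurable_cabs.
have absE x : (\int[m2]_y `|(cabs (f (x, y)))%:E| =
               \int[m2]_y (cabs (f (x, y)))%:E)%E.
  by apply: eq_integral => y _; rewrite gee0_abs// lee_fin cabs_ge0.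
by under eq_integral do rewrite absE.
Qed.

Lemma cmeasurable_pair1 (f : T1 * T2 -> C) x : cmeasurable f ->
  cmeasurable (fun y => f (x, y)).
Proof.
by move=> [rf jf]; apply: (cmeasurable_comp (phi := pair x)).
Qed.

Lemma cintegral_prod (f : T1 -> C) (g : T2 -> C) :
  cintegrable m1 setT f -> cintegrable m2 setT g ->
  cintegrable (m1 \x m2)%E setT (fun z => f z.1 * g z.2) /\
  cintegral (m1 \x m2)%E setT (fun z => f z.1 * g z.2) =
  cintegral m1 setT f * cintegral m2 setT g.
Proof.
move=> iF ig; have [rf jf] := cintg_meas iF; have [rg jg] := cintg_meas ig.
have h : cintegrable (m1 \x m2)%E setT (fun z => f z.1 * g z.2).
  apply: cintg_prod12.
    apply: cmeasurableM.
      exact: (cmeasurable_comp (phi := fst)).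
    exact: (cmeasurable_comp (phi := snd)).
  have /integrableP[mcf] := cintg_cabs iF; have /integrableP[mcg] := cintg_cabs ig.
  under [X in (X < _)%E]eq_integral do rewrite gee0_abs ?lee_fin ?cabs_ge0//.
  under [X in _ -> (X < _)%E -> _]eq_integral do
    rewrite gee0_abs ?lee_fin ?cabs_ge0//.
  move=> fin_g fin_f.
  under eq_integral => x _.
    under eq_integral do rewrite /= cabsM EFinM.
    rewrite ge0_integralZl//; last 2 first.
      by move=> y _; rewrite lee_fin cabs_ge0.
      by rewrite lee_fin cabs_ge0.
    over.
  rewrite ge0_integralZr//.
    by rewrite lte_mul_pinfty// ?integral_ge0// ?ge0_fin_numE// ?integral_ge0// => x _;
      rewrite lee_fin cabs_ge0.
    by move=> x _; rewrite lee_fin cabs_ge0.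
  by apply: integral_ge0 => x _; rewrite lee_fin cabs_ge0.
split => //; have [_ ->] := cfubini h.
rewrite -cintegralZr//; congr (cintegral _ _ _); apply/funext => x /=.
by rewrite cintegralZ.
Qed.

End complex_fubini.

Section complex_fubini_swap.
Variable R : realType.
Local Notation C := (Cplx R).
Context d1 d2 (T1 : measurableType d1) (T2 : measurableType d2).
Variables (m1 : {sigma_finite_measure set T1 -> \bar R})
          (m2 : {sigma_finite_measure set T2 -> \bar R}).

Lemma Rfubini_swap (f : T1 * T2 -> R) :
  (m1 \x m2)%E.-integrable setT (fun z => (f z)%:E) ->
  (m2 \x m1)%E.-integrable setT (fun z => (f (z.2, z.1))%:E) /\
  \int[(m1 \x m2)%E]_(z in setT) f z = \int[(m2 \x m1)%E]_(z in setT) f (z.2, z.1).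
Proof.
move=> iF.
have mf : measurable_fun setT f.
  by have /measurable_EFinP := measurable_int _ iF.
have mfs : measurable_fun setT (fun z : T2 * T1 => (f (z.2, z.1))%:E).
  apply/measurable_EFinP; apply: (measurableT_comp mf).
  by apply: measurable_fun_pair.
have is_ : (m2 \x m1)%E.-integrable setT (fun z => (f (z.2, z.1))%:E).
  apply/integrable12ltyP => //.
  by have := (integrable21ltyP m1 m2 (measurable_int _ iF)).1 iF.
split => //; congr fine.
by rewrite -integral21_prod_meas1// -integral12_prod_meas1.
Qed.

Lemma cfubini_swap (f : T1 * T2 -> C) : cintegrable (m1 \x m2)%E setT f ->
  cintegrable m2 setT (fun y => cintegral m1 setT (fun x => f (x, y))) /\
  cintegral (m1 \x m2)%E setT f =
  cintegral m2 setT (fun y => cintegral m1 setT (fun x => f (x, y))).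
Proof.
move=> [/Rfubini_swap[irf rf] /Rfubini_swap[ijf jf]].
have [i21 e21] := @cfubini R _ _ _ _ m2 m1 (fun z => f (z.2, z.1)) (conj irf ijf).
by split => //; rewrite -e21; apply: Ceq.
Qed.

End complex_fubini_swap.

(** * Integrals over a subset as integrals over the whole space *)

Section complex_restriction.
Variable R : realType.
Local Notation C := (Cplx R).
Context d (T : measurableType d) (mu : {measure set T -> \bar R}).
Variables (D : set T) (mD : measurable D).

Lemma cmeasurable_indic : cmeasurable (fun t => (\1_D t)%:C : C).
Proof. by apply: cmeasurable_real; exact: measurable_indic. Qed.

Lemma cintg_indic (f : T -> C) : cintegrable mu D f <->
  cintegrable mu setT (fun t => (\1_D t)%:C * f t).
Proof.
have ER : (fun t => (complex.Re (f t))%:E) \_ D =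
    fun t => (complex.Re ((\1_D t)%:C * f t))%:E.
  apply/funext => t; rewrite patchE indicE; case: ifPn => _.
    by rewrite CReM /= mul1r mul0r subr0.
  by rewrite CReM /= !mul0r subr0.
have EI : (fun t => (complex.Im (f t))%:E) \_ D =
    fun t => (complex.Im ((\1_D t)%:C * f t))%:E.
  apply/funext => t; rewrite patchE indicE; case: ifPn => _.
    by rewrite CImM /= mul1r mul0r addr0.
  by rewrite CImM /= !mul0r addr0.
rewrite /cintegrable -ER -EI; split=> -[h1 h2].
  by split; apply/(integrable_mkcond _ mD).
by split; apply/(integrable_mkcond _ mD).
Qed.

Lemma cintegral_indic (f : T -> C) : cintegral mu D f =
  cintegral mu setT (fun t => (\1_D t)%:C * f t).
Proof.
apply: Ceq => /=; rewrite Rintegral_mkcond; apply: eq_Rintegral => t _;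
  rewrite patchE indicE; case: ifPn => _.
- by rewrite CReM /= mul1r mul0r subr0.
- by rewrite CReM /= !mul0r subr0.
- by rewrite CImM /= mul1r mul0r addr0.
- by rewrite CImM /= !mul0r addr0.
Qed.

End complex_restriction.

(** * Beta and gamma integrals *)

Section lebesgue_affine.
Variable R : realType.
Local Notation C := (Cplx R).
Local Notation RM := (measurableTypeR R).
Local Notation mu := (@lebesgue_measure R).

Lemma measurable_shift (s : R) : measurable_fun setT (fun u : RM => u + s : RM).
Proof. by apply: measurable_funD => //; exact: measurable_cst. Qed.

Lemma lebesgue_shift (s : R) (A : set RM) : measurable A ->
  mu A = pushforward mu (fun u : RM => u + s : RM) A.
Proof.
move=> mA; apply: lebesgue_measure_unique => //=.
  exact: measurable_shift.
move=> _ _ [[a b]] _ <-.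
rewrite /pushforward (_ : _ @^-1` _ = `]a - s, b - s]%classic); last first.
  by apply/seteqP; split => u; rewrite /= !in_itv/= ltrBlDr lerBrDr.
rewrite !lebesgue_measure_itv/= !lte_fin ltrD2r.
by case: ifP => // _; rewrite -!EFinB; congr EFin; ring.
Qed.

Lemma measurable_scale (r : R) : measurable_fun setT (fun t : RM => r * t : RM).
Proof. by apply: measurable_funM => //; exact: measurable_cst. Qed.

(** Agreement on half-open intervals determines Lebesgue measure. The preimage of []a, b]] has
    length (b - a) / r, and [mscale] restores the factor r. *)
Lemma lebesgue_scale (r : {nonneg R}) (A : set RM) : 0 < r%:num -> measurable A ->
  mu A = pushforward (mscale r mu) (fun t : RM => r%:num * t : RM) A.
Proof.
move=> r0 mA; apply: lebesgue_measure_unique => //=.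
  exact: measurable_scale.
move=> _ _ [[a b]] _ <-.
rewrite /pushforward /mscale (_ : _ @^-1` _ = `]a / r%:num, b / r%:num]%classic); last first.
  by apply/seteqP; split => u; rewrite /= !in_itv/= ltr_pdivrMr// ler_pdivlMr// ![_ * u]mulrC.
transitivity (r%:num%:E * mu `](a / r%:num)%R, (b / r%:num)%R])%E; last by [].
rewrite !lebesgue_measure_itv/= !lte_fin ltr_pM2r ?invr_gt0//.
case: ifP => [_|_]; last by rewrite mule0.
by rewrite -!EFinB -EFinM mulrBr !(mulrC _ (_ / _)) !divfK// gt_eqF.
Qed.

Lemma cintegral_shift (s : R) (f : RM -> C) : cmeasurable f ->
  cintegrable mu setT (fun u => f (u + s)) ->
  cintegral mu setT f = cintegral mu setT (fun u => f (u + s)).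
Proof.
move=> mf; apply: (@cintegral_pushforward R _ _ _ _ mu (fun u : RM => u + s : RM)) => //.
  exact: measurable_shift.
by move=> A mA; exact: lebesgue_shift.
Qed.

Lemma ge0_integral_shift (s : R) (f : RM -> \bar R) : measurable_fun setT f ->
  (forall t, (0 <= f t)%E) -> (\int[mu]_t f t = \int[mu]_t f (t + s)%R)%E.
Proof.
move=> mf f0.
have ms := measurable_shift s.
rewrite (eq_measure_integral (pushforward mu (fun u : RM => u + s : RM))).
  by rewrite (ge0_integral_pushforward ms)// preimage_setT.
by move=> A mA _; exact: lebesgue_shift.
Qed.

Lemma integral_mscale_integrable (r : {nonneg R}) (f : RM -> \bar R) :
  mu.-integrable setT f ->
  (mscale r mu).-integrable setT f /\
  ((\int[mscale r mu]_t f t)%E = r%:num%:E * \int[mu]_t f t)%E.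
Proof.
move=> iF; have /integrableP[mf foo] := iF; split.
  apply/integrableP; split => //.
  rewrite ge0_integral_mscale//; last exact: measurableT_comp.
  by rewrite lte_mul_pinfty ?lee_fin.
have Ep : (\int[mscale r mu]_t f^\+ t = r%:num%:E * \int[mu]_t f^\+ t)%E.
  by rewrite ge0_integral_mscale//; exact: measurable_funepos.
have En : (\int[mscale r mu]_t f^\- t = r%:num%:E * \int[mu]_t f^\- t)%E.
  by rewrite ge0_integral_mscale//; exact: measurable_funeneg.
rewrite (integralE mu setT f) (integralE (mscale r mu) setT f) Ep En.
by rewrite [RHS]muleBr//; exact: integrable_add_def.
Qed.

Lemma cintegral_scale (r : R) (f : RM -> C) : 0 < r -> cmeasurable f ->
  cintegrable mu setT (fun t => f (r * t)) ->
  cintegrable mu setT f /\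
  cintegral mu setT f = r%:C * cintegral mu setT (fun t => f (r * t)).
Proof.
move=> r0 mf [irf ijf]; pose s := NngNum (ltW r0).
have [irs ers] := integral_mscale_integrable s irf.
have [ijs ejs] := integral_mscale_integrable s ijf.
have ms : measurable_fun setT (fun t : RM => s%:num * t : RM).
  exact: measurable_scale.
have nuE A : measurable A -> mu A = pushforward (mscale s mu) (fun t : RM => s%:num * t : RM) A.
  by move=> mA; exact: lebesgue_scale.
split; first exact: (@cintg_pushforward R _ _ _ _ (mscale s mu) _ ms _ nuE).
rewrite (@cintegral_pushforward R _ _ _ _ (mscale s mu) _ ms _ nuE)//.
apply: Ceq; rewrite ?CReM ?CImM /= /Rintegral.
  by rewrite ers fineM ?mul0r ?subr0//; exact: integrable_fin_num.
by rewrite ejs fineM ?mul0r ?addr0//; exact: integrable_fin_num.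
Qed.

End lebesgue_affine.

(** * Complex powers of real numbers *)

Section truncated_power.
Variable R : realType.
Local Notation C := (Cplx R).
Local Notation RM := (measurableTypeR R).
Implicit Types (z w : C) (t r : R).

(* Extending t ^ z by 0 to t <= 0 makes the laws below hold for every real t, *)
(* and turns integrals over intervals and simplices into integrals over the   *)
(* whole space.                                                               *)
Definition tpow z t : C := if 0 < t then cpow t z else 0.

Lemma tpow_le0 z t : t <= 0 -> tpow z t = 0.
Proof. by rewrite /tpow ltNge => ->. Qed.

Lemma tpow_gt0 z t : 0 < t -> tpow z t = cpow t z.
Proof. by rewrite /tpow => ->. Qed.

Lemma cpowD z w t : 0 < t -> cpow t (z + w) = cpow t z * cpow t w.
Proof.
move=> t0; apply: Ceq; rewrite ?CReM ?CImM /= CReD CImD mulrDl.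
  by rewrite powRD ?(gt_eqF t0) ?implybT// cosD; ring.
by rewrite powRD ?(gt_eqF t0) ?implybT// sinD; ring.
Qed.

Lemma tpowD z w t : tpow (z + w) t = tpow z t * tpow w t.
Proof. by rewrite /tpow; case: ifPn => [t0|_]; rewrite ?mul0r// cpowD. Qed.

Lemma tpowM z r t : 0 < r -> tpow z (r * t) = tpow z r * tpow z t.
Proof.
move=> r0; rewrite /tpow pmulr_rgt0// r0; case: ifPn => [t0|_]; last by rewrite mulr0.
apply: Ceq; rewrite ?CReM ?CImM /= powRM ?ltW// lnM ?posrE// mulrDr.
  by rewrite cosD; ring.
by rewrite sinD; ring.
Qed.

Lemma tpow0 t : 0 < t -> tpow 0 t = 1.
Proof.
by move=> t0; rewrite tpow_gt0//; apply: Ceq; rewrite /= powRr0 mul0r ?cos0 ?sin0 !mul1r.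
Qed.

Lemma tpow1 t : 0 < t -> tpow 1 t = t%:C.
Proof.
move=> t0; rewrite tpow_gt0//; apply: Ceq; rewrite /= powRr1 ?ltW// mul0r ?cos0 ?sin0.
  by rewrite mulr1.
by rewrite mulr0.
Qed.

Lemma tpow_addn z n t : tpow (z + n%:R) t = tpow z t * (t ^+ n)%:C.
Proof.
have [t0|t0] := leP t 0; first by rewrite !tpow_le0// mul0r.
elim: n => [|n IH]; first by rewrite addr0 expr0 mulr1.
by rewrite -natr1 addrA tpowD IH tpow1// -mulrA -crealM -exprSr.
Qed.

Lemma tpow_one z : tpow z 1 = 1 :> C.
Proof.
rewrite tpow_gt0//; apply: Ceq; rewrite /= powR1 ln1 mulr0 ?cos0 ?sin0 ?mulr1//.
by rewrite mulr0.
Qed.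

Lemma tpow_real (x : R) t : tpow x%:C t = (if 0 < t then t `^ x else 0)%:C.
Proof.
rewrite /tpow; case: ifPn => // t0.
by apply: Ceq; rewrite /= mul0r ?cos0 ?sin0 ?mulr1 ?mulr0.
Qed.

Lemma cabs_tpow z t : cabs (tpow z t) = if 0 < t then t `^ complex.Re z else 0.
Proof.
rewrite /tpow; case: ifPn => [t0|_]; last exact: cabs0.
rewrite cabsE /= !exprMn -mulrDr cos2Dsin2 mulr1 sqrtr_sqr ger0_norm//.
exact: powR_ge0.
Qed.

(** The modulus of a truncated power is again one, with a real exponent, so absolute integrability
    can be read off from the exact formulas at real parameters. *)
Lemma tpow_cabs z t : ((cabs (tpow z t))%:C : C) = tpow (complex.Re z)%:C t.
Proof. by rewrite cabs_tpow tpow_real. Qed.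

Lemma cmeasurable_cpow z : cmeasurable (fun t : RM => cpow t z).
Proof.
have mln : measurable_fun setT (fun t : RM => complex.Im z * ln t).
  by apply: measurable_funM => //; exact: measurable_ln.
have mp := measurable_powR (complex.Re z).
split; apply: measurable_funM => //; apply: (measurableT_comp _ mln);
  apply: continuous_measurable_fun; [exact: continuous_cos|exact: continuous_sin].
Qed.

Lemma cmeasurable_tpow z : cmeasurable (tpow z : RM -> C).
Proof.
have mpos : measurable_fun setT (fun t : RM => 0 < t) by exact: measurable_fun_ltr.
have [mr mi] := cmeasurable_cpow z.
split.
  rewrite (_ : (fun _ => _) = fun t : RM => if 0 < t then complex.Re (cpow t z) else 0).
    exact: measurable_fun_ifT.
  by apply/funext => t; rewrite /tpow; case: ifP.
rewrite (_ : (fun _ => _) = fun t : RM => if 0 < t then complex.Im (cpow t z) else 0).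
  exact: measurable_fun_ifT.
by apply/funext => t; rewrite /tpow; case: ifP.
Qed.

End truncated_power.

(** * The integral of t^(a-1) over ]0, 1] *)

Section beta_one.
Variable R : realType.
Local Notation C := (Cplx R).
Local Notation RM := (measurableTypeR R).
Local Notation mu := (@lebesgue_measure R).

Lemma is_derive_cpow (z : C) (t : R) : 0 < t ->
  is_derive t 1 (fun u => complex.Re (cpow u z)) (complex.Re (z * cpow t (z - 1))) /\
  is_derive t 1 (fun u => complex.Im (cpow u z)) (complex.Im (z * cpow t (z - 1))).
Proof.
move=> t0; have dp := is_derive1_powR (complex.Re z) t0.
have dl : is_derive t 1 (fun u => complex.Im z * ln u) (complex.Im z * t^-1).
  exact: (is_deriveZ (complex.Im z) (is_derive1_ln t0)).
have dc := @is_derive1_comp R cos (fun u => complex.Im z * ln u) t _ _ (is_derive_cos (complex.Im z * ln t)) dl.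
have ds := @is_derive1_comp R sin (fun u => complex.Im z * ln u) t _ _ (is_derive_sin (complex.Im z * ln t)) dl.
have tE : t `^ complex.Re z = t * t `^ (complex.Re z - 1).
  rewrite -{2}(powRr1 (ltW t0)) -powRD ?(gt_eqF t0) ?implybT//.
  by congr (_ `^ _); ring.
have tV : t * t^-1 = 1 by rewrite divff// gt_eqF.
split.
  apply: is_derive_eq (is_deriveM dp dc) _.
  rewrite /GRing.scale /= CReM /= CReB CImB /= subr0 tE.
  transitivity (t * t^-1 * (- complex.Im z * (t `^ (complex.Re z - 1) *
     sin (complex.Im z * ln t))) + complex.Re z * (t `^ (complex.Re z - 1) *
     cos (complex.Im z * ln t))); first by ring.
  by rewrite tV; ring.
apply: is_derive_eq (is_deriveM dp ds) _.
rewrite /GRing.scale /= CImM /= CReB CImB /= subr0 tE.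
transitivity (t * t^-1 * (complex.Im z * (t `^ (complex.Re z - 1) *
   cos (complex.Im z * ln t))) + complex.Re z * (t `^ (complex.Re z - 1) *
   sin (complex.Im z * ln t))); first by ring.
by rewrite tV; ring.
Qed.

Lemma cpow_continuous (z : C) (e : R) : 0 < e ->
  {within `[e, 1], continuous (fun u => complex.Re (cpow u z))} /\
  {within `[e, 1], continuous (fun u => complex.Im (cpow u z))}.
Proof.
move=> e0; split; apply: derivable_within_continuous => t;
  rewrite in_itv/= => /andP[et _]; have [dr di] := is_derive_cpow z (lt_le_trans e0 et).
  by case: dr.
by case: di.
Qed.

Lemma FTC_real (f F : R -> R) (e : R) : 0 < e -> e < 1 ->
  (forall t : R, 0 < t -> is_derive t 1 F (f t)) ->
  {within `[e, 1], continuous f} ->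
  (\int[mu]_(t in `[e, 1%R]) (f t)%:E = (F 1 - F e)%:E)%E.
Proof.
move=> e0 e1 dF cf; rewrite (continuous_FTC2 e1 cf (F := F)) ?EFinB//.
  split.
  - move=> t; rewrite in_itv/= => /andP[et _].
    by have [] := dF t (lt_trans e0 et).
  - apply/cvg_at_right_filter; apply/differentiable_continuous/derivable1_diffP.
    by have [] := dF e e0.
  - apply/cvg_at_left_filter; apply/differentiable_continuous/derivable1_diffP.
    by have [] := dF 1 ltr01.
move=> t; rewrite in_itv/= => /andP[et _].
by rewrite derive1E; have [_ ->] := dF t (lt_trans e0 et).
Qed.

Lemma integral_cpow (z : C) (e : R) : 0 < e -> e < 1 ->
  cintegrable mu `[e, 1] (fun t => z * cpow t (z - 1)) /\
  cintegral mu `[e, 1] (fun t : RM => z * cpow t (z - 1)) = 1 - cpow e z.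
Proof.
move=> e0 e1; have [rc ic] := cpow_continuous (z - 1) e0.
have cr : {within `[e, 1], continuous (fun t => complex.Re (z * cpow t (z - 1)))}.
  rewrite (_ : (fun t => _) = fun t => complex.Re z * complex.Re (cpow t (z - 1)) -
    complex.Im z * complex.Im (cpow t (z - 1))); last first.
    by apply/funext => t; rewrite CReM.
  by move=> t; apply: cvgB; apply: cvgM; [exact: cvg_cst|exact: rc|exact: cvg_cst|exact: ic].
have ci : {within `[e, 1], continuous (fun t => complex.Im (z * cpow t (z - 1)))}.
  rewrite (_ : (fun t => _) = fun t => complex.Re z * complex.Im (cpow t (z - 1)) +
    complex.Im z * complex.Re (cpow t (z - 1))); last first.
    by apply/funext => t; rewrite CImM.
  by move=> t; apply: cvgD; apply: cvgM; [exact: cvg_cst|exact: ic|exact: cvg_cst|exact: rc].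
split.
  by split; apply: continuous_compact_integrable => //; exact: segment_compact.
have one : cpow 1 z = 1 by rewrite -(tpow_one z) tpow_gt0.
have -> : 1 - cpow e z = cpow 1 z - cpow e z by rewrite one.
apply: Ceq; rewrite ?CReB ?CImB /= /Rintegral.
  by rewrite (FTC_real e0 e1 (fun t t0 => (is_derive_cpow z t0).1) cr).
by rewrite (FTC_real e0 e1 (fun t t0 => (is_derive_cpow z t0).2) ci).
Qed.

(** The modulus is t^(s-1) with s = Re a, so the real exponent suffices. There monotone convergence
    along the intervals [1/(n+2), 1] bounds the integral by 1/s. *)
Lemma tpow_unit_intg (a : C) : 0 < complex.Re a ->
  cintegrable mu setT (fun t => (\1_(`]0%R, 1%R] : set RM) t)%:C * tpow (a - 1) t).
Proof.
move=> a0; set s := complex.Re a.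
have mt := cmeasurable_tpow (a - 1).
have mt' := cmeasurable_tpow (s%:C - 1).
apply: (cintg_dom (M := 1) (g := fun t => (\1_(`]0%R, 1%R] : set RM) t)%:C * tpow (s%:C - 1) t)).
- by apply: cmeasurableM => //; exact: cmeasurable_indic.
- suff : cintegrable mu (`]0%R, 1%R] : set RM) (tpow (s%:C - 1)).
    by move/(@cintg_indic _ _ _ _ (`]0%R, 1%R] : set RM) (measurable_itv _)).
  have Eim t : complex.Im (tpow (s%:C - 1) t) = 0.
    by rewrite (_ : s%:C - 1 = (s - 1)%:C) ?tpow_real//; apply: Ceq; rewrite ?CReB ?CImB//= subr0.
  have Ere t : complex.Re (tpow (s%:C - 1) t) = if 0 < t then t `^ (s - 1) else 0.
    rewrite (_ : s%:C - 1 = (s - 1)%:C) ?tpow_real//.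
    by apply: Ceq; rewrite ?CReB ?CImB//= subr0.
  split; last first.
    apply: (eq_integrable _ (cst 0%E)) (integrable0 _ _) => // t _. by rewrite Eim.
  have re_ge0 t : 0 <= complex.Re (tpow (s%:C - 1) t).
    by rewrite Ere; case: ifP => // _; exact: powR_ge0.
  have mre : measurable_fun setT (fun t : RM => (complex.Re (tpow (s%:C - 1) t))%:E).
    by apply/measurable_EFinP; case: mt'.
  apply/integrableP; split; first exact: measurable_funTS mre.
  (* The shift by 2 keeps the left end strictly below 1, as [integral_cpow] requires. *)
  pose F (n : nat) : set RM := `[n.+2%:R^-1, 1%R]%classic.
  have mF n : measurable (F n) by exact: measurable_itv.
  have F01 : \bigcup_n F n = `]0%R, 1%R]%classic.
    apply/seteqP; split => [t [n _]|t] /=; rewrite /F /= !in_itv/= => /andP[t0 t1].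
      by rewrite t1 andbT (lt_le_trans _ t0).
    exists (Num.truncn t^-1) => //=; rewrite in_itv/= t1 andbT.
    rewrite -[leRHS]invrK lef_pV2 ?posrE ?invr_gt0//.
    by rewrite (le_trans (ltW (truncnS_gt _)))// ler_nat.
  have ndF : {homo F : n m / (n <= m)%N >-> (n <= m)%O}.
    move=> n m nm; apply/subsetPset => t; rewrite /F /= !in_itv/= => /andP[nt ->].
    by rewrite andbT (le_trans _ nt)// lef_pV2 ?posrE// ler_nat.
  have := @ge0_nondecreasing_set_cvg_integral _ _ _ F
    (fun t => (complex.Re (tpow (s%:C - 1) t))%:E) mu ndF
    (fun n => measurable_itv _) (fun n => measurable_funTS mre)
    (fun n t _ => re_ge0 t).
  rewrite F01 => cvgF.
  under eq_integral do rewrite gee0_abs ?lee_fin//.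
  (* On [F n] the integral multiplied by s equals 1 - (n+2)^(-s), hence is at most 1. *)
  apply: (@le_lt_trans _ _ (s^-1)%:E); last exact: ltry.
  apply: (cvge_to_le cvgF); apply: nearW => n.
  have n0 : 0 < n.+2%:R^-1 :> R by rewrite invr_gt0.
  have n1 : n.+2%:R^-1 < 1 :> R by rewrite invf_lt1// ltr1n.
  have [[ir _] /(congr1 (@complex.Re R))] := integral_cpow s%:C n0 n1.
  rewrite [LHS]/= CReB => Eint.
  have Ers t : F n t -> complex.Re ((s%:C : C) * cpow t (s%:C - 1)) =
      s * complex.Re (tpow (s%:C - 1) t).
    move=> Fn; have t0 : 0 < t by move: Fn; rewrite /F /= in_itv/= => /andP[tn _]; rewrite (lt_le_trans n0).
    by rewrite CReM tpow_gt0// mul0r subr0.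
  have : (s%:E * \int[mu]_(t in F n) (complex.Re (tpow (s%:C - 1) t))%:E <= 1)%E.
    rewrite -ge0_integralZl//; last 3 first.
    - exact: measurable_funTS mre.
    - by move=> t _; rewrite lee_fin.
    - by rewrite lee_fin ltW.
    rewrite (eq_integral (fun t : RM => (complex.Re ((s%:C : C) * cpow t (s%:C - 1)))%:E)); last first.
      by move=> t /set_mem Ft; rewrite Ers.
    rewrite -[X in (X <= _)%E]fineK ?integrable_fin_num//.
    move: Eint; rewrite /Rintegral => ->.
    rewrite lee_fin /= mul0r cos0 mulr1 lerBlDr lerDl; exact: powR_ge0.
  by rewrite -lee_pdivlMl// mule1.
- move=> t; rewrite mul1r !cabsM ler_wpM2l ?cabs_ge0// !cabs_tpow.
  by rewrite !CReB.
Qed.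

(** Over [e, 1] the integral of a t^(a-1) is 1 - e^a, and |e^a| = e^(Re a) tends to 0 with e;
    dominated convergence passes to the limit. This is the value B(a, 1), from which Gamma(a+1) = a
    Gamma(a) follows. *)
Lemma cintegral_tpow_unit (a : C) : 0 < complex.Re a ->
  cintegral mu setT (fun t => (\1_(`]0%R, 1%R] : set RM) t)%:C * tpow (a - 1) t) = a^-1.
Proof.
move=> a0; have ia := tpow_unit_intg a0.
have an0 : a != 0 by apply: contraTneq a0 => ->; rewrite ltxx.
apply: (mulfI an0); rewrite divff// -cintegralZ//.
pose e n : R := n.+2%:R^-1.
have e0 n : 0 < e n by rewrite invr_gt0.
have e1 n : e n < 1 by rewrite invf_lt1// ltr1n.
pose u n (t : RM) : C := (\1_(`[e n, 1%R] : set RM) t)%:C * (a * tpow (a - 1) t).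
have uE n : cintegral mu setT (u n) = 1 - cpow (e n) a.
  have [_ <-] := integral_cpow a (e0 n) (e1 n).
  rewrite [RHS]cintegral_indic; congr (cintegral _ _ _); apply/funext => t; rewrite /u.
  rewrite indicE; case: (boolP (t \in _)) => [/set_mem|_]; last by rewrite !mul0r.
  by rewrite /= in_itv/= => /andP[et _]; rewrite tpow_gt0// (lt_le_trans (e0 n)).
have elim0 : e @ \oo --> 0.
  by have := @cvg_harmonic R; rewrite -cvg_shiftS.
have mu_ n : cmeasurable (u n).
  apply: cmeasurableM; first exact: cmeasurable_indic.
  by apply: cmeasurableM; [exact: cmeasurable_cst|exact: cmeasurable_tpow].
have [||| _ lim_u] := @cdominated_cvg R _ RM mu u
   (fun t => a * ((\1_(`]0%R, 1%R] : set RM) t)%:C * tpow (a - 1) t))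
   (fun t => cabs (a * ((\1_(`]0%R, 1%R] : set RM) t)%:C * tpow (a - 1) t))) mu_.
- move=> t; apply: cvg_near_cst.
  have [t0|t0] := leP t 0.
    by apply: nearW => n; rewrite /u tpow_le0// !mulr0.
  have /cvgrPdist_lt/(_ _ t0) := elim0; apply: filterS => n.
  rewrite sub0r normrN gtr0_norm// => et.
  rewrite /u mulrCA; congr (_ * (_ * _)); congr (_%:C).
  by rewrite !indicE; congr (_%:R); congr nat_of_bool; apply/idP/idP => /set_mem;
    rewrite /= in_itv/= => /andP[_ t1]; apply/mem_set; rewrite /= in_itv/= ?t0 ?t1 ?(ltW et).
- by apply: cintg_cabs; exact: cintgZ.
- move=> n t; rewrite /u mulrCA !cabsM ler_wpM2l ?cabs_ge0//.
  have [t0|t0] := leP t 0.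
    by rewrite tpow_le0// cabs0 !mulr0.
  rewrite ler_wpM2r ?cabs_ge0// !cabs_real !indicE !ger0_norm//.
  case: (boolP (t \in (`[e n, 1%R]%classic : set RM))) => [|_]; last by rewrite ler0n.
  move=> /set_mem; rewrite /= in_itv/= => /andP[_ t1].
  by rewrite mem_set//= in_itv/= t0.
apply: (ccvg_eq lim_u); rewrite (funext uE).
apply: ccvg_cabs.
rewrite (_ : (fun _ => _) = (fun n => e n `^ complex.Re a)); last first.
  by apply/funext => n; rewrite addrAC subrr add0r cabsN -tpow_gt0// cabs_tpow e0.
by have /cvg_at_rightP/(_ e) := powR_cvg0 a0; apply; split.
Qed.

End beta_one.

(** * Gamma and beta integrals and the relation between them *)

Section gamma_beta.
Variable R : realType.
Local Notation C := (Cplx R).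
Local Notation RM := (measurableTypeR R).
Local Notation mu := (@lebesgue_measure R).

Definition gamma_kernel (z : C) (t : RM) : C := tpow (z - 1) t * (expR (- t))%:C.

Definition beta_kernel (a b : C) (t : RM) : C := tpow (a - 1) t * tpow (b - 1) (1 - t).

Definition cBeta (a b : C) : C := cintegral mu setT (beta_kernel a b).

Lemma cGammaE (z : C) : cGamma z = cintegral mu setT (gamma_kernel z).
Proof.
rewrite /cGamma cintegral_indic; congr (cintegral _ _ _); apply/funext => t.
rewrite /gamma_kernel /tpow indicE; case: (boolP (t \in _)) => [/set_mem|/negP t0].
  by rewrite /= in_itv/= andbT => ->; rewrite mul1r.
rewrite mul0r; case: ifPn => [t0'|_]; last by rewrite mul0r.
by exfalso; apply: t0; apply/mem_set; rewrite /= in_itv/= andbT.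
Qed.

Lemma cmeasurable_gamma_kernel (z : C) : cmeasurable (gamma_kernel z).
Proof.
apply: cmeasurableM; first exact: cmeasurable_tpow.
apply: cmeasurable_real; apply: (@measurableT_comp _ _ _ _ _ _ (@expR R)).
  exact: measurable_expR.
by apply: measurable_funN.
Qed.

(** Half of the exponential absorbs the power: with an integer m > s, t^s <= t^m since t > 1, and
    (t/2)^m / m! is a term of the series of exp(t/2). *)
Lemma powR_exp_bound (s t : R) : 1 < t ->
  t `^ s * expR (- t) <= 2 ^+ (Num.truncn s).+1 * (Num.truncn s).+1`!%:R *
    expR (- 2^-1 * t).
Proof.
move=> t1; set m := (Num.truncn s).+1.
have t0 : 0 < t by rewrite (lt_trans ltr01).
have -> : expR (- t) = expR (- 2^-1 * t) * expR (- 2^-1 * t).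
  by rewrite -expRD; congr expR; lra.
rewrite mulrA ler_wpM2r ?expR_ge0//.
have -> : expR (- 2^-1 * t) = (expR (t / 2))^-1.
  by rewrite -expRN; congr expR; ring.
rewrite ler_pdivrMr ?expR_gt0// (@le_trans _ _ (t ^+ m))//.
  rewrite -powR_mulrn ?(ltW t0)// ler_powR ?(ltW t1)//.
  exact/ltW/truncnS_gt.
have t2 : 0 <= t / 2 by rewrite divr_ge0// ltW.
have m0 : (m`!%:R : R) != 0 by rewrite pnatr_eq0 -lt0n fact_gt0.
have -> : t ^+ m = 2 ^+ m * m`!%:R * ((t / 2) ^+ m / m`!%:R).
  rewrite expr_div_n; field.
  by rewrite m0 expf_neq0// pnatr_eq0.
rewrite ler_wpM2l ?mulr_ge0 ?exprn_ge0//.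
by apply: le_trans _ (expR_ge1Dxn (Num.truncn s) t2); rewrite lerDr.
Qed.

Lemma cabs_gamma_kernel (z : C) (t : R) : cabs (gamma_kernel z t) =
  cabs (tpow (z - 1) t) * expR (- t).
Proof. by rewrite cabsM cabs_real gtr0_norm// expR_gt0. Qed.

(** On ]0, 1] the kernel is dominated by the power alone; beyond 1 it is dominated by a multiple of
    the exponential density of rate 1/2. *)
Lemma gamma_kernel_intg (z : C) : 0 < complex.Re z ->
  cintegrable mu setT (gamma_kernel z).
Proof.
move=> z0; set s := complex.Re z - 1; set m := (Num.truncn s).+1.
(* The last factor 2 cancels the normalizing constant 1/2 of the exponential density. *)
pose K : R := 2 ^+ m * m`!%:R * 2.
have K0 : 0 <= K by rewrite !mulr_ge0 ?exprn_ge0.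
pose g1 t := cabs ((\1_(`]0%R, 1%R] : set RM) t)%:C * tpow (z - 1) t).
pose g2 (t : R) := K * exponential_pdf 2^-1 t.
apply: (@cintg_le _ _ _ _ _ (fun t => g1 t + g2 t)).
- exact: cmeasurable_gamma_kernel.
- under eq_fun do rewrite EFinD; apply: integrableD => //.
    by apply: cintg_cabs; exact: tpow_unit_intg.
  rewrite /g2; under eq_fun do rewrite EFinM; apply: integrableZl => //.
  by apply: integrable_exponential_pdf; rewrite invr_gt0.
move=> t; rewrite cabs_gamma_kernel /g1 cabsM cabs_real indicE.
have pdf0 : 0 <= g2 t.
  by rewrite mulr_ge0// exponential_pdf_ge0// invr_ge0.
have [t0|t0] := leP t 0.
  by rewrite tpow_le0// cabs0 mul0r mulr0 add0r.
have [t1|t1] := leP t 1.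
  rewrite mem_set/= ?in_itv/= ?t0 ?t1// normr1 mul1r.
  rewrite (@le_trans _ _ (cabs (tpow (z - 1) t)))//; last by rewrite lerDl.
  rewrite ler_piMr ?cabs_ge0// -expR0 ler_expR oppr_le0; exact: ltW.
rewrite memNset/= ?in_itv/= ?(leNgt t) ?t1 ?andbF// normr0 mul0r add0r.
rewrite cabs_tpow t0 CReB /= (le_trans (powR_exp_bound _ t1))//.
rewrite /g2 exponential_pdfE ?(ltW t0)// /K -!mulrA ler_wpM2l ?exprn_ge0//.
by rewrite ler_wpM2l// mulrA divff// mul1r.
Qed.

Lemma cGamma1 : cGamma (1 : C) = 1.
Proof.
rewrite cGammaE (@cintegral_ae _ _ _ _ _
  (fun t : RM => (exponential_pdf 1 t : R)%:C : C) [set 0]).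
- apply: Ceq => /=; last by rewrite /Rintegral integral0.
  by rewrite /Rintegral integral_exponential_pdf.
- exact: cmeasurable_gamma_kernel.
- by apply: cmeasurable_real; exact: measurable_exponential_pdf.
- exact: measurable_set1.
- exact: lebesgue_measure_set1.
move=> t /eqP t0; rewrite /gamma_kernel subrr.
have [t0'|t0'] := leP t 0.
  by rewrite tpow_le0// mul0r lt0_exponential_pdf// lt_neqAle t0.
by rewrite tpow0// mul1r exponential_pdfE ?ltW// /exponential_pdf mul1r mulN1r.
Qed.

(* (s, u) |-> s ^ (a - 1) (u - s) ^ (b - 1) exp (- u) is integrated in both   *)
(* orders: u first gives Gamma(a) Gamma(b), s first gives Gamma(a + b) B(a,b) *)
Let conv (a b : C) (p : RM * RM) : C :=
  tpow (a - 1) p.1 * (tpow (b - 1) (p.2 - p.1) * (expR (- p.2))%:C).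

Let cmeasurable_conv (a b : C) : cmeasurable (conv a b).
Proof.
have [mr mi] := cmeasurable_tpow (a - 1); have [mr' mi'] := cmeasurable_tpow (b - 1).
apply: cmeasurableM.
  exact: (cmeasurable_comp (phi := fst)).
apply: cmeasurableM.
  apply: (cmeasurable_comp (phi := fun p : RM * RM => p.2 - p.1 : RM)) => //.
  exact: measurable_funB.
apply: cmeasurable_real; apply: (@measurableT_comp _ _ _ _ _ _ (@expR R)).
  exact: measurable_expR.
exact: measurable_funN.
Qed.

Let conv_shift (a b : C) (s u : R) :
  conv a b (s, u + s) = gamma_kernel a s * gamma_kernel b u.
Proof.
rewrite /conv /gamma_kernel /= addrK opprD expRD crealM; ring.
Qed.

Let cmeasurable_conv1 (a b : C) (s : R) : cmeasurable (fun u : RM => conv a b (s, u)).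
Proof. exact: (cmeasurable_pair1 s (cmeasurable_conv a b)). Qed.

Let cmeasurable_conv2 (a b : C) (u : R) : cmeasurable (fun s : RM => conv a b (s, u)).
Proof.
have [mr mi] := cmeasurable_conv a b.
by apply: (cmeasurable_comp (phi := fun s : RM => (s, u) : RM * RM)).
Qed.

Let conv_intg (a b : C) : 0 < complex.Re a -> 0 < complex.Re b ->
  cintegrable (mu \x mu)%E setT (conv a b).
Proof.
move=> a0 b0; have ia := gamma_kernel_intg a0; have ib := gamma_kernel_intg b0.
apply: cintg_prod12; first exact: cmeasurable_conv.
have /integrableP[mca] := cintg_cabs ia; have /integrableP[mcb] := cintg_cabs ib.
under [X in (X < _)%E]eq_integral do rewrite gee0_abs ?lee_fin ?cabs_ge0//.
under [X in _ -> (X < _)%E -> _]eq_integral do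
  rewrite gee0_abs ?lee_fin ?cabs_ge0//.
move=> fin_b fin_a.
have E (s : R) : (\int[mu]_u (cabs (conv a b (s, u)))%:E =
    (cabs (gamma_kernel a s))%:E * \int[mu]_u (cabs (gamma_kernel b u))%:E)%E.
  rewrite (ge0_integral_shift s)//; last 2 first.
  - by apply/measurable_EFinP; exact: measurable_cabs.
  - by move=> t; rewrite lee_fin cabs_ge0.
  rewrite -ge0_integralZl//; last 2 first.
  - by move=> t _; rewrite lee_fin cabs_ge0.
  - by rewrite lee_fin cabs_ge0.
  by apply: eq_integral => u _; rewrite conv_shift cabsM EFinM.
under eq_integral do rewrite E.
rewrite ge0_integralZr//.
- by rewrite lte_mul_pinfty// ?integral_ge0// ?ge0_fin_numE// ?integral_ge0// => x _;
    rewrite lee_fin cabs_ge0.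
- by move=> x _; rewrite lee_fin cabs_ge0.
by apply: integral_ge0 => x _; rewrite lee_fin cabs_ge0.
Qed.

Let conv_integral1 (a b : C) : 0 < complex.Re a -> 0 < complex.Re b ->
  cintegral (mu \x mu)%E setT (conv a b) = cGamma a * cGamma b.
Proof.
move=> a0 b0; have ia := gamma_kernel_intg a0; have ib := gamma_kernel_intg b0.
have [_ ->] := cfubini (conv_intg a0 b0).
rewrite !cGammaE -cintegralZr//; congr (cintegral _ _ _); apply/funext => s.
rewrite (cintegral_shift (s := s) (cmeasurable_conv1 a b s)); last first.
  by under eq_fun do rewrite conv_shift; exact: cintgZ.
have -> : (fun u : RM => conv a b (s, u + s)) =
    fun u => gamma_kernel a s * gamma_kernel b u.
  by apply/funext => u; exact: conv_shift.
exact: cintegralZ.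
Qed.

Let conv_scale (a b : C) (u t : R) : 0 < u ->
  conv a b (u * t, u) = (tpow (a - 1 + (b - 1)) u * (expR (- u))%:C) * beta_kernel a b t.
Proof.
move=> u0; rewrite /conv /beta_kernel /= (_ : u - u * t = u * (1 - t)); last by ring.
by rewrite !tpowM// (tpowD (a - 1) (b - 1)); ring.
Qed.

Let conv_le0 (a b : C) (s u : R) : u <= 0 -> conv a b (s, u) = 0.
Proof.
move=> u0; rewrite /conv /=; have [s0|s0] := leP s 0; first by rewrite tpow_le0// mul0r.
by rewrite [tpow _ (u - s)]tpow_le0 ?mul0r ?mulr0//; lra.
Qed.

Lemma cmeasurable_beta_kernel (a b : C) : cmeasurable (beta_kernel a b).
Proof.
have [mr mi] := cmeasurable_tpow (b - 1).
apply: cmeasurableM; first exact: cmeasurable_tpow.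
apply: (cmeasurable_comp (phi := fun t : RM => 1 - t : RM)) => //.
exact: measurable_funB.
Qed.

(** No estimate near 0 and 1 is made: since [conv] is integrable on the plane, almost every slice at
    fixed u is integrable, and for u > 0 the slice is, up to the scaling s = u t and a nonzero
    constant, the beta kernel. *)
Lemma beta_kernel_intg (a b : C) : 0 < complex.Re a -> 0 < complex.Re b ->
  cintegrable mu setT (beta_kernel a b).
Proof.
move=> a0 b0; have ic := cintg_cabs (conv_intg a0 b0).
have [u u0 iu] : exists2 u : R, 0 < u & mu.-integrable setT
    (fun s : RM => (cabs (conv a b (s, u)))%:E).
  (* If no positive u worked, the null set of bad slices would contain ]0, 1[. *)
  apply: contrapT => nu; have [N [mN N0 subN]] := ae_integrable2 ic.
  have : (mu (`]0%R, 1%R[ : set RM) <= mu N)%E.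
    apply: le_measure; [by apply/mem_set; exact: measurable_itv|by apply/mem_set|].
    move=> u /=; rewrite in_itv/= => /andP[u0 _].
    by apply: subN => iu; apply: nu; exists u.
  by rewrite N0 lebesgue_measure_itv/= lte_fin ltr01 sube0 leNgt lte01.
have iu' : cintegrable mu setT (fun s : RM => conv a b (s, u)).
  exact: (cintg_le (cmeasurable_conv2 a b u) iu).
pose K : C := tpow (a - 1 + (b - 1)) u * (expR (- u))%:C.
have K0 : K != 0.
  apply/eqP => /(congr1 (fun z : C => cabs z)); rewrite cabsM cabs_tpow cabs_real u0 cabs0 => /eqP.
  by rewrite mulf_eq0 normr_eq0 (gt_eqF (powR_gt0 _ u0)) (gt_eqF (expR_gt0 _)).
have fE : (fun t : RM => conv a b (u * t, u)) = fun t => K * beta_kernel a b t.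
  by apply/funext => t; rewrite conv_scale.
have [||| iK _] := @cintegral_scale R u^-1 (fun t : RM => conv a b (u * t, u)).
- by rewrite invr_gt0.
- by rewrite fE; apply: cmeasurableM; [exact: cmeasurable_cst|exact: cmeasurable_beta_kernel].
- by under eq_fun do rewrite mulrA divff ?gt_eqF// mul1r.
rewrite fE in iK.
have -> : beta_kernel a b = fun t => K^-1 * (K * beta_kernel a b t).
  by apply/funext => t; rewrite mulKf.
exact: cintgZ.
Qed.

(** This is the second evaluation of the double integral of [conv]: for u > 0 the substitution s = u
    t turns the inner integral into u^(a+b-1) exp(-u) B(a, b), the Jacobian supplying one power of
    u; for u <= 0 it is zero. *)
Lemma cGammaM (a b : C) : 0 < complex.Re a -> 0 < complex.Re b ->
  cGamma a * cGamma b = cGamma (a + b) * cBeta a b.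
Proof.
move=> a0 b0; rewrite -conv_integral1//.
have [_ ->] := cfubini_swap (conv_intg a0 b0).
have iab : cintegrable mu setT (gamma_kernel (a + b)).
  by apply: gamma_kernel_intg; rewrite CReD addr_gt0.
rewrite cGammaE -cintegralZr//; congr (cintegral _ _ _); apply/funext => u.
have [u0|u0] := leP u 0.
  rewrite /gamma_kernel tpow_le0// !mul0r.
  rewrite -[RHS](cintegral0 mu); congr (cintegral _ _ _).
  by apply/funext => s; rewrite conv_le0.
have ib := beta_kernel_intg a0 b0.
have ic : cintegrable mu setT (fun t : RM => conv a b (u * t, u)).
  rewrite (_ : (fun _ => _) = fun t => (tpow (a - 1 + (b - 1)) u * (expR (- u))%:C) * beta_kernel a b t).
    exact: cintgZ.
  by apply/funext => t; rewrite conv_scale.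
have [_ ->] := cintegral_scale u0 (cmeasurable_conv2 a b u) ic.
rewrite (_ : (fun _ => _) = fun t => (tpow (a - 1 + (b - 1)) u * (expR (- u))%:C) * beta_kernel a b t); last first.
  by apply/funext => t; rewrite conv_scale.
rewrite cintegralZ// mulrA; congr (_ * _); rewrite /gamma_kernel.
rewrite mulrA -tpow1// -tpowD; congr (tpow _ _ * _); ring.
Qed.

Lemma cBeta1 (a : C) : 0 < complex.Re a -> cBeta a 1 = a^-1.
Proof.
move=> a0; rewrite -cintegral_tpow_unit//.
apply: (@cintegral_ae _ _ _ mu (beta_kernel a 1) _ [set 1]).
- exact: cmeasurable_beta_kernel.
- apply: cmeasurableM; last exact: cmeasurable_tpow.
  exact: cmeasurable_indic.
- exact: measurable_set1.
- exact: lebesgue_measure_set1.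
move=> t /eqP t1; rewrite /beta_kernel subrr indicE mulrC.
have [t0|t0] := leP t 0; first by rewrite [tpow _ t]tpow_le0// !mulr0.
have [t1'|t1'] := leP t 1.
  rewrite mem_set/= ?in_itv/= ?t0 ?t1'// tpow0// subr_gt0 lt_neqAle t1 t1'//.
by rewrite tpow_le0 ?subr_le0 ?ltW// memNset//= in_itv/= leNgt t1' andbF.
Qed.

Lemma cGammaS (a : C) : 0 < complex.Re a -> cGamma (a + 1) = a * cGamma a.
Proof.
move=> a0; have an0 : a != 0 by apply: contraTneq a0 => ->; rewrite ltxx.
have := @cGammaM a 1 a0 ltr01.
rewrite cGamma1 mulr1 cBeta1// => ->.
by rewrite mulrCA divff// mulr1.
Qed.

End gamma_beta.

(** * Gamma has no zero in the right half-plane *)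

Section gamma_nonzero.
Variable R : realType.
Local Notation C := (Cplx R).
Local Notation RM := (measurableTypeR R).
Local Notation mu := (@lebesgue_measure R).

Lemma cGamma_addn (z : C) n : 0 < complex.Re z ->
  cGamma (z + n%:R) = poch z n * cGamma z.
Proof.
move=> z0; elim: n => [|n IH]; first by rewrite addr0 /poch big_ord0 mul1r.
rewrite -natr1 addrA cGammaS ?CReD ?CRe_nat ?ltr_wpDr// IH.
by rewrite /poch big_ord_recr /=; ring.
Qed.

Lemma abs_sin_le (x : R) : 0 <= x -> `|sin x| <= x.
Proof.
move=> x0; have [c _] := @MVT_segment R sin cos 0 x x0
  (fun y _ => is_derive_sin y) (continuous_subspaceT (@continuous_sin R)).
rewrite sin0 !subr0 => ->; rewrite normrM (ger0_norm x0) ler_piMl//.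
by rewrite ler_norml cos_geN1 cos_le1.
Qed.

(** From the half-angle formula cos x = 1 - 2 sin(x/2)^2 and |sin y| <= y for y >= 0. *)
Lemma cos_ge_quadratic (x : R) : 1 - x ^+ 2 / 2 <= cos x.
Proof.
wlog x0 : x / 0 <= x.
  move=> h; have [/h//|/ltW x0] := leP 0 x.
  by rewrite -cosN -sqrrN; apply: h; rewrite oppr_ge0.
have -> : x = (x / 2) *+ 2 by rewrite -mulr_natr divfK.
have x20 : 0 <= x / 2 by rewrite divr_ge0.
have := abs_sin_le x20; rewrite -(ler_pXn2r (n := 2))// ?nnegrE// real_normK ?num_real//.
by rewrite cos_mulr2n cos2sin2; lra.
Qed.

Lemma ln_le_sub1 (x : R) : 0 < x -> ln x <= x - 1.
Proof.
move=> x0; have : -1 < x - 1 by lra.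
by move/le_ln1Dx; rewrite addrC subrK.
Qed.

(** The inequality ln x <= x - 1 is used at x or at 1/x, according to the sign of ln x. A bound
    rational in x is wanted because its integral against the Gamma density is explicit. *)
Lemma ln_sqr_le (x : R) : 0 < x -> ln x ^+ 2 <= (x - 1) ^+ 2 + (x^-1 - 1) ^+ 2.
Proof.
move=> x0; have [l0|l0] := leP 0 (ln x).
  apply: (@le_trans _ _ ((x - 1) ^+ 2)); last by rewrite lerDl sqr_ge0.
  by rewrite ler_sqr ?nnegrE ?ln_le_sub1// (le_trans l0)// ln_le_sub1.
have V0 : 0 < x^-1 by rewrite invr_gt0.
have h : - ln x <= x^-1 - 1 by rewrite -lnV ?posrE// ln_le_sub1.
apply: (@le_trans _ _ ((x^-1 - 1) ^+ 2)); last by rewrite lerDr sqr_ge0.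
rewrite -sqrrN ler_sqr ?nnegrE// ?oppr_ge0 ?(ltW l0)// (le_trans _ h)// oppr_ge0.
exact: ltW.
Qed.

Lemma Re_gamma_kernel (s : R) (t : R) : 0 < t ->
  complex.Re (gamma_kernel s%:C t) = t `^ (s - 1) * expR (- t).
Proof.
move=> t0; rewrite /gamma_kernel (_ : s%:C - 1 = (s - 1)%:C :> C).
  by rewrite tpow_real t0 CReM /= mulr0 subr0.
by apply: Ceq; rewrite ?CReB ?CImB//= subr0.
Qed.

Lemma gamma_kernel_le0 (z : C) (t : R) : t <= 0 -> gamma_kernel z t = 0.
Proof. by move=> t0; rewrite /gamma_kernel tpow_le0// mul0r. Qed.

Lemma Re_cGamma_gt0 (s : R) : 1 <= s -> 0 < complex.Re (cGamma (s%:C : C)).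
Proof.
move=> s1; have s0 : 0 < complex.Re (s%:C : C) by rewrite (lt_le_trans ltr01).
have [ir _] := gamma_kernel_intg s0.
have e0 := expR_gt0 (- 2 : R).
rewrite cGammaE /=; apply: (@lt_le_trans _ _ (\int[mu]_(t in setT) (expR (- 2) * \1_(`[1%R, 2%R] : set RM) t))).
  rewrite RintegralZl//; last by apply: integrable_indic_itv.
  have muE : mu (`[1%R, 2%R] : set RM) = 1%E.
    by rewrite lebesgue_measure_itv/= lte_fin ltr1n -EFinB; congr EFin; ring.
  rewrite /Rintegral integral_indic// setIT.
  by change (0 < expR (- 2) * fine (mu (`[1%R, 2%R] : set RM))); rewrite muE mulr1.
apply: le_Rintegral => //.
  rewrite /comp; under eq_fun do rewrite EFinM.
  by apply: integrableZl => //; apply: integrable_indic_itv.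
move=> t _; rewrite indicE; case: (boolP (t \in _)) => [/set_mem|_].
  rewrite /= in_itv/= => /andP[t1 t2]; have t0 : 0 < t by rewrite (lt_le_trans ltr01).
  rewrite Re_gamma_kernel// mulr1 -[leLHS]mul1r; apply: ler_pM; rewrite ?ler01 ?(ltW e0)//.
    by rewrite -[leLHS](powRr0 t) ler_powR// subr_ge0.
  by rewrite ler_expR lerN2.
rewrite mulr0; have [t0|t0] := leP t 0; first by rewrite gamma_kernel_le0.
by rewrite Re_gamma_kernel// mulr_ge0 ?powR_ge0 ?expR_ge0.
Qed.

(** Combines the two preceding bounds at x = t / sigma. The factor t^2 clears the negative powers of
    t, so the lower bound is a polynomial of degree 4 and its integral only involves Gamma(s), ...,
    Gamma(s+4). *)
Lemma cos_ln_ge (q tau sigma t : R) : q = tau ^+ 2 / 2 -> 0 < sigma -> 0 < t ->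
  t ^+ 2 - q * ((t ^+ 2 / sigma - t) ^+ 2 + (sigma - t) ^+ 2) <=
  t ^+ 2 * cos (tau * ln (sigma^-1 * t)).
Proof.
move=> qE sg0 t0; have x0 : 0 < sigma^-1 * t by rewrite mulr_gt0 ?invr_gt0.
have q0 : 0 <= q by rewrite qE divr_ge0// sqr_ge0.
apply: le_trans (ler_wpM2l (sqr_ge0 t) (cos_ge_quadratic _)).
have := ler_wpM2l (mulr_ge0 (sqr_ge0 t) q0) (ln_sqr_le x0).
set l := ln _; rewrite qE; move=> h.
have -> : t ^+ 2 * (1 - (tau * l) ^+ 2 / 2) = t ^+ 2 - t ^+ 2 * (tau ^+ 2 / 2) * l ^+ 2.
  by field.
rewrite lerB// (le_trans h)// le_eqVlt; apply/orP; left; apply/eqP.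
by field; rewrite !gt_eqF.
Qed.

(* With z = sigma + i tau and sigma large, the real part of sigma ^ (- i tau) *)
(* Gamma(z) is the integral of the Gamma density times cos (tau ln (t/sigma)) *)
(* and the density concentrates around t = sigma.                             *)
Lemma cGamma_neq0_large (s tau : R) : 2 + 4 * tau ^+ 2 <= s ->
  cGamma ((s + 2) +i* tau : C) != 0.
Proof.
move=> sge; set z := _ +i* _; pose sg := s + 2.
have tau20 := sqr_ge0 tau.
have s2 : 2 <= s by lra.
have sg0 : 0 < sg by rewrite /sg; lra.
have z0 : 0 < complex.Re z by rewrite /z /=.
have s0 : 0 < complex.Re (s%:C : C) by rewrite /=; lra.
pose q := tau ^+ 2 / 2.
pose g n t := gamma_kernel (s%:C + n%:R : C) t.
have sn0 n : 0 < complex.Re (s%:C + n%:R : C) by rewrite CReD CRe_nat ltr_wpDr.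
have ig n : cintegrable mu setT (g n) by exact: gamma_kernel_intg.
have gE n t : g n t = gamma_kernel s%:C t * (t ^+ n)%:C.
  by rewrite /g /gamma_kernel addrAC tpow_addn; ring.
(* Multiplication by [w] = sigma^(- i tau) turns the factor t^(i tau) of the kernel into (t /
   sigma)^(i tau), whose real part is the cosine of [cos_ln_ge]. *)
pose w : C := tpow (0 +i* tau) sg^-1.
(* [L] is the polynomial of [cos_ln_ge], expanded in powers of t, times the kernel at s; [g n]
   carries the power t^n. *)
pose L t := (- (q * sg ^+ 2))%:C * g 0%N t + (2 * q * sg)%:C * g 1%N t +
  (1 - 2 * q)%:C * g 2%N t + (2 * q / sg)%:C * g 3%N t + (- (q / sg ^+ 2))%:C * g 4%N t.
have iL : cintegrable mu setT L by do 4 (apply: cintgD; last exact: cintgZ); exact: cintgZ.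
have iz : cintegrable mu setT (fun t => w * gamma_kernel z t).
  by apply: cintgZ; exact: gamma_kernel_intg.
have LE t : L t = gamma_kernel s%:C t *
    (t ^+ 2 - q * ((t ^+ 2 / sg - t) ^+ 2 + (sg - t) ^+ 2))%:C.
  rewrite /L !gE.
  transitivity (gamma_kernel s%:C t * ((- (q * sg ^+ 2) * t ^+ 0)%:C + (2 * q * sg * t ^+ 1)%:C +
    ((1 - 2 * q) * t ^+ 2)%:C + (2 * q / sg * t ^+ 3)%:C + (- (q / sg ^+ 2) * t ^+ 4)%:C)).
    by rewrite !crealM; ring.
  rewrite -!crealD; congr (_ * _%:C); field; exact: lt0r_neq0.
have wE t : 0 < t -> complex.Re (w * gamma_kernel z t) =
    t `^ (s - 1) * expR (- t) * (t ^+ 2 * cos (tau * ln (sg^-1 * t))).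
  move=> t0.
  have -> : w * gamma_kernel z t = gamma_kernel s%:C t * (t ^+ 2)%:C * tpow (0 +i* tau) (sg^-1 * t).
    rewrite tpowM ?invr_gt0// /gamma_kernel.
    have -> : z - 1 = s%:C - 1 + 2%:R + (0 +i* tau).
      by apply: Ceq; rewrite ?CReB ?CImB ?CReD ?CImD ?CRe_nat ?CIm_nat /= ; ring.
    by rewrite (tpowD (s%:C - 1 + 2%:R)) tpow_addn /w; ring.
  rewrite (tpow_gt0 (0 +i* tau)) ?mulr_gt0 ?invr_gt0//.
  rewrite CReM CReM CImM Re_gamma_kernel// (_ : complex.Im (gamma_kernel s%:C t) = 0).
    by rewrite /= powRr0; ring.
  rewrite /gamma_kernel (_ : s%:C - 1 = (s - 1)%:C :> C).
    by rewrite tpow_real CImM /= !mulr0 !mul0r addr0.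
  by apply: Ceq; rewrite ?CReB ?CImB//= subr0.
have : complex.Re (cintegral mu setT L) <= complex.Re (w * cGamma z).
  rewrite cGammaE -cintegralZ; last exact: gamma_kernel_intg.
  apply: le_Rintegral => //; [by case: iL|by case: iz|].
  move=> t _; rewrite LE; have [t0|t0] := leP t 0.
    by rewrite !gamma_kernel_le0// mul0r mulr0.
  rewrite wE// CReM Re_gamma_kernel// [complex.Re _%:C]/= [complex.Im _%:C]/= mulr0 subr0.
  by rewrite ler_wpM2l ?mulr_ge0 ?powR_ge0 ?expR_ge0// cos_ln_ge.
have -> : cintegral mu setT L = cGamma s%:C *
   ((- (q * sg ^+ 2)) + (2 * q * sg) * s + (1 - 2 * q) * (s * (s + 1)) +
    (2 * q / sg) * (s * (s + 1) * (s + 2)) +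
    (- (q / sg ^+ 2)) * (s * (s + 1) * (s + 2) * (s + 3)))%:C.
  rewrite /L !cintegralD ?cintegralZ//; do ?[exact: cintgZ|apply: cintgD].
  rewrite -!cGammaE !cGamma_addn// /poch !big_ord_recr !big_ord0 /= !crealD !crealM.
  by rewrite addr0 !mul1r; ring.
rewrite CReM [complex.Re _%:C]/= [complex.Im _%:C]/= mulr0 subr0 => h.
apply/eqP => Gz0; move: h; rewrite Gz0 mulr0 leNgt => /negP; apply.
apply: mulr_gt0; first by apply: Re_cGamma_gt0; lra.
rewrite [complex.Re _]/=.
(* Since sigma = s + 2, a factor s + 2 cancels in the terms of order 3 and 4, and only one
   denominator remains. *)
have -> : - (q * sg ^+ 2) + 2 * q * sg * s + (1 - 2 * q) * (s * (s + 1)) +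
     2 * q / sg * (s * (s + 1) * (s + 2)) +
     - (q / sg ^+ 2) * (s * (s + 1) * (s + 2) * (s + 3)) =
  s * (s + 1) - q * (s * (s + 1) / sg + sg + 2).
  by rewrite /sg; field; rewrite gt_eqF//; lra.
have q0 : 0 <= q by rewrite /q; lra.
(* The bracket is at most s + (s + 4) = 2 s + 4, and 8 q = 4 tau^2 <= s - 2, so the subtracted term
   is at most (s^2 - 4) / 4, which is below s (s + 1). *)
have h1 : s * (s + 1) / sg <= s.
  by rewrite ler_pdivrMr// ler_wpM2l// /sg; lra.
have h2 : q * (s * (s + 1) / sg + sg + 2) <= q * (2 * s + 4).
  by apply: ler_wpM2l => //; rewrite /sg in h1 *; lra.
have q8 : 8 * q <= s - 2 by rewrite /q; lra.
have h3 : 8 * q * (2 * s + 4) <= (s - 2) * (2 * s + 4).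
  by apply: ler_wpM2r => //; lra.
rewrite subr_gt0 (le_lt_trans h2)//; nra.
Qed.

Lemma cGamma_neq0 (z : C) : 0 < complex.Re z -> cGamma z != 0.
Proof.
(* The constant 4 is the 2 of [cGamma_neq0_large] plus the 2 lost in s = Re z + n - 2; shifting by
   [n] leaves the imaginary part unchanged. *)
move=> z0; pose n := (Num.truncn (4 + 4 * complex.Im z ^+ 2)).+1.
have hn : 4 + 4 * complex.Im z ^+ 2 <= n%:R by exact/ltW/truncnS_gt.
have := @cGamma_neq0_large (complex.Re z + n%:R - 2) (complex.Im z).
rewrite (_ : _ +i* _ = z + n%:R); last first.
  by apply: Ceq; rewrite ?CReD ?CImD ?CRe_nat ?CIm_nat /= ?addr0 ?subrK.
rewrite cGamma_addn// mulf_eq0 negb_or => /(_ _)/andP[]//; lra.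
Qed.

End gamma_nonzero.

(** * Dirichlet moments *)

Section dirichlet.
Variable R : realType.
Local Notation C := (Cplx R).
Local Notation RM := (measurableTypeR R).
Local Notation mu := (@lebesgue_measure R).

(** Scaling t by [r] reduces this to the beta integral; for [r <= 0] both sides vanish by
    truncation. It is the outer integral in the induction step of [dirichlet_integral]. *)
Lemma beta_integral_scaled (a b : C) (r : R) : 0 < complex.Re a -> 0 < complex.Re b ->
  cintegrable mu setT (fun t : RM => tpow (a - 1) t * tpow (b - 1) (r - t)) /\
  cintegral mu setT (fun t : RM => tpow (a - 1) t * tpow (b - 1) (r - t)) =
  cBeta a b * tpow (a + b - 1) r.
Proof.
move=> a0 b0; have [r0|r0] := leP r 0.
  have -> : (fun t : RM => tpow (a - 1) t * tpow (b - 1) (r - t)) = fun=> 0.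
    apply/funext => t; have [t0|t0] := leP t 0; first by rewrite tpow_le0// mul0r.
    by rewrite [tpow _ (r - t)]tpow_le0 ?mulr0//; lra.
  by rewrite [tpow _ r]tpow_le0// mulr0 cintegral0; split => //; exact: cintg0.
have ib := beta_kernel_intg a0 b0.
pose f (t : RM) := tpow (a - 1) t * tpow (b - 1) (r - t).
have fE : (fun t : RM => f (r * t)) = fun t => tpow (a - 1 + (b - 1)) r * beta_kernel a b t.
  apply/funext => t; rewrite /f /beta_kernel (_ : r - r * t = r * (1 - t)); last by ring.
  by rewrite !tpowM// (tpowD (a - 1) (b - 1)); ring.
have mf : cmeasurable f.
  have [mr mi] := cmeasurable_tpow (b - 1).
  apply: cmeasurableM; first exact: cmeasurable_tpow.
  apply: (cmeasurable_comp (phi := fun t : RM => r - t : RM)) => //.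
  exact: measurable_funB.
have [|i_f ->] := cintegral_scale r0 mf; first by rewrite fE; exact: cintgZ.
split => //; rewrite fE cintegralZ// -tpow1// mulrA -tpowD mulrC /cBeta.
by congr (_ * tpow _ _); ring.
Qed.

(** Truncation makes the kernel vanish outside the open simplex of size [r]. The size is left free
    for the induction on [k]: fixing the first coordinate s_1 leaves a simplex of size r - s_1. *)
Definition dirichlet_kernel k (l : 'I_k -> C) (al : C) (r : R) (s : k.-tuple RM) : C :=
  (\prod_(i < k) tpow (l i - 1) (tnth s i)) *
  tpow (al - 1) (r - \sum_(i < k) (tnth s i : R)).

Lemma measurable_tuple_sum k :
  measurable_fun setT (fun s : k.-tuple RM => \sum_(i < k) (tnth s i : R) : RM).
Proof. by apply: measurable_sum => i; exact: measurable_tnth. Qed.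

Lemma cmeasurable_dirichlet_kernel k (l : 'I_k -> C) al r :
  cmeasurable (dirichlet_kernel l al r).
Proof.
apply: cmeasurableM.
  apply: cmeasurable_prod => i; have [mr mi] := cmeasurable_tpow (l i - 1).
  apply: (cmeasurable_comp (phi := fun s : k.-tuple RM => tnth s i)) => //.
  exact: measurable_tnth.
have [mr mi] := cmeasurable_tpow (al - 1).
apply: (cmeasurable_comp
  (phi := fun s : k.-tuple RM => r - \sum_(i < k) (tnth s i : R) : RM)) => //.
by apply: measurable_funB => //; exact: measurable_tuple_sum.
Qed.

Lemma dirichlet_kernel_tcons k (l : 'I_k.+1 -> C) al r (p : RM * k.-tuple RM) :
  dirichlet_kernel l al r (tcons p) =
  tpow (l ord0 - 1) p.1 * dirichlet_kernel (fun i => l (lift ord0 i)) al (r - p.1) p.2.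
Proof.
rewrite /dirichlet_kernel !big_ord_recl /= mulrA; congr (_ * _ * tpow _ _).
  by apply: eq_bigr => i _; rewrite tnthS.
rewrite opprD addrA; congr (_ - _ - _); apply: eq_bigr => i _.
by rewrite tnthS.
Qed.

Lemma cabs_dirichlet_kernel k (l : 'I_k -> C) al r s :
  ((cabs (dirichlet_kernel l al r s))%:C : C) =
  dirichlet_kernel (fun i => (complex.Re (l i))%:C) (complex.Re al)%:C r s.
Proof.
have ReB1 (z : C) : (complex.Re (z - 1))%:C = (complex.Re z)%:C - 1 :> C.
  by apply: Ceq; rewrite ?CReB ?CImB//= ?CReB//= subr0.
rewrite cabsM crealM cabs_prod creal_prod tpow_cabs ReB1; congr (_ * _).
by apply: eq_bigr => i _; rewrite tpow_cabs ReB1.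
Qed.

(** Integrating out all coordinates but the first leaves, by induction, a constant times (r - x)^(L'
    + al - 1), and the remaining integral over x is a scaled beta integral. The Gamma factors then
    telescope through [cGammaM]. *)
Lemma dirichlet_integral k (l : 'I_k -> C) (al : C) (r : R) :
  (forall i, 0 < complex.Re (l i)) -> 0 < complex.Re al ->
  cintegrable (leb R k) setT (dirichlet_kernel l al r) /\
  cintegral (leb R k) setT (dirichlet_kernel l al r) =
  (\prod_(i < k) cGamma (l i)) * cGamma al / cGamma (\sum_(i < k) l i + al) *
  tpow (\sum_(i < k) l i + al - 1) r.
Proof.
elim: k l al r => [|k IH] l al r l0 al0.
  (* In dimension 0 the measure is the Dirac mass at the empty tuple, and the Gamma factors reduce
     to Gamma(al) / Gamma(al) = 1. *)
  have [mr mi] := cmeasurable_dirichlet_kernel l al r.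
  have dE : dirichlet_kernel l al r [tuple] = tpow (al - 1) r.
    by rewrite /dirichlet_kernel !big_ord0 mul1r subr0.
  split.
    apply: (cintg_le (g := fun s => cabs (dirichlet_kernel l al r s))) => //.
    have mc := measurable_cabs (conj mr mi).
    apply/integrableP; split; first exact/measurable_EFinP.
    rewrite /= integral_dirac//; last by do 2 apply: measurableT_comp => //.
    by rewrite diracT mul1e ltry.
  apply: Ceq; rewrite /= /Rintegral integral_dirac//; try exact/measurable_EFinP;
    rewrite diracT mul1e /= dE !big_ord0 mul1r add0r divff ?mul1r//;
    exact: cGamma_neq0.
pose l' i := l (lift ord0 i).
have l'0 i : 0 < complex.Re (l' i) by exact: l0.
pose L' := \sum_(i < k) l' i.
have L'al0 : 0 < complex.Re (L' + al).
  by rewrite CReD CRe_sum ltr_wpDl// sumr_ge0// => i _; exact/ltW.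
have mtc := @measurable_tcons R k.
have nuE A : measurable A -> leb R k.+1 A = pushforward (mu \x leb R k)%E (@tcons R k) A by [].
pose D' := (\prod_(i < k) cGamma (l' i)) * cGamma al / cGamma (L' + al).
have mprod : cmeasurable (fun p : RM * k.-tuple RM => dirichlet_kernel l al r (tcons p)).
  have [mr mi] := cmeasurable_dirichlet_kernel l al r.
  exact: (cmeasurable_comp (phi := @tcons R k)).
have iprod : cintegrable (mu \x leb R k)%E setT
    (fun p => dirichlet_kernel l al r (tcons p)).
  apply: cintg_prod12 => //.
  (* Integrability on the product is checked by Tonelli. The modulus of the kernel is the kernel at
     the real parts of the parameters, so the induction hypothesis at [lr], [alr] evaluates the
     inner integral of the modulus. *)
  pose lr i : C := (complex.Re (l' i))%:C.
  pose alr : C := (complex.Re al)%:C.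
  have lr0 i : 0 < complex.Re (lr i) by exact: l'0.
  have alr0 : 0 < complex.Re alr by [].
  pose Lr := \sum_(i < k) lr i.
  have Lr0 : 0 < complex.Re (Lr + alr).
    by rewrite CReD CRe_sum ltr_wpDl// sumr_ge0// => i _; exact/ltW.
  pose Dr := (\prod_(i < k) cGamma (lr i)) * cGamma alr / cGamma (Lr + alr).
  have inner rho : (\int[leb R k]_s (cabs (dirichlet_kernel l' al rho s))%:E =
      (complex.Re (Dr * tpow (Lr + alr - 1) rho))%:E)%E.
    have [[ir _] /(congr1 (@complex.Re R))] := IH lr alr rho lr0 alr0.
    rewrite [LHS]/= -/Lr -/Dr => <-; rewrite /Rintegral fineK ?integrable_fin_num//.
    by apply: eq_integral => s _; rewrite -cabs_dirichlet_kernel.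
  have [ib _] := beta_integral_scaled r (l0 ord0) Lr0.
  have /integrableP[_] := cintg_cabs (cintgZ Dr ib); apply: le_lt_trans.
  under [X in (X <= _)%E]eq_integral => x _.
    under eq_integral do rewrite dirichlet_kernel_tcons [(_, _).1]/= [(_, _).2]/= cabsM EFinM.
    rewrite ge0_integralZl//; last 3 first.
    - apply/measurable_EFinP; exact/measurable_cabs/cmeasurable_dirichlet_kernel.
    - by move=> y _; rewrite lee_fin cabs_ge0.
    - by rewrite lee_fin cabs_ge0.
    rewrite inner.
    over.
  have rege0 rho : 0 <= complex.Re (Dr * tpow (Lr + alr - 1) rho).
    by rewrite -lee_fin -inner; apply: integral_ge0 => s _; rewrite lee_fin cabs_ge0.
  have [mr mi] := cmeasurable_tpow (Lr + alr - 1).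
  have mrx : cmeasurable (fun x : RM => tpow (Lr + alr - 1) (r - x)).
    apply: (cmeasurable_comp (phi := fun x : RM => r - x : RM)) => //.
    exact: measurable_funB.
  apply: ge0_le_integral => //.
  - by move=> x _; rewrite mule_ge0// lee_fin// cabs_ge0.
  - apply: emeasurable_funM; apply/measurable_EFinP.
      exact/measurable_cabs/cmeasurable_tpow.
    by have [] := cmeasurableM (@cmeasurable_cst R _ RM Dr) mrx.
  - do 2 apply: measurableT_comp => //; apply: measurable_cabs.
    apply: cmeasurableM; first exact: cmeasurable_cst.
    by apply: cmeasurableM => //; exact: cmeasurable_tpow.
  - move=> x _; rewrite -EFinM lee_fin ger0_norm ?cabs_ge0// mulrCA cabsM.
    by rewrite ler_wpM2l ?cabs_ge0// (le_trans (ler_norm _))// Re_le_cabs.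
split.
  apply: (cintg_pushforward mtc nuE) iprod.
  exact: cmeasurable_dirichlet_kernel.
rewrite (cintegral_pushforward mtc nuE (cmeasurable_dirichlet_kernel l al r) iprod).
have [_ ->] := cfubini iprod.
have [ib eb] := beta_integral_scaled r (l0 ord0) L'al0.
transitivity (cintegral mu setT
    (fun x : RM => D' * (tpow (l ord0 - 1) x * tpow (L' + al - 1) (r - x)))).
  congr (cintegral _ _ _); apply/funext => x.
  have [il el] := IH l' al (r - x) l'0 al0.
  transitivity (cintegral (leb R k) setT
    (fun s => tpow (l ord0 - 1) x * dirichlet_kernel l' al (r - x) s)).
    by congr (cintegral _ _ _); apply/funext => s; rewrite dirichlet_kernel_tcons.
  by rewrite cintegralZ// el -/L' -/D' mulrCA.
rewrite cintegralZ// eb !big_ord_recl -/L' mulrA addrA; congr (_ * tpow (_ - 1) _).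
have G0 := cGamma_neq0 L'al0.
have G1 : cGamma (l ord0 + (L' + al)) != 0.
  by apply: cGamma_neq0; rewrite CReD addr_gt0.
have GM := cGammaM (l0 ord0) L'al0.
have -> : cBeta (l ord0) (L' + al) = cGamma (l ord0) * cGamma (L' + al) / cGamma (l ord0 + (L' + al)).
  by rewrite GM mulrAC divff// mul1r.
by rewrite /D' -[in RHS]addrA; field; rewrite G0 G1.
Qed.

Lemma poch_neq0 (z : C) n : 0 < complex.Re z -> poch z n != 0.
Proof.
move=> z0; apply/prodf_neq0 => i _; apply: contraTneq z0 => zi.
by rewrite (_ : z = - i%:R) ?CReN ?CRe_nat ?oppr_gt0 ?ltrn0//; rewrite -[LHS](addrK i%:R) zi sub0r.
Qed.

(* Multiplying the density by s ^ n amounts to adding n to its exponents. *)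
Lemma dirichlet_kernel_moment k (l : 'I_k -> C) (al : C) (n : 'I_k -> nat) :
  (forall i, 0 < complex.Re (l i)) -> 0 < complex.Re al ->
  cintegral (leb R k) setT (fun s => (\prod_(i < k) ((tnth s i : R)%:C : C) ^+ n i) *
    (cGamma (\sum_(i < k) l i + al) / ((\prod_(i < k) cGamma (l i)) * cGamma al) *
     dirichlet_kernel l al 1 s)) =
  (\prod_(i < k) poch (l i) (n i)) / poch (\sum_(i < k) l i + al) (\sum_(i < k) n i)%N.
Proof.
move=> l0 al0; pose ln i := l i + (n i)%:R.
have ln0 i : 0 < complex.Re (ln i) by rewrite CReD CRe_nat ltr_wpDr.
have L0 : 0 < complex.Re (\sum_(i < k) l i + al).
  by rewrite CReD CRe_sum ltr_wpDl// sumr_ge0// => i _; exact/ltW.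
have [iK eK] := dirichlet_integral 1 ln0 al0.
set K := cGamma _ / _.
transitivity (cintegral (leb R k) setT (fun s => K * dirichlet_kernel ln al 1 s)).
  congr (cintegral _ _ _); apply/funext => s; rewrite mulrCA; congr (_ * _).
  rewrite /dirichlet_kernel mulrA; congr (_ * _); rewrite -big_split; apply: eq_bigr => i _.
  by rewrite /ln addrAC tpow_addn crealX /= mulrC.
rewrite cintegralZ// eK tpow_one mulr1.
have -> : \sum_(i < k) ln i + al = \sum_(i < k) l i + al + (\sum_(i < k) n i)%N%:R.
  by rewrite big_split /= natr_sum addrAC.
rewrite cGamma_addn//.
have -> : \prod_(i < k) cGamma (ln i) =
    (\prod_(i < k) poch (l i) (n i)) * \prod_(i < k) cGamma (l i).
  by rewrite -big_split; apply: eq_bigr => i _; rewrite /= cGamma_addn.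
rewrite /K; field; rewrite !cGamma_neq0// poch_neq0//=.
by apply/prodf_neq0 => i _; exact: cGamma_neq0.
Qed.

Lemma measurable_preimageT d1 d2 (T1 : measurableType d1) (T2 : measurableType d2)
  (f : T1 -> T2) (A : set T2) : measurable_fun setT f -> measurable A -> measurable (f @^-1` A).
Proof. by move=> mf mA; rewrite -(setTI (f @^-1` A)); exact: mf. Qed.

Lemma measurable_simplex k : measurable (simplex R k).
Proof.
have -> : simplex R k = [set s : k.-tuple RM | forall i, (`[0%R, +oo[%classic : set RM) (tnth s i)] `&`
    (fun s : k.-tuple RM => \sum_(i < k) (tnth s i : R) : RM) @^-1` `]-oo, 1%R]%classic.
  apply/seteqP; split => s /= -[h1 h2].
    by split => [i|]; rewrite /= in_itv/= ?h1 ?h2.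
  by split => [i|]; [have := h1 i|move: h2]; rewrite /= in_itv/= ?andbT.
apply: measurableI.
  by apply: (@measurable_box R k (fun=> `[0%R, +oo[%classic)) => i; exact: measurable_itv.
by apply: measurable_preimageT; [exact: measurable_tuple_sum|exact: measurable_itv].
Qed.

Lemma cmeasurable_dirichlet_density k (la : 'rV[C]_k) (al : C) :
  cmeasurable (dirichlet_density la al).
Proof.
apply: cmeasurableM; first exact: cmeasurable_cst.
apply: cmeasurableM.
  apply: cmeasurable_prod => i; have [mr mi] := cmeasurable_cpow (la 0 i - 1).
  apply: (cmeasurable_comp (f := fun t : RM => cpow t (la 0 i - 1))
    (phi := fun s : k.-tuple RM => tnth s i)) => //.
  exact: measurable_tnth.
have [mr mi] := cmeasurable_cpow (al - 1).
apply: (cmeasurable_comp (f := fun t : RM => cpow t (al - 1))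
  (phi := fun s : k.-tuple RM => 1 - \sum_(i < k) (tnth s i : R) : RM)) => //.
by apply: measurable_funB => //; exact: measurable_tuple_sum.
Qed.

(** Where the density and the truncated kernel may disagree: [cpow] at 0 need not vanish, as the
    exponent may have real part 0, whereas [tpow] does. *)
Definition simplex_boundary k : set (k.-tuple RM) :=
  (\big[setU/set0]_(i < k) [set s | tnth s i = 0 :> R]) `|`
  [set s | \sum_(i < k) (tnth s i : R) = 1].

Let measurable_face k (i : 'I_k) : measurable [set s : k.-tuple RM | tnth s i = 0 :> R].
Proof.
have := @measurable_preimageT _ _ (k.-tuple RM) RM (fun s => tnth s i) [set 0].
by apply; [exact: measurable_tnth|exact: measurable_set1].
Qed.

Let measurable_sum1 k : measurable [set s : k.-tuple RM | \sum_(i < k) (tnth s i : R) = 1].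
Proof.
have := @measurable_preimageT _ _ _ RM _ [set 1] (@measurable_tuple_sum k).
by apply; exact: measurable_set1.
Qed.

Lemma measurable_simplex_boundary k : measurable (@simplex_boundary k).
Proof.
apply: measurableU; last exact: measurable_sum1.
by apply: bigsetU_measurable => i _; exact: measurable_face.
Qed.

Lemma leb_simplex_boundary k : leb R k.+1 (@simplex_boundary k.+1) = 0%E.
Proof.
apply: null_set_setU; [|exact: measurable_sum1| |].
- by apply: bigsetU_measurable => i _; exact: measurable_face.
- elim: (index_enum _) => [|i r IH]; first by rewrite big_nil measure0.
  rewrite big_cons; apply: null_set_setU; [exact: measurable_face| | |exact: IH].
    by apply: bigsetU_measurable => j _; exact: measurable_face.
  (* A coordinate hyperplane is a box with one side reduced to a point; that zero factor makes the
     product 0 although the other factors are infinite. *)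
  pose A j : set RM := if j == i then [set 0] else setT.
  have mA j : measurable (A j) by rewrite /A; case: ifP.
  have -> : [set s : k.+1.-tuple RM | tnth s i = 0 :> R] = 
     [set s | forall j, A j (tnth s j)].
    apply/seteqP; split => s /= h; last by have := h i; rewrite /A eqxx.
    by move=> j; rewrite /A; case: eqP => [->|].
  transitivity (\prod_(j < k.+1) mu (A j))%E; first exact: leb_box.
  by rewrite (bigD1 i)//= {1}/A eqxx lebesgue_measure_set1 mul0e.
(* The hyperplane of sum 1 is null by Tonelli: once the other coordinates are fixed, the first one
   is determined. *)
pose A : set (RM * k.-tuple RM) := [set p | p.1 + \sum_(i < k) (tnth p.2 i : R) = 1].
have mA : measurable A.
  apply: (@measurable_preimageT _ _ _ RM (fun p : RM * k.-tuple RM =>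
    p.1 + \sum_(i < k) (tnth p.2 i : R) : RM) [set 1]) => //.
  apply: measurable_funD => //.
  exact: (measurableT_comp (@measurable_tuple_sum k)).
transitivity ((mu \x leb R k)%E A).
  transitivity ((mu \x leb R k)%E (@tcons R k @^-1` [set s | \sum_(i < k.+1) (tnth s i : R) = 1])).
    by [].
  congr ((_ \x _)%E _).
  apply/seteqP; split => p; rewrite /A /= big_ord_recl /= => <-;
    by congr (_ + _); apply: eq_bigr => i _; rewrite tnthS.
transitivity (\int[mu \x leb R k]_p (\1_A p)%:E)%E; first by rewrite integral_indic// setIT.
rewrite (indic_fubini_tonelli1 _ _ mA) indic_fubini_tonelli//.
rewrite (eq_integral (cst 0%E)) ?integral0// => s _.
rewrite indic_fubini_tonelli_GE//=.
have -> : ysection A s = [set 1 - \sum_(i < k) (tnth s i : R)].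
  apply/seteqP; split => x; rewrite /ysection /A /=.
    by move=> /set_mem /= <-; rewrite addrK.
  by move=> ->; apply/mem_set; rewrite /= subrK.
exact: lebesgue_measure_set1.
Qed.

Definition simplex_density k (la : 'rV[C]_k) (al : C) (s : k.-tuple RM) : C :=
  (\1_(simplex R k) s)%:C * dirichlet_density la al s.

Lemma cmeasurable_simplex_density k (la : 'rV[C]_k) (al : C) :
  cmeasurable (simplex_density la al).
Proof.
apply: cmeasurableM; last exact: cmeasurable_dirichlet_density.
by apply: cmeasurable_indic; exact: measurable_simplex.
Qed.

(** Off the boundary, a point of the simplex has all truncated factors equal to the true powers, and
    a point outside it has at least one truncated factor equal to 0. *)
Lemma simplex_densityE k (la : 'rV[C]_k) (al : C) (s : k.-tuple RM) :
  ~ simplex_boundary s -> simplex_density la al s =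
  cGamma (\sum_(i < k) la 0 i + al) / ((\prod_(i < k) cGamma (la 0 i)) * cGamma al) *
    dirichlet_kernel (fun i => la 0 i) al 1 s.
Proof.
move=> /not_orP[sN s1]; rewrite /simplex_density /dirichlet_density indicE mulrCA.
congr (_ * _).
have si i : tnth s i != 0 :> R.
  apply/eqP => s0; apply: sN.
  by rewrite (bigD1 i)//=; left.
case: (boolP (s \in _)) => [/set_mem[s0 sle]|/negP sn].
  rewrite mul1r /dirichlet_kernel tpow_gt0; last first.
    by rewrite subr_gt0 lt_neqAle sle andbT; exact/eqP.
  congr (_ * _); apply: eq_bigr => i _.
  by rewrite tpow_gt0// lt_neqAle eq_sym si s0.
rewrite mul0r /dirichlet_kernel.
have [h|/existsNP[i /negP]] := pselect (forall i, 0 <= (tnth s i : R)).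
  rewrite [X in _ * X]tpow_le0 ?mulr0// subr_le0 leNgt; apply/negP => /ltW slt.
  by apply: sn; apply/mem_set; split.
rewrite -ltNge => si0.
by rewrite (bigD1 i)//= tpow_le0 ?mul0r// ltW.
Qed.

Section simplex_density_integral.
Variables (k : nat) (la : 'rV[C]_k) (al : C).
Hypotheses (k0 : (0 < k)%N) (la0 : forall i, 0 < complex.Re (la 0 i)).
Hypothesis al0 : 0 < complex.Re al.

Let leb_bd0 : leb R k (@simplex_boundary k) = 0%E.
Proof. by case: k k0 => // n _; exact: leb_simplex_boundary. Qed.

Lemma simplex_density_intg : cintegrable (leb R k) setT (simplex_density la al).
Proof.
have [iK _] := dirichlet_integral 1 la0 al0.
apply: (cintg_ae (N := @simplex_boundary k)) (cintgZ _ iK) _ _ _.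
- exact: cmeasurable_simplex_density.
- exact: measurable_simplex_boundary.
- exact: leb_bd0.
exact: simplex_densityE.
Qed.

Lemma simplex_density_moment (n : 'I_k -> nat) :
  cintegral (leb R k) setT (fun s =>
    (\prod_(i < k) ((tnth s i : R)%:C : C) ^+ n i) * simplex_density la al s) =
  (\prod_(i < k) poch (la 0 i) (n i)) / poch (vsum la + al) (\sum_(i < k) n i)%N.
Proof.
have mpow : cmeasurable (fun s : k.-tuple RM => \prod_(i < k) ((tnth s i : R)%:C : C) ^+ n i).
  apply: cmeasurable_prod => i; apply: cmeasurableX; apply: cmeasurable_real.
  exact: measurable_tnth.
rewrite -(dirichlet_kernel_moment n la0 al0).
apply: (cintegral_ae (N := @simplex_boundary k)).
- by apply: cmeasurableM => //; exact: cmeasurable_simplex_density.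
- apply: cmeasurableM => //; apply: cmeasurableM; first exact: cmeasurable_cst.
  exact: cmeasurable_dirichlet_kernel.
- exact: measurable_simplex_boundary.
- exact: leb_bd0.
by move=> s sN; rewrite simplex_densityE.
Qed.

End simplex_density_integral.

Definition interval_density (al be : C) (t : RM) : C :=
  (\1_(`[0%R, 1%R] : set RM) t)%:C * beta_density al be t.

Lemma cmeasurable_interval_density (al be : C) : cmeasurable (interval_density al be).
Proof.
apply: cmeasurableM; first by apply: cmeasurable_indic; exact: measurable_itv.
apply: cmeasurableM; first exact: cmeasurable_cst.
apply: cmeasurableM; first exact: cmeasurable_cpow.
have [mr mi] := cmeasurable_cpow (be - 1).
apply: (cmeasurable_comp (f := fun t : RM => cpow t (be - 1)) (phi := fun t : RM => 1 - t : RM)) => //.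
exact: measurable_funB.
Qed.

Lemma interval_densityE (al be : C) (t : RM) : ~ [set (0 : RM); (1 : RM)] t ->
  interval_density al be t =
  cGamma (al + be) / (cGamma al * cGamma be) * beta_kernel al be t.
Proof.
move=> /not_orP[/eqP t0 /eqP t1]; rewrite /interval_density /beta_density indicE mulrCA.
congr (_ * _); rewrite /beta_kernel.
case: (boolP (t \in _)) => [/set_mem|/negP tn].
  rewrite /= in_itv/= => /andP[t0' t1'].
  by rewrite mul1r !tpow_gt0// ?subr_gt0 lt_neqAle ?t1// eq_sym t0.
rewrite mul0r; have [t0'|t0'] := leP t 0; first by rewrite tpow_le0// mul0r.
rewrite [X in _ * X]tpow_le0 ?mulr0// subr_le0 leNgt; apply/negP => t1'.
by apply: tn; apply/mem_set; rewrite /= in_itv/= !ltW.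
Qed.

Lemma interval_density_intg (al be : C) : 0 < complex.Re al -> 0 < complex.Re be ->
  cintegrable mu setT (interval_density al be).
Proof.
move=> a0 b0; apply: (cintg_ae (N := [set (0 : RM); (1 : RM)]))
  (cintgZ _ (beta_kernel_intg a0 b0)) _ _ _.
- exact: cmeasurable_interval_density.
- exact: measurableU.
- by apply: null_set_setU => //; exact: lebesgue_measure_set1.
exact: interval_densityE.
Qed.

Lemma interval_density_moment (al be : C) n : 0 < complex.Re al -> 0 < complex.Re be ->
  cintegral mu setT (fun t : RM => ((t : R)%:C : C) ^+ n * interval_density al be t) =
  poch al n / poch (al + be) n.
Proof.
move=> a0 b0; have an0 : 0 < complex.Re (al + n%:R) by rewrite CReD CRe_nat ltr_wpDr.
have ab0 : 0 < complex.Re (al + be) by rewrite CReD addr_gt0.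
set K := cGamma (al + be) / (cGamma al * cGamma be).
transitivity (cintegral mu setT (fun t => K * beta_kernel (al + n%:R) be t)).
  apply: (cintegral_ae (N := [set (0 : RM); (1 : RM)])).
  - apply: cmeasurableM; last exact: cmeasurable_interval_density.
    by apply: cmeasurableX; exact: cmeasurable_real.
  - by apply: cmeasurableM; [exact: cmeasurable_cst|exact: cmeasurable_beta_kernel].
  - exact: measurableU.
  - by apply: null_set_setU => //; exact: lebesgue_measure_set1.
  move=> t tN; rewrite interval_densityE// mulrCA; congr (_ * _).
  by rewrite /beta_kernel addrAC tpow_addn crealX; ring.
rewrite cintegralZ; last exact: beta_kernel_intg.
rewrite -/(cBeta _ _); have := cGammaM an0 b0; rewrite addrAC !cGamma_addn//.
have P0 : poch (al + be) n * cGamma (al + be) != 0.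
  by rewrite mulf_neq0 ?poch_neq0 ?cGamma_neq0.
move=> E; have -> : cBeta (al + n%:R) be =
  poch al n * cGamma al * cGamma be / (poch (al + be) n * cGamma (al + be)).
  by rewrite E mulrAC divff// mul1r.
by rewrite /K; field; rewrite !cGamma_neq0 ?poch_neq0.
Qed.

End dirichlet.

(** * Hypergeometric series *)

Section pochhammer_bounds.
Variable R : realType.
Local Notation C := (Cplx R).

(** Factor by factor: |a + j| <= (1 + |a|) (j + 1). *)
Lemma poch_ub (a : C) n : cabs (poch a n) <= (1 + cabs a) ^+ n * n`!%:R.
Proof.
elim: n => [|n IH]; first by rewrite /poch big_ord0 cabs1 expr0 mulr1.
rewrite /poch big_ord_recr /= cabsM exprSr factS natrM -/(poch a n).
rewrite [leRHS](_ : _ = (1 + cabs a) ^+ n * n`!%:R * ((1 + cabs a) * n.+1%:R)); last by ring.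
apply: ler_pM => //; rewrite ?cabs_ge0// (le_trans (cabsD _ _))// cabs_nat -natr1.
have := cabs_ge0 a; have : 0 <= n%:R :> R by [].
by nra.
Qed.

(** Factor by factor: with r = Re c, (1 + 1/r) |c + j| >= (1 + 1/r) (r + j) >= j + 1. *)
Lemma poch_lb (c : C) n : 0 < complex.Re c ->
  n`!%:R <= (1 + (complex.Re c)^-1) ^+ n * cabs (poch c n).
Proof.
move=> c0; have ci0 : 0 < (complex.Re c)^-1 by rewrite invr_gt0.
elim: n => [|n IH]; first by rewrite /poch big_ord0 cabs1 expr0 mulr1.
rewrite /poch big_ord_recr /= cabsM exprSr factS natrM -/(poch c n) mulrC.
rewrite [leRHS](_ : _ = (1 + (complex.Re c)^-1) ^+ n * cabs (poch c n) *
  ((1 + (complex.Re c)^-1) * cabs (c + n%:R))); last by ring.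
apply: ler_pM => //.
apply: (@le_trans _ _ ((1 + (complex.Re c)^-1) * (complex.Re c + n%:R))).
  rewrite mulrDr mulrDl mulVf ?gt_eqF// mul1r -natr1 mulrDl mul1r.
  have : 0 <= (complex.Re c)^-1 * n%:R by rewrite mulr_ge0// ltW.
  by lra.
rewrite ler_wpM2l//; first by lra.
by rewrite (le_trans _ (Re_le_cabs _))// CReD CRe_nat ler_norm.
Qed.

Lemma poch_ratio (a c : C) n : 0 < complex.Re c ->
  cabs (poch a n / poch c n) <= ((1 + cabs a) * (1 + (complex.Re c)^-1)) ^+ n.
Proof.
move=> c0; have p0 : 0 < cabs (poch c n).
  by rewrite lt_neqAle cabs_ge0 andbT eq_sym; apply/eqP => /cabs_eq0/eqP; rewrite (negbTE (poch_neq0 _ c0)).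
rewrite cabsM cabsV ler_pdivrMr// exprMn -mulrA (le_trans (poch_ub _ _))//.
by rewrite ler_wpM2l ?poch_lb// exprn_ge0// addr_ge0// cabs_ge0.
Qed.

End pochhammer_bounds.

(** * Multinomial coefficients lie between 1 and a geometric bound *)

Section multinomial_bounds.

Lemma prod_fact_le (I : Type) (r : seq I) (m : I -> nat) :
  (\prod_(i <- r) (m i)`! <= (\sum_(i <- r) m i)`!)%N.
Proof.
elim: r => [|i r IH]; first by rewrite !big_nil.
rewrite !big_cons; set s := (\sum_(_ <- _) _)%N in IH *.
have := @bin_fact (m i + s) (m i) (leq_addr _ _); rewrite addKn => <-.
rewrite (leq_trans (leq_mul (leqnn _) IH))// leq_pmull// bin_gt0 leq_addr//.
Qed.

(** A multinomial coefficient is a product of one binomial coefficient per index, each at most 2 to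
    the power of the total degree. *)
Lemma fact_sum_le (I : Type) (r : seq I) (m : I -> nat) :
  ((\sum_(i <- r) m i)`! <= 2 ^ (size r * \sum_(i <- r) m i) * \prod_(i <- r) (m i)`!)%N.
Proof.
elim: r => [|i r IH]; first by rewrite !big_nil.
rewrite !big_cons /=; set s := (\sum_(_ <- _) _)%N in IH *; set p := (\prod_(_ <- _) _)%N in IH *.
have := @bin_fact (m i + s) (m i) (leq_addr _ _); rewrite addKn => <-.
have b2 : ('C(m i + s, m i) <= 2 ^ (m i + s))%N.
  rewrite -[2%N]/(1 + 1)%N Pascal.
  rewrite (bigD1 (inord (m i) : 'I_(m i + s).+1))//= inordK ?ltnS ?leq_addr//.
  by rewrite !exp1n !muln1 leq_addr.
rewrite (leq_trans (leq_mul b2 (leq_mul (leqnn (m i)`!) IH)))//.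
rewrite mulSn [in leqRHS]expnD -!mulnA leq_mul2l; apply/orP; right.
rewrite mulnCA; apply: leq_mul => //.
by rewrite leq_exp2l// leq_mul2l leq_addl orbT.
Qed.

End multinomial_bounds.

(** * The complex exponential as a power series *)

Section complex_exponential.
Variable R : realType.
Local Notation C := (Cplx R).

Lemma cseries_cvg (u : nat -> C) (b : nat -> R) : (forall n, cabs (u n) <= b n) ->
  cvgn (series b) -> exists l : C, (series (u : nat -> C^o) : nat -> C^o) @ \oo --> (l : C^o).
Proof.
move=> ub cb.
have cvg_part (p : C -> R) : (forall z, `|p z| <= cabs z) -> cvgn (series (p \o u)).
  move=> pc; apply: normed_cvg; apply: (series_le_cvg _ _ _ cb) => n //=.
    by rewrite (le_trans _ (ub n))// cabs_ge0.
  by rewrite (le_trans (pc _)).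
have cr := cvg_part _ (@Re_le_cabs R); have ci := cvg_part _ (@Im_le_cabs R).
exists (limn (series (@complex.Re R \o u)) +i* limn (series (@complex.Im R \o u))).
apply/ccvgP; split => /=.
  by rewrite (_ : (fun _ => _) = series (@complex.Re R \o u))//; apply/funext => n; rewrite /series /= CRe_sum.
by rewrite (_ : (fun _ => _) = series (@complex.Im R \o u))//; apply/funext => n; rewrite /series /= CIm_sum.
Qed.

Definition cexp_coeff (z : C) (n : nat) : C^o := z ^+ n / n`!%:R.

Definition cexp (z : C) : C := limn (series (cexp_coeff z)).

Lemma cabs_exp_coeff z n : cabs (cexp_coeff z n) = exp_coeff (cabs z) n.
Proof. by rewrite /cexp_coeff cabsM cabsX cabsV cabs_nat. Qed.

Lemma cexp_cvg z : series (cexp_coeff z) @ \oo --> (cexp z : C^o).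
Proof.
have ub n : cabs (cexp_coeff z n) <= exp_coeff (cabs z) n by rewrite cabs_exp_coeff.
have [l cl] := cseries_cvg ub (is_cvg_series_exp_coeff _).
by rewrite /cexp (cvg_lim (@norm_hausdorff _ _) cl).
Qed.

(** At 1 these polynomials evaluate to the partial sums of the exponential, so products of partial
    sums become polynomial products, whose coefficients below degree [N] are those of exp(a + b) by
    the binomial theorem. The field is generic because both C and R are used. *)
Let pexp (F : numFieldType) (N : nat) (a : F) : {poly F} := \poly_(i < N) (a ^+ i / i`!%:R).

Let pexp_mulE (F : numFieldType) (N : nat) (a b : F) :
  (\sum_(0 <= i < N) a ^+ i / i`!%:R) * (\sum_(0 <= i < N) b ^+ i / i`!%:R) =
  \sum_(0 <= n < N) (a + b) ^+ n / n`!%:R + \sum_(N <= n < N + N) (pexp N a * pexp N b)`_n.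
Proof.
have sz (x : F) : (size (pexp N x) <= N)%N by exact: size_poly.
have hE (x : F) : (pexp N x).[1] = \sum_(0 <= i < N) x ^+ i / i`!%:R.
  rewrite (horner_coef_wide _ (sz x)) big_mkord; apply: eq_bigr => i _.
  by rewrite coef_poly ltn_ord expr1n mulr1.
rewrite -(hE a) -(hE b) -hornerM.
have szM : (size (pexp N a * pexp N b)%R <= N + N)%N.
  apply: leq_trans (size_polyMleq _ _) _; apply: leq_trans (leq_pred _) _.
  by rewrite leq_add.
rewrite (horner_coef_wide _ szM) -(big_mkord xpredT (fun i => (pexp N a * pexp N b)`_i * 1 ^+ i)).
rewrite (@big_cat_nat _ _ _ N)//= ?leq_addr//; congr (_ + _); apply: eq_big_nat => n.
  move=> /andP[_ nN]; rewrite expr1n mulr1 coefM addrC exprDn mulr_suml.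
  apply: eq_bigr => j _; have jn : (j <= n)%N by rewrite -ltnS.
  rewrite !coef_poly (leq_ltn_trans jn nN) (leq_ltn_trans (leq_subr _ _) nN).
  rewrite -(bin_fact jn) !natrM -mulr_natr; field.
  by rewrite !pnatr_eq0 -!lt0n !fact_gt0 bin_gt0 jn.
by move=> _; rewrite expr1n mulr1.
Qed.

Let cabs_pexp_coef N (a b : C) n :
  cabs (pexp N a * pexp N b)`_n <= (pexp N (cabs a) * pexp N (cabs b))`_n.
Proof.
have E (z : C) i : cabs (pexp N z)`_i = (pexp N (cabs z))`_i.
  rewrite !coef_poly; case: ifP => _; last exact: cabs0.
  by rewrite cabsM cabsX cabsV cabs_nat.
rewrite !coefM (le_trans (cabs_sum _ _ _))//; apply: ler_sum => j _.
by rewrite cabsM !E.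
Qed.

(** The error between the product of partial sums and the partial sum at a + b is bounded in modulus
    by the same error at |a| and |b|, and the latter tends to 0 because the real exponential is
    already known to be additive. *)
Lemma cexpD (a b : C) : cexp (a + b) = cexp a * cexp b.
Proof.
have cM : (series (cexp_coeff a) \* series (cexp_coeff b) : nat -> C^o) @ \oo -->
    (cexp a * cexp b : C^o).
  by apply: (@cvgM C); exact: cexp_cvg.
apply: (ccvg_eq (@cexp_cvg (a + b))).
pose E (x : R) := series (exp_coeff x).
have cE (x : R) : E x @ \oo --> expR x by exact: is_cvg_series_exp_coeff.
pose D n := series (cexp_coeff a) n * series (cexp_coeff b) n.
have bound n : cabs (series (cexp_coeff (a + b)) n - D n) <=
    E (cabs a) n * E (cabs b) n - E (cabs a + cabs b) n.
  rewrite -cabsN opprB /D /E /series /= /cexp_coeff /exp_coeff /= !pexp_mulE.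
  rewrite addrAC subrr add0r addrAC subrr add0r.
  by rewrite (le_trans (cabs_sum _ _ _))//; apply: ler_sum => j _; exact: cabs_pexp_coef.
have E0 : (fun n => E (cabs a) n * E (cabs b) n - E (cabs a + cabs b) n) @ \oo --> (0 : R).
  rewrite -(subrr (expR (cabs a + cabs b))) {1}expRD.
  by apply: cvgB; [apply: cvgM; exact: cE|exact: cE].
have c0 : (fun n => series (cexp_coeff (a + b)) n - D n : C^o) @ \oo --> (0 : C^o).
  apply: ccvg_cabs; apply: (squeeze_cvgr _ (cvg_cst 0) E0); apply: nearW => n.
  by rewrite cabs_ge0 subr0 bound.
have h := cvgD c0 cM; rewrite add0r in h.
have -> : series (cexp_coeff (a + b)) = (fun n => series (cexp_coeff (a + b)) n - D n : C^o) \+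
    (series (cexp_coeff a) \* series (cexp_coeff b)).
  by apply/funext => n; rewrite /= subrK.
exact: h.
Qed.

Lemma cexp0 : cexp 0 = 1.
Proof.
apply: (ccvg_eq (@cexp_cvg 0)); apply: cvg_near_cst; exists 1%N => // n /= n0.
rewrite /series /= -(prednK n0) big_nat_recl// /cexp_coeff expr0 fact0 divr1 big1 ?addr0//.
by move=> i _; rewrite expr0n mul0r.
Qed.

Lemma cexp_sum I (r : seq I) (F : I -> C) :
  cexp (\sum_(i <- r) F i) = \prod_(i <- r) cexp (F i).
Proof. by elim/big_ind2: _ => // [|x1 x2 y1 y2 <- <-]; [exact: cexp0|exact: cexpD]. Qed.

Lemma series_exp_le (x : R) n : 0 <= x -> series (exp_coeff x) n <= expR x.
Proof.
move=> x0; rewrite /expR; apply: nondecreasing_cvgn_le.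
  by apply: nondecreasing_series => i _ _; exact: exp_coeff_ge0.
exact: is_cvg_series_exp_coeff.
Qed.

End complex_exponential.

(** * Sums over the boxes [0, N[^k *)

Section box_sums.
Variable k : nat.
Local Notation idx := {ffun 'I_k -> nat}.

Definition box_embed N (f : {ffun 'I_k -> 'I_N}) : idx := [ffun i => f i : nat].

Lemma box_embed_inj N : injective (@box_embed N).
Proof.
move=> f g /ffunP fg; apply/ffunP => i; apply: val_inj.
by have := fg i; rewrite !ffunE.
Qed.

(** Boxes are cofinal among the finite sets of multi-indices, and sums of product families over them
    factor coordinatewise, see [box_sum_prod]. Limits of box sums are sequential, as dominated
    convergence requires. *)
Definition box_sum (V : nmodType) N (x : idx -> V) : V :=
  \sum_(f : {ffun 'I_k -> 'I_N}) x (box_embed f).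

Definition box N : {fset idx} := seq_fset tt [seq box_embed f | f <- index_enum {ffun 'I_k -> 'I_N}].

Lemma box_sumE (V : nmodType) N (x : idx -> V) : box_sum N x = \sum_(m <- box N) x m.
Proof.
rewrite /box_sum -(big_map (@box_embed N) xpredT x); apply: perm_big.
apply: uniq_perm.
- by rewrite map_inj_uniq ?index_enum_uniq//; exact: box_embed_inj.
- exact: fset_uniq.
- by move=> m; rewrite seq_fsetE.
Qed.

Lemma in_box N (m : idx) : (m \in box N) = [forall i, m i < N]%N.
Proof.
rewrite seq_fsetE; apply/mapP/forallP => [[f _ ->] i|mN]; first by rewrite ffunE ltn_ord.
exists [ffun i => Ordinal (mN i)]; first by rewrite mem_index_enum.
by apply/ffunP => i; rewrite !ffunE.
Qed.

Lemma box_sub N N' : (N <= N')%N -> (box N `<=` box N')%fset.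
Proof.
move=> NN'; apply/fsubsetP => m; rewrite !in_box => /forallP mN; apply/forallP => i.
exact: leq_trans (mN i) NN'.
Qed.

Lemma fset_sub_box (J : {fset idx}) : exists N, (J `<=` box N)%fset.
Proof.
exists (\max_(m <- J) \max_(i < k) m i).+1; apply/fsubsetP => m mJ; rewrite in_box.
apply/forallP => i; rewrite ltnS (leq_trans (leq_bigmax i))//.
exact: (@leq_bigmax_seq _ _ xpredT (fun m : idx => \max_(i < k) m i)).
Qed.

Lemma box_sum_prod (A : comPzSemiRingType) N (F : 'I_k -> nat -> A) :
  box_sum N (fun m => \prod_(i < k) F i (m i)) = \prod_(i < k) \sum_(0 <= j < N) F i j.
Proof.
under [RHS]eq_bigr do rewrite big_mkord.
rewrite (bigA_distr_bigA (fun i (j : 'I_N) => F i j)).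
by apply: eq_bigr => f _; apply: eq_bigr => i _; rewrite ffunE.
Qed.

End box_sums.
Arguments box {k} N.

(** * Unordered sums as limits of box sums *)

Section unordered_sums.
Variables (R : realType) (k : nat).
Local Notation C := (Cplx R).
Local Notation idx := {ffun 'I_k -> nat}.
Implicit Types (A J : {fset idx}).

Let fset_split (V : nmodType) A J (x : idx -> V) : (A `<=` J)%fset ->
  \sum_(m <- J) x m = \sum_(m <- A) x m + \sum_(m <- J | m \notin A) x m.
Proof.
move=> /fsubsetP AJ; rewrite (bigID [in A])/=; congr (_ + _).
rewrite big_fset_condE; congr bigop; congr (enum_fset _).
by apply/fsetP => m; rewrite !inE/= andbC; case: (boolP (m \in A)) => // /AJ ->.
Qed.

Let fset_sum_le A J (b : idx -> R) (P : pred idx) : (forall m, 0 <= b m) ->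
  (A `<=` J)%fset -> \sum_(m <- A | P m) b m <= \sum_(m <- J | P m) b m.
Proof.
move=> b0 AJ; rewrite big_mkcond [leRHS]big_mkcond (fset_split _ AJ) lerDl.
by apply: sumr_ge0 => m _; case: ifP.
Qed.

(* The unordered sum of a family dominated by b is the limit of its box sums: *)
(* a finite set J containing box N contributes, outside of the box, at most   *)
(* sup b - b(box N).                                                          *)
Lemma box_sum_cvg (x : idx -> C) (b : idx -> R) (M : R) :
  (forall m, cabs (x m) <= b m) -> (forall N, box_sum N b <= M) ->
  ((fun N => box_sum N x) : nat -> C^o) @ \oo -->
    (summability.sum (x : idx -> C^o) : C^o).
Proof.
move=> xb bM; have b0 m : 0 <= b m by rewrite (le_trans (cabs_ge0 _) (xb m)).
have mono (c : idx -> R) : (forall m, 0 <= c m) -> nondecreasing_seq (fun N => box_sum N c).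
  by move=> c0 N N' NN'; rewrite !box_sumE; apply: fset_sum_le => //; exact: box_sub.
have bcvg (c : idx -> R) M' : (forall m, 0 <= c m) -> (forall N, box_sum N c <= M') ->
    cvgn (fun N => box_sum N c).
  move=> c0 cM; apply: nondecreasing_is_cvgn; first exact: mono.
  by exists M' => _ [N _ <-].
have cb := bcvg b M b0 bM.
pose L := limn (fun N => box_sum N b).
have bL N : box_sum N b <= L by exact: nondecreasing_cvgn_le (mono b b0) cb N.
(* For [p] the real or imaginary part, p(x) + b is nonnegative, so its box sums are monotone and
   bounded; subtracting those of [b] gives convergence. *)
have part (p : C -> R) : (forall z, `|p z| <= cabs z) -> (forall N, p (box_sum N x) = box_sum N (p \o x)) ->
    cvgn (fun N => p (box_sum N x)).
  move=> pc pE.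
  have -> : (fun N => p (box_sum N x)) =
      (fun N => box_sum N (fun m => p (x m) + b m) - box_sum N b).
    by apply/funext => N; rewrite pE /box_sum big_split /= addrK.
  have pb m : `|p (x m)| <= b m by rewrite (le_trans (pc _)).
  apply: is_cvgB => //; apply: (bcvg _ (M + M)) => [m|N].
    by have := pb m; rewrite ler_norml => /andP[? _]; rewrite -lerBlDr sub0r.
  rewrite /box_sum big_split lerD ?bM// (le_trans _ (bM N))//.
  by apply: ler_sum => f _; rewrite (le_trans (ler_norm _)).
have cr := part _ (@Re_le_cabs R) (fun N => CRe_sum _ _ _).
have ci := part _ (@Im_le_cabs R) (fun N => CIm_sum _ _ _).
pose S : C := limn (fun N => complex.Re (box_sum N x)) +i* limn (fun N => complex.Im (box_sum N x)).
have xS : ((fun N => box_sum N x) : nat -> C^o) @ \oo --> (S : C^o) by apply/ccvgP.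
suff netS : (partial_sum (x : idx -> C^o)) @ totally --> (S : C^o).
  have FF : ProperFilter (@totally idx) := totally_filter.
  by rewrite /summability.sum (cvg_lim (@norm_hausdorff _ _) netS).
have tail J N : (box N `<=` J)%fset -> cabs (\sum_(m <- J) x m - box_sum N x) <= L - box_sum N b.
  move=> NJ; rewrite box_sumE (fset_split x NJ) addrAC subrr add0r.
  have [N' JN'] := fset_sub_box J.
  rewrite (le_trans (cabs_sum _ _ _))//.
  apply: (@le_trans _ _ (\sum_(m <- J | m \notin box N) b m)); first exact: ler_sum.
  rewrite (le_trans (fset_sum_le _ b0 JN'))// lerBrDr addrC box_sumE.
  by rewrite -(fset_split b (fsubset_trans NJ JN')) -box_sumE.
have FF : ProperFilter (@totally idx) := totally_filter.
apply: ccvg_cabs; apply/cvgrPdist_lt => e e0.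
have e20 : 0 < e / 2 by rewrite divr_gt0.
have [N [hb hx]] : exists N, L - box_sum N b < e / 2 /\ cabs (box_sum N x - S) < e / 2.
  have /cvgrPdist_lt/(_ _ e20) hb : (fun N => box_sum N b) @ \oo --> L by [].
  have hx0 : (fun N => cabs (box_sum N x - S)) @ \oo --> (0 : R) by exact: cabs_cvg xS.
  have /cvgrPdist_lt/(_ _ e20) hx := hx0.
  have [N _ h] : \forall N \near \oo, `|L - box_sum N b| < e / 2 /\ `|0 - cabs (box_sum N x - S)| < e / 2.
    by near=> N; split; near: N; [exact: hb|exact: hx].
  exists N; have [h1 h2] := h N (leqnn N); split; first exact: le_lt_trans (ler_norm _) h1.
  by move: h2; rewrite sub0r normrN; apply: le_lt_trans; exact: ler_norm.
exists (box N) => // J NJ; rewrite sub0r normrN ger0_norm ?cabs_ge0//.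
rewrite (_ : partial_sum _ J = \sum_(m <- J) x m); last first.
  by rewrite /partial_sum -(big_seq_fsetE _ _ xpredT).
rewrite -(subrKA (box_sum N x)) [ltRHS]splitr.
by rewrite (le_lt_trans (cabsD _ _))// ltrD// (le_lt_trans (tail _ _ NJ)).
Unshelve. all: by end_near. Qed.

End unordered_sums.

(** * Series with geometrically bounded coefficients *)

Section hypergeometric_sums.
Variables (R : realType) (k : nat).
Local Notation C := (Cplx R).
Local Notation idx := {ffun 'I_k -> nat}.

Definition hyper_term (coef : idx -> C) (w : 'rV[C]_k) (m : idx) : C :=
  coef m * ((\prod_(i < k) w 0 i ^+ m i) / (\prod_(i < k) (m i)`!)%N%:R).

Lemma hyper_term_exp coef w m : hyper_term coef w m =
  coef m * \prod_(i < k) cexp_coeff (w 0 i) (m i).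
Proof. by rewrite /hyper_term /cexp_coeff prodf_div natr_prod. Qed.

Variables (coef : idx -> C) (K : R).
Hypothesis K0 : 0 <= K.
Hypothesis coefK : forall m, cabs (coef m) <= K ^+ (\sum_(i < k) m i)%N.

(** The factor K^<m> is distributed over the coordinates, so the dominating family is a product of
    exponential series and its box sums are bounded by a product of exponentials. *)
Let bnd (w : 'rV[C]_k) (m : idx) : R := \prod_(i < k) exp_coeff (K * cabs (w 0 i)) (m i).

Let hyper_term_le w m : cabs (hyper_term coef w m) <= bnd w m.
Proof.
rewrite hyper_term_exp cabsM cabs_prod.
rewrite (le_trans (ler_wpM2r _ (coefK m)))//; first by apply: prodr_ge0 => i _; exact: cabs_ge0.
rewrite expr_sum /bnd -big_split/=; apply: ler_prod => i _.
apply/andP; split; first by rewrite mulr_ge0 ?exprn_ge0 ?cabs_ge0.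
by rewrite cabs_exp_coeff /exp_coeff /= exprMn mulrA.
Qed.

Let bnd_le w N : box_sum N (bnd w) <= \prod_(i < k) expR (K * cabs (w 0 i)).
Proof.
rewrite /bnd (box_sum_prod N (fun i => exp_coeff (K * cabs (w 0 i)))).
apply: ler_prod => i _; rewrite series_exp_le ?mulr_ge0 ?cabs_ge0// andbT.
by apply: sumr_ge0 => j _; rewrite exp_coeff_ge0// mulr_ge0// cabs_ge0.
Qed.

Lemma hyper_sum_cvg w : ((fun N => box_sum N (hyper_term coef w)) : nat -> C^o) @ \oo -->
  (summability.sum (hyper_term coef w : idx -> C^o) : C^o).
Proof. exact: box_sum_cvg (hyper_term_le w) (bnd_le w). Qed.

Lemma cabs_hyper_box (w : 'rV[C]_k) (B : R) N : (forall i, cabs (w 0 i) <= B) ->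
  cabs (box_sum N (hyper_term coef w)) <= expR (K * B) ^+ k.
Proof.
move=> wB; apply: (@le_trans _ _ (box_sum N (bnd w))).
  by rewrite (le_trans (cabs_sum _ _ _))//; apply: ler_sum => f _; exact: hyper_term_le.
rewrite (le_trans (bnd_le w N))// -[X in _ ^+ X]card_ord -prodr_const.
by apply: ler_prod => i _; rewrite expR_ge0 ler_expR ler_wpM2l.
Qed.

End hypergeometric_sums.

Section hypergeometric_coefficients.
Variables (R : realType) (k : nat).
Local Notation C := (Cplx R).
Local Notation idx := {ffun 'I_k -> nat}.

Definition Phi2_coef (b : 'rV[C]_k) (c : C) (m : idx) : C :=
  (\prod_(i < k) poch (b 0 i) (m i)) / poch c (\sum_(i < k) m i)%N.

Definition Psi2_coef (a : C) (c : 'rV[C]_k) (m : idx) : C :=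
  poch a (\sum_(i < k) m i)%N / (\prod_(i < k) poch (c 0 i) (m i)).

(** The numerators contribute the product of the m_i!, which is at most <m>!, and [poch_lb] absorbs
    <m>! into the denominator. *)
Lemma Phi2_coef_le b c m : 0 < complex.Re c -> cabs (Phi2_coef b c m) <=
  ((1 + \sum_(i < k) cabs (b 0 i)) * (1 + (complex.Re c)^-1)) ^+ (\sum_(i < k) m i)%N.
Proof.
move=> c0; set B := 1 + \sum_(i < k) _; set K := 1 + (complex.Re c)^-1.
have B1 : 1 <= B by rewrite lerDl sumr_ge0// => i _; exact: cabs_ge0.
have B0 := le_trans ler01 B1.
have p0 : 0 < cabs (poch c (\sum_(i < k) m i)%N).
  rewrite lt_neqAle cabs_ge0 andbT eq_sym; apply/eqP => /cabs_eq0/eqP.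
  by rewrite (negbTE (poch_neq0 _ c0)).
rewrite /Phi2_coef cabsM cabsV ler_pdivrMr// exprMn -mulrA.
apply: (@le_trans _ _ (B ^+ (\sum_(i < k) m i)%N * (\prod_(i < k) (m i)`!)%N%:R)).
  rewrite cabs_prod natr_prod expr_sum -big_split; apply: ler_prod => i _ /=.
  rewrite cabs_ge0 (le_trans (poch_ub _ _))// ler_wpM2r// lerXn2r ?nnegrE// ?addr_ge0 ?cabs_ge0//.
  by rewrite /B lerD2l (bigD1 i)//= lerDl sumr_ge0// => j _; exact: cabs_ge0.
rewrite ler_wpM2l ?exprn_ge0// (le_trans _ (poch_lb _ c0))// ler_nat.
exact: prod_fact_le.
Qed.

(** Here the numerator contributes <m>! and the denominators only the product of the m_i!;
    [fact_sum_le] bounds their quotient by 2^(k <m>), whence the factor 2^k. *)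
Lemma Psi2_coef_le (a : C) (c : 'rV[C]_k) m : (forall i, 0 < complex.Re (c 0 i)) -> cabs (Psi2_coef a c m) <=
  ((1 + cabs a) * 2 ^+ k * (1 + \sum_(i < k) (complex.Re (c 0 i))^-1)) ^+ (\sum_(i < k) m i)%N.
Proof.
move=> c0; set E := 1 + \sum_(i < k) _.
have ci0 i : 0 < (complex.Re (c 0 i))^-1 by rewrite invr_gt0.
have E1 : 1 <= E by rewrite lerDl sumr_ge0// => i _; exact/ltW.
have E0 := le_trans ler01 E1.
have p0 : 0 < \prod_(i < k) cabs (poch (c 0 i) (m i)).
  apply: prodr_gt0 => i _; rewrite lt_neqAle cabs_ge0 andbT eq_sym.
  by apply/eqP => /cabs_eq0/eqP; rewrite (negbTE (poch_neq0 _ (c0 i))).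
have pE : cabs (\prod_(i < k) poch (c 0 i) (m i)) = \prod_(i < k) cabs (poch (c 0 i) (m i)).
  exact: cabs_prod.
rewrite /Psi2_coef cabsM cabsV pE ler_pdivrMr// !exprMn -mulrA.
set n := (\sum_(i < k) m i)%N.
apply: (@le_trans _ _ ((1 + cabs a) ^+ n * n`!%:R)); first exact: poch_ub.
rewrite -mulrA ler_wpM2l ?exprn_ge0 ?addr_ge0 ?cabs_ge0//.
apply: (@le_trans _ _ ((2 ^+ k) ^+ n * (\prod_(i < k) (m i)`!)%N%:R)).
  rewrite -exprM -[2]/(2%N%:R) -natrX -natrM ler_nat.
  have := @fact_sum_le _ (index_enum 'I_k) m; rewrite -/n.
  by rewrite [size _](_ : _ = k)// -[RHS]card_ord cardT enumT.
rewrite -mulrA ler_wpM2l ?exprn_ge0// natr_prod expr_sum -big_split; apply: ler_prod => i _ /=.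
rewrite ler0n (le_trans (poch_lb _ (c0 i)))// ler_wpM2r ?cabs_ge0//.
rewrite lerXn2r ?nnegrE// ?addr_ge0 ?(ltW (ci0 i))//.
by rewrite /E lerD2l (bigD1 i)//= lerDl sumr_ge0// => j _; exact/ltW.
Qed.

Lemma Psi2_K_ge0 (a : C) (c : 'rV[C]_k) : (forall i, 0 < complex.Re (c 0 i)) ->
  0 <= (1 + cabs a) * 2 ^+ k * (1 + \sum_(i < k) (complex.Re (c 0 i))^-1).
Proof.
move=> c0; rewrite !mulr_ge0 ?exprn_ge0// addr_ge0 ?cabs_ge0//.
by apply: sumr_ge0 => i _; rewrite invr_ge0 ltW.
Qed.

End hypergeometric_coefficients.

(** * Averages of hypergeometric series *)

Section density_sums.
Variable R : realType.
Local Notation C := (Cplx R).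
Local Notation RM := (measurableTypeR R).

(** The partial sums are bounded only after multiplication by [rho], because their arguments are
    controlled only on the support of the density. *)
Lemma cintegral_density_cvg d (T : measurableType d) (mu : {measure set T -> \bar R})
    (rho : T -> C) (S : nat -> T -> C) (F : T -> C) (M : R) :
  cintegrable mu setT rho -> (forall N, cmeasurable (S N)) ->
  (forall t, ((fun N => S N t) : nat -> C^o) @ \oo --> (F t : C^o)) ->
  (forall N t, cabs (S N t * rho t) <= M * cabs (rho t)) ->
  cintegrable mu setT (fun t => F t * rho t) /\
  ((fun N => cintegral mu setT (fun t => S N t * rho t)) : nat -> C^o) @ \oo -->
    (cintegral mu setT (fun t => F t * rho t) : C^o).
Proof.
move=> ir mS SF SM; apply: (cdominated_cvg (g := fun t => M * cabs (rho t))).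
- by move=> N; apply: cmeasurableM => //; exact: cintg_meas ir.
- by move=> t; apply: (@cvgM C); [exact: SF|exact: cvg_cst].
- under eq_fun do rewrite EFinM; apply: integrableZl => //; exact: cintg_cabs.
- exact: SM.
Qed.

Lemma ccvg_prod I (r : seq I) (u : I -> nat -> C) (l : I -> C) :
  (forall i, (u i : nat -> C^o) @ \oo --> (l i : C^o)) ->
  ((fun N => \prod_(i <- r) u i N) : nat -> C^o) @ \oo --> (\prod_(i <- r) l i : C^o).
Proof.
move=> ul; elim: r => [|i r IH].
  rewrite big_nil (_ : (fun _ => _) = fun=> 1); last by apply/funext => N; rewrite big_nil.
  exact: cvg_cst.
rewrite big_cons (_ : (fun _ => _) = fun N => u i N * \prod_(j <- r) u j N); last first.
  by apply/funext => N; rewrite big_cons.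
by apply: (@cvgM C); [exact: ul|exact: IH].
Qed.

Section multivariate.
Variables (k : nat) (d : measure_display) (T : measurableType d).
Variables (mu : {measure set T -> \bar R}) (rho : T -> C).
Hypothesis irho : cintegrable mu setT rho.
Variables (W : T -> 'rV[C]_k) (B : R).
Hypothesis mW : forall i, cmeasurable (fun t => W t 0 i).
Hypothesis WB : forall t, rho t != 0 -> forall i, cabs (W t 0 i) <= B.
Variables (coef : {ffun 'I_k -> nat} -> C) (K : R).
Hypothesis K0 : 0 <= K.
Hypothesis coefK : forall m, cabs (coef m) <= K ^+ (\sum_(i < k) m i)%N.

Let mpow (m : 'I_k -> nat) : cmeasurable (fun t => \prod_(i < k) W t 0 i ^+ m i).
Proof. by apply: cmeasurable_prod => i; exact: cmeasurableX. Qed.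

Let mterm m : cmeasurable (fun t => hyper_term coef (W t) m).
Proof.
apply: cmeasurableM; first exact: cmeasurable_cst.
by apply: cmeasurableM => //; exact: cmeasurable_cst.
Qed.

(** Dominated convergence with the constant of [cabs_hyper_box]. The measure is arbitrary so that
    the same statement serves on one simplex, to compute averages, and on the triple product, to get
    joint integrability. *)
Lemma hyper_sum_density :
  cintegrable mu setT (fun t => summability.sum (hyper_term coef (W t) : _ -> C^o) * rho t) /\
  ((fun N => cintegral mu setT (fun t => box_sum N (hyper_term coef (W t)) * rho t))
    : nat -> C^o) @ \oo -->
  (cintegral mu setT (fun t => summability.sum (hyper_term coef (W t) : _ -> C^o) * rho t) : C^o).
Proof.
apply: (@cintegral_density_cvg _ _ _ _ _ _ (expR (K * B) ^+ k)) => //.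
- by move=> N; apply: cmeasurable_sum => f; exact: mterm.
- by move=> t; exact: (hyper_sum_cvg K0 coefK).
move=> N t; have [->|r0] := eqVneq (rho t) 0; first by rewrite mulr0 cabs0 mulr0.
by rewrite cabsM ler_wpM2r ?cabs_ge0// (cabs_hyper_box K0 coefK)//; exact: WB.
Qed.

Lemma cintg_pow_density (m : 'I_k -> nat) :
  cintegrable mu setT (fun t => (\prod_(i < k) W t 0 i ^+ m i) * rho t).
Proof.
apply: (cintg_dom (M := \prod_(i < k) `|B| ^+ m i) (g := rho)) => //.
  by apply: cmeasurableM; [exact: mpow|exact: cintg_meas irho].
move=> t; have [->|r0] := eqVneq (rho t) 0; first by rewrite mulr0 cabs0 mulr0.
rewrite cabsM ler_wpM2r ?cabs_ge0// cabs_prod; apply: ler_prod => i _.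
rewrite cabs_ge0 cabsX lerXn2r ?nnegrE ?cabs_ge0//.
by rewrite (le_trans (WB r0 i))// ler_norm.
Qed.

Lemma cintegral_box_density N :
  cintegral mu setT (fun t => box_sum N (hyper_term coef (W t)) * rho t) =
  box_sum N (fun m => coef m / (\prod_(i < k) (m i)`!)%N%:R *
    cintegral mu setT (fun t => (\prod_(i < k) W t 0 i ^+ m i) * rho t)).
Proof.
transitivity (cintegral mu setT (fun t => box_sum N (fun m =>
    coef m / (\prod_(i < k) (m i)`!)%N%:R * ((\prod_(i < k) W t 0 i ^+ m i) * rho t)))).
  congr (cintegral _ _ _); apply/funext => t; rewrite /box_sum mulr_suml.
  by apply: eq_bigr => f _; rewrite /hyper_term; ring.
rewrite /box_sum cintegral_sum; last first.
  by move=> f; apply: cintgZ; exact: cintg_pow_density.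
by apply: eq_bigr => f _; rewrite cintegralZ//; exact: cintg_pow_density.
Qed.

End multivariate.

(** * Dirichlet averages giving [Phi2] and the exponential *)

Section simplex_representations.
Variables (k : nat) (k0 : (0 < k)%N).

Lemma simplex_density_supp (la : 'rV[C]_k) (al : C) (s : k.-tuple RM) i :
  simplex_density la al s != 0 -> cabs ((tnth s i : R)%:C : C) <= 1.
Proof.
rewrite /simplex_density indicE; case: (boolP (s \in _)) => [/set_mem[s0 s1] _|_].
  rewrite cabs_real ger0_norm// (le_trans _ s1)// (bigD1 i)//= lerDl.
  exact: sumr_ge0.
by rewrite mul0r eqxx.
Qed.

Lemma cmeasurable_coord i : cmeasurable (fun s : k.-tuple RM => (tnth s i : R)%:C : C).
Proof. by apply: cmeasurable_real; exact: measurable_tnth. Qed.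

(** With all coefficients 1 a box sum factors into one-variable partial sums; in the limit this
    identifies exp <w> as a multivariate series of the general form. *)
Lemma box_sum_cexp N (w : 'rV[C]_k) :
  box_sum N (hyper_term (fun=> 1) w) = \prod_(i < k) series (cexp_coeff (w 0 i)) N.
Proof.
rewrite -(box_sum_prod N (fun i => cexp_coeff (w 0 i))).
by apply: eq_bigr => f _; rewrite hyper_term_exp mul1r.
Qed.

Lemma box_sum_cexp_cvg (w : 'rV[C]_k) :
  ((fun N => box_sum N (hyper_term (fun=> 1) w)) : nat -> C^o) @ \oo -->
  (cexp (vsum w) : C^o).
Proof.
rewrite /vsum cexp_sum; under eq_fun do rewrite box_sum_cexp.
by apply: ccvg_prod => i; exact: cexp_cvg.
Qed.

Lemma cabs_one_le (m : {ffun 'I_k -> nat}) : cabs (1 : C) <= 1 ^+ (\sum_(i < k) m i)%N.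
Proof. by rewrite expr1n cabs1. Qed.

Lemma sum_hyper_one (w : 'rV[C]_k) :
  summability.sum (hyper_term (fun=> 1) w : _ -> C^o) = cexp (vsum w) :> C.
Proof.
exact: (ccvg_eq (@hyper_sum_cvg R k (fun=> 1) 1 ler01 cabs_one_le w) (@box_sum_cexp_cvg w)).
Qed.

Lemma cmeasurable_hadamard_cvec (w : 'rV[C]_k) i :
  cmeasurable (fun s : k.-tuple RM => hadamard w (cvec s) 0 i).
Proof.
rewrite (_ : (fun _ => _) = fun s : k.-tuple RM => w 0 i * ((tnth s i : R)%:C : C)).
  by apply: cmeasurableM; [exact: cmeasurable_cst|exact: cmeasurable_coord].
by apply/funext => s; rewrite !mxE.
Qed.

Lemma cabs_hadamard_le (w v : 'rV[C]_k) i : cabs (v 0 i) <= 1 ->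
  cabs (hadamard w v 0 i) <= \sum_(j < k) cabs (w 0 j).
Proof.
move=> v1; rewrite !mxE cabsM (bigD1 i)//= -[leLHS]addr0 lerD//.
  by rewrite ler_piMr ?cabs_ge0.
by apply: sumr_ge0 => j _; exact: cabs_ge0.
Qed.

Lemma simplex_density_cvec (la : 'rV[C]_k) (al : C) (s : k.-tuple RM) i :
  simplex_density la al s != 0 -> cabs (cvec s 0 i) <= 1.
Proof. by move=> s0; rewrite mxE; exact: simplex_density_supp s0. Qed.

Lemma simplex_density_scaled_moment (la : 'rV[C]_k) (al : C) (w : 'rV[C]_k) (m : 'I_k -> nat) :
  (forall i, 0 < complex.Re (la 0 i)) -> 0 < complex.Re al ->
  cintegral (leb R k) setT (fun s =>
    (\prod_(i < k) hadamard w (cvec s) 0 i ^+ m i) * simplex_density la al s) =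
  (\prod_(i < k) w 0 i ^+ m i) *
  ((\prod_(i < k) poch (la 0 i) (m i)) / poch (vsum la + al) (\sum_(i < k) m i)%N).
Proof.
move=> la0 al0; have ir := simplex_density_intg k0 la0 al0.
have mcv i : cmeasurable (fun s : k.-tuple RM => cvec s 0 i).
  rewrite (_ : (fun _ => _) = fun s : k.-tuple RM => (tnth s i : R)%:C : C).
    exact: cmeasurable_coord.
  by apply/funext => s; rewrite mxE.
have cv1 s : simplex_density la al s != 0 -> forall i, cabs (cvec s 0 i) <= 1.
  by move=> s0 i; rewrite mxE; exact: simplex_density_supp s0.
have ic := cintg_pow_density ir mcv cv1 m.
transitivity (cintegral (leb R k) setT (fun s => (\prod_(i < k) w 0 i ^+ m i) *
    ((\prod_(i < k) cvec s 0 i ^+ m i) * simplex_density la al s))).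
  congr (cintegral _ _ _); apply/funext => s; rewrite mulrA -big_split; congr (_ * _).
  by apply: eq_bigr => i _; rewrite mxE exprMn.
rewrite cintegralZ// -simplex_density_moment//; congr (_ * cintegral _ _ _).
by apply/funext => s; congr (_ * _); apply: eq_bigr => i _; rewrite mxE.
Qed.

(** Expand the exponential and integrate termwise: the coefficient 1 of x^m / m! becomes the
    Dirichlet moment, whose denominator parameter is <a> + (c - <a>) = c. *)
Lemma Phi2_integral (a : 'rV[C]_k) (c : C) (x : 'rV[C]_k) :
  (forall i, 0 < complex.Re (a 0 i)) -> complex.Re (vsum a) < complex.Re c ->
  let rho := simplex_density a (c - vsum a) in
  let e u := cexp (vsum (hadamard x (cvec u))) in
  [/\ cintegrable (leb R k) setT rho,
      cintegrable (leb R k) setT (fun u => e u * rho u) &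
      cintegral (leb R k) setT (fun u => e u * rho u) = Phi2 a c x].
Proof.
move=> a0 ac rho e.
have ca0 : 0 < complex.Re (c - vsum a) by rewrite CReB subr_gt0.
have vc : 0 < complex.Re c.
  by rewrite (le_lt_trans _ ac)// CRe_sum sumr_ge0// => i _; exact/ltW.
have ir : cintegrable (leb R k) setT rho by exact: simplex_density_intg.
pose W u := hadamard x (cvec u).
have mW i : cmeasurable (fun u => W u 0 i) by exact: cmeasurable_hadamard_cvec.
have WB u : rho u != 0 -> forall i, cabs (W u 0 i) <= \sum_(j < k) cabs (x 0 j).
  by move=> ru i; apply: cabs_hadamard_le; exact: simplex_density_cvec ru.
have eE : (fun u => summability.sum (hyper_term (fun=> 1) (W u) : _ -> C^o) * rho u) =
    (fun u => e u * rho u).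
  by apply/funext => u; rewrite sum_hyper_one.
have [ie ce] := hyper_sum_density ir mW WB ler01 cabs_one_le.
rewrite eE in ie ce; split => //.
apply: (ccvg_eq ce).
under eq_fun do rewrite (cintegral_box_density ir mW WB).
have K0 : 0 <= (1 + \sum_(i < k) cabs (a 0 i)) * (1 + (complex.Re c)^-1).
  rewrite mulr_ge0// addr_ge0// ?invr_ge0 ?(ltW vc)//.
  by apply: sumr_ge0 => i _; exact: cabs_ge0.
rewrite (_ : (fun N => _) = (fun N => box_sum N (hyper_term (Phi2_coef a c) x))).
  exact: (hyper_sum_cvg K0 (fun m => Phi2_coef_le a m vc)).
apply/funext => N; apply: eq_bigr => f _.
by rewrite simplex_density_scaled_moment// addrC subrK /hyper_term /Phi2_coef; ring.
Qed.

(** The coefficients (g)_<m> / prod (h_i)_(m_i) are the inverses of the moments of this density, so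
    termwise integration leaves the coefficients 1 of the exponential. *)
Lemma Psi2_integral (g : C) (h : 'rV[C]_k) (w : 'rV[C]_k) :
  (forall i, 0 < complex.Re (h 0 i)) -> complex.Re (vsum h) < complex.Re g ->
  let rho := simplex_density h (g - vsum h) in
  cintegrable (leb R k) setT (fun t => Psi2 g h (hadamard w (cvec t)) * rho t) /\
  cintegral (leb R k) setT (fun t => Psi2 g h (hadamard w (cvec t)) * rho t) = cexp (vsum w).
Proof.
move=> h0 hg rho.
have gh0 : 0 < complex.Re (g - vsum h) by rewrite CReB subr_gt0.
have g0 : 0 < complex.Re g.
  by rewrite (le_lt_trans _ hg)// CRe_sum sumr_ge0// => i _; exact/ltW.
have ir : cintegrable (leb R k) setT rho by exact: simplex_density_intg.
pose W t := hadamard w (cvec t).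
have mW i : cmeasurable (fun t => W t 0 i) by exact: cmeasurable_hadamard_cvec.
have WB t : rho t != 0 -> forall i, cabs (W t 0 i) <= \sum_(j < k) cabs (w 0 j).
  by move=> rt i; apply: cabs_hadamard_le; exact: simplex_density_cvec rt.
have [ie ce] := hyper_sum_density ir mW WB (Psi2_K_ge0 g h0) (fun m => Psi2_coef_le g m h0).
split; first exact: ie.
apply: (ccvg_eq ce).
under eq_fun do rewrite (cintegral_box_density ir mW WB).
rewrite (_ : (fun N => _) = (fun N => box_sum N (hyper_term (fun=> 1) w))).
  exact: box_sum_cexp_cvg.
apply/funext => N; apply: eq_bigr => f _.
rewrite simplex_density_scaled_moment// addrC subrK /hyper_term /Psi2_coef mul1r.
have p0 : \prod_(i < k) poch (h 0 i) (box_embed f i) != 0.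
  by apply/prodf_neq0 => i _; exact: poch_neq0.
have q0 := poch_neq0 (\sum_(i < k) box_embed f i)%N g0.
have m0 : (\prod_(i < k) (box_embed f i)`!)%N%:R != 0 :> C.
  by rewrite pnatr_eq0 -lt0n prodn_gt0// => i; exact: fact_gt0.
by field; rewrite p0 q0 m0.
Qed.

End simplex_representations.

Lemma interval_density_supp (al be : C) (t : RM) :
  interval_density al be t != 0 -> cabs ((t : R)%:C : C) <= 1.
Proof.
rewrite cabs_real /interval_density indicE.
case: (boolP (t \in _)) => [/set_mem|_]; last by rewrite mul0r eqxx.
by rewrite /= in_itv/= => /andP[t0 t1] _; rewrite ger0_norm.
Qed.

Section confluent.
Variables (g h : C).
Hypothesis h0 : 0 < complex.Re h.

Let term (z : C) (n : nat) : C^o := poch g n / poch h n * (z ^+ n / n`!%:R).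

Let K := (1 + cabs g) * (1 + (complex.Re h)^-1).

Let K0 : 0 <= K.
Proof. by rewrite mulr_ge0// addr_ge0// ?cabs_ge0// invr_ge0 ltW. Qed.

Let term_le z n : cabs (term z n) <= exp_coeff (K * cabs z) n.
Proof.
rewrite cabsM -/(cexp_coeff z n) cabs_exp_coeff /exp_coeff /= exprMn -mulrA.
by rewrite ler_wpM2r ?divr_ge0 ?exprn_ge0 ?cabs_ge0// poch_ratio.
Qed.

Let hyp1F1_cvg z : (series (term z) : nat -> C^o) @ \oo --> (hyp1F1 g h z : C^o).
Proof.
have [l cl] := cseries_cvg (term_le z) (is_cvg_series_exp_coeff _).
by rewrite /hyp1F1 (cvg_lim (@norm_hausdorff _ _) cl).
Qed.

Lemma hyp1F1_density d (T : measurableType d) (mu : {measure set T -> \bar R})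
    (rho W : T -> C) (B : R) :
  cintegrable mu setT rho -> cmeasurable W -> (forall t, rho t != 0 -> cabs (W t) <= B) ->
  cintegrable mu setT (fun t => hyp1F1 g h (W t) * rho t) /\
  ((fun N => cintegral mu setT (fun t => series (term (W t)) N * rho t)) : nat -> C^o) @ \oo -->
    (cintegral mu setT (fun t => hyp1F1 g h (W t) * rho t) : C^o).
Proof.
move=> ir mW WB; apply: (@cintegral_density_cvg _ _ mu rho (fun N t => series (term (W t)) N)
  (fun t => hyp1F1 g h (W t)) (expR (K * B))) => //.
  move=> N; apply: cmeasurable_sum => n; apply: cmeasurableM; first exact: cmeasurable_cst.
  by apply: cmeasurableM; [exact: cmeasurableX|exact: cmeasurable_cst].
move=> N t; have [->|r0] := eqVneq (rho t) 0; first by rewrite mulr0 cabs0 mulr0.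
rewrite cabsM ler_wpM2r ?cabs_ge0// (le_trans (cabs_sum _ _ _))//.
apply: (@le_trans _ _ (series (exp_coeff (K * cabs (W t))) N)); first exact: ler_sum.
apply: le_trans (series_exp_le _ _) _; first by rewrite mulr_ge0 ?cabs_ge0.
by rewrite ler_expR ler_wpM2l//; exact: WB.
Qed.

Hypothesis hg : complex.Re h < complex.Re g.

(** One-variable analogue of [Psi2_integral]: the beta moment (h)_n / (g)_n cancels the coefficient
    (g)_n / (h)_n. *)
Lemma hyp1F1_integral (z : C) :
  let rho := interval_density h (g - h) in
  cintegrable (@lebesgue_measure R) setT (fun t : RM => hyp1F1 g h ((t : R)%:C * z) * rho t) /\
  cintegral (@lebesgue_measure R) setT (fun t : RM => hyp1F1 g h ((t : R)%:C * z) * rho t) = cexp z.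
Proof.
move=> rho; have gh0 : 0 < complex.Re (g - h) by rewrite CReB subr_gt0.
have g0 := lt_trans h0 hg.
have ir : cintegrable (@lebesgue_measure R) setT rho by exact: interval_density_intg.
have mW : cmeasurable (fun t : RM => (t : R)%:C * z : C).
  by apply: cmeasurableM; [exact: cmeasurable_real|exact: cmeasurable_cst].
have t1 t : rho t != 0 -> cabs ((t : R)%:C : C) <= 1 by exact: interval_density_supp.
have WB t : rho t != 0 -> cabs ((t : R)%:C * z : C) <= cabs z.
  by move=> rt; rewrite cabsM ler_piMl ?cabs_ge0 ?t1.
have [ie ce] := hyp1F1_density ir mW WB; split; first exact: ie.
apply: (ccvg_eq ce).
rewrite (_ : (fun N => _) = series (cexp_coeff z)); first exact: cexp_cvg.
apply/funext => N; rewrite /series /=.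
have ipow n : cintegrable (@lebesgue_measure R) setT (fun t : RM => ((t : R)%:C : C) ^+ n * rho t).
  apply: (cintg_dom (M := 1) (g := rho)) => //.
    apply: cmeasurableM; last exact: cintg_meas ir.
    by apply: cmeasurableX; exact: cmeasurable_real.
  move=> t; have [->|rt] := eqVneq (rho t) 0; first by rewrite mulr0 cabs0 mulr0.
  by rewrite cabsM ler_wpM2r ?cabs_ge0// cabsX exprn_ile1 ?cabs_ge0 ?t1.
transitivity (cintegral (@lebesgue_measure R) setT (fun t : RM => \sum_(0 <= n < N)
    (poch g n / poch h n * (z ^+ n / n`!%:R)) * (((t : R)%:C : C) ^+ n * rho t))).
  congr (cintegral _ _ _); apply/funext => t; rewrite mulr_suml; apply: eq_bigr => n _.
  by rewrite /term exprMn; ring.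
rewrite cintegral_sum; last by move=> n; exact: cintgZ.
apply: eq_bigr => n _; rewrite cintegralZ// interval_density_moment// addrC subrK.
have p0 := poch_neq0 n h0; have q0 := poch_neq0 n g0.
have n0 : (n`!%:R : C) != 0 by rewrite pnatr_eq0 -lt0n fact_gt0.
by rewrite /cexp_coeff; field; rewrite p0 q0 n0.
Qed.

End confluent.
End density_sums.

(** * Fubini on a product of three spaces *)

Section triple_product.
Variable R : realType.
Local Notation C := (Cplx R).
Context d1 d2 d3 (T1 : measurableType d1) (T2 : measurableType d2) (T3 : measurableType d3).
Variables (m1 : {sigma_finite_measure set T1 -> \bar R})
          (m2 : {sigma_finite_measure set T2 -> \bar R})
          (m3 : {sigma_finite_measure set T3 -> \bar R}).

(* The canonical sigma-finite structure of m1 \x m2 is shadowed in the library *)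
(* by the one for subprobabilities; a new head constant makes it available.    *)
Definition prodm : set (T1 * T2) -> \bar R := (m1 \x m2)%E.

HB.instance Definition _ := Measure.on prodm.

Let prodm_sigma_finite : sigma_finite setT prodm.
Proof.
have /sigma_finiteP[F [TF ndF Foo]] := sigma_finiteT m1.
have /sigma_finiteP[G [TG ndG Goo]] := sigma_finiteT m2.
exists (fun n => F n `*` G n).
  rewrite -setXTT TF TG; apply/seteqP; split => -[x y] /=.
    move=> [[n _ Fnx] [m _ Gmy]]; exists (maxn n m) => //; split.
    - by move: x Fnx; exact/subsetPset/ndF/leq_maxl.
    - by move: y Gmy; exact/subsetPset/ndG/leq_maxr.
  by move=> [n _ [? ?]]; split; exists n.
move=> n; have [? ?] := Foo n; have [? ?] := Goo n.
split; first exact: measurableX.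
by rewrite /prodm product_measure1E// lte_mul_pinfty// ge0_fin_numE.
Qed.

HB.instance Definition _ := Measure_isSigmaFinite.Build _ _ _ prodm prodm_sigma_finite.

Lemma cfubini3 (f : T1 * T2 * T3 -> C) : cintegrable (m1 \x m2 \x m3)%E setT f ->
  cintegral (m1 \x m2 \x m3)%E setT f =
  cintegral (m1 \x m2)%E setT (fun x => cintegral m3 setT (fun y => f (x, y))).
Proof. by move=> h; exact: (@cfubini R _ _ _ _ prodm m3 _ h).2. Qed.

Lemma cintegrable_prod3 (f : T1 * T2 -> C) (g : T3 -> C) :
  cintegrable (m1 \x m2)%E setT f -> cintegrable m3 setT g ->
  cintegrable (m1 \x m2 \x m3)%E setT (fun z => f z.1 * g z.2).
Proof. by move=> fi gi; exact: (@cintegral_prod R _ _ _ _ prodm m3 _ _ fi gi).1. Qed.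

End triple_product.

Section fubini_density.
Variable R : realType.
Local Notation C := (Cplx R).
Local Notation RM := (measurableTypeR R).

Lemma indic_setX (T1 T2 : Type) (A : set T1) (B : set T2) (z : T1 * T2) :
  ((\1_(A `*` B) z : R)%:C : C) = (\1_A z.1)%:C * (\1_B z.2)%:C.
Proof. by rewrite !indicE in_setX -crealM -natrM mulnb. Qed.

Lemma vsumD k (x y : 'rV[C]_k) : vsum (x + y) = vsum x + vsum y.
Proof. by rewrite /vsum -big_split; apply: eq_bigr => i _; rewrite mxE. Qed.

Lemma cmeasurable_vsum k d (T : measurableType d) (W : T -> 'rV[C]_k) :
  (forall i, cmeasurable (fun t => W t 0 i)) -> cmeasurable (fun t => vsum (W t)).
Proof. by move=> mW; exact: cmeasurable_sum. Qed.

Lemma cabs_vsum_le k (w : 'rV[C]_k) (B : R) : (forall i, cabs (w 0 i) <= B) ->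
  cabs (vsum w) <= B *+ k.
Proof.
move=> wB; rewrite (le_trans (cabs_sum _ _ _))//.
by rewrite (le_trans (ler_sum _ (fun i _ => wB i)))// sumr_const card_ord.
Qed.

Variables (k : nat) (x y : 'rV[C]_k).

Local Notation tup := (k.-tuple RM).

Definition mixed (p : tup * tup) : 'rV[C]_k := hadamard x (cvec p.1) + hadamard y (cvec p.2).

Lemma cmeasurable_mixed i : cmeasurable (fun p => mixed p 0 i).
Proof.
have [xr xi] := cmeasurable_hadamard_cvec x i; have [yr yi] := cmeasurable_hadamard_cvec y i.
rewrite (_ : (fun _ => _) = fun p : tup * tup =>
  hadamard x (cvec p.1) 0 i + hadamard y (cvec p.2) 0 i); last first.
  by apply/funext => p; rewrite /mixed mxE.
apply: cmeasurableD.
  exact: (cmeasurable_comp (f := fun s : tup => hadamard x (cvec s) 0 i) (phi := fst)).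
exact: (cmeasurable_comp (f := fun s : tup => hadamard y (cvec s) 0 i) (phi := snd)).
Qed.

Lemma cabs_mixed_le (p : tup * tup) i :
  (forall j, cabs (cvec p.1 0 j : C) <= 1) -> (forall j, cabs (cvec p.2 0 j : C) <= 1) ->
  cabs (mixed p 0 i) <= \sum_(j < k) cabs (x 0 j) + \sum_(j < k) cabs (y 0 j).
Proof.
move=> p1 p2; rewrite /mixed mxE (le_trans (cabsD _ _))// lerD// cabs_hadamard_le//.
Qed.

Lemma mul_indic_densities (iA iB iH X A B H : C) :
  iA * iB * iH * (X * A * B * H) = X * ((iA * A) * (iB * B) * (iH * H)).
Proof. by ring. Qed.

Lemma pull_indic_density (iH X A B H : C) : iH * (X * A * B * H) = A * B * (X * (iH * H)).
Proof. by ring. Qed.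

Lemma pull_indic_densities (iA iB X A B : C) : iA * iB * (A * B * X) = X * ((iA * A) * (iB * B)).
Proof. by ring. Qed.

End fubini_density.

(** * The two product formulas *)

Theorem proposition3p1 (R : realType) (k : nat) (hk : (1 <= k)%N)
    (x y a b : 'rV[Cplx R]_k) (c d : Cplx R)
    (ha : forall i, 0 < complex.Re (a 0 i))
    (hc : complex.Re (vsum a) < complex.Re c)
    (hb : forall i, 0 < complex.Re (b 0 i))
    (hd : complex.Re (vsum b) < complex.Re d) :
  (forall g h : Cplx R,
     0 < complex.Re h -> complex.Re h < complex.Re g ->
     let F (u v : k.-tuple (measurableTypeR R)) (t : measurableTypeR R) : Cplx R :=
       hyp1F1 g h
         ((t : R)%:C * vsum (hadamard x (cvec u) + hadamard y (cvec v))) *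
       dirichlet_density a (c - vsum a) u *
       dirichlet_density b (d - vsum b) v *
       beta_density h (g - h) t in
     cintegrable ((leb R k \x leb R k) \x @lebesgue_measure R)%E
       ((simplex R k `*` simplex R k) `*` `[0, 1])
       (fun w => F w.1.1 w.1.2 w.2) /\
     Phi2 a c x * Phi2 b d y =
     cintegral (leb R k \x leb R k)%E (simplex R k `*` simplex R k)
       (fun p => cintegral (@lebesgue_measure R) `[0, 1]
                   (fun t => F p.1 p.2 t)))
  /\
  (forall (g : Cplx R) (h : 'rV[Cplx R]_k),
     (forall i, 0 < complex.Re (h 0 i)) ->
     complex.Re (vsum h) < complex.Re g ->
     let F (u v t : k.-tuple (measurableTypeR R)) : Cplx R :=
       Psi2 g h
         (hadamard (hadamard x (cvec u) + hadamard y (cvec v)) (cvec t)) *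
       dirichlet_density a (c - vsum a) u *
       dirichlet_density b (d - vsum b) v *
       dirichlet_density h (g - vsum h) t in
     cintegrable ((leb R k \x leb R k) \x leb R k)%E
       ((simplex R k `*` simplex R k) `*` simplex R k)
       (fun w => F w.1.1 w.1.2 w.2) /\
     Phi2 a c x * Phi2 b d y =
     cintegral ((leb R k \x leb R k) \x leb R k)%E
       ((simplex R k `*` simplex R k) `*` simplex R k)
       (fun w => F w.1.1 w.1.2 w.2)).
Proof.
have mS := @measurable_simplex R k.
have mSS := measurableX mS mS.
have [irA ieA EA] := Phi2_integral hk x ha hc.
have [irB ieB EB] := Phi2_integral hk y hb hd.
set rA := simplex_density a _ in irA ieA EA.
set rB := simplex_density b _ in irB ieB EB.
have [irAB _] := cintegral_prod irA irB.
have rAB0 p : rA p.1 * rB p.2 != 0 ->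
    (forall j, cabs (cvec p.1 0 j : Cplx R) <= 1) /\ (forall j, cabs (cvec p.2 0 j : Cplx R) <= 1).
  rewrite mulf_eq0 negb_or => /andP[r1 r2].
  by split => j; [exact: simplex_density_cvec r1|exact: simplex_density_cvec r2].
(* The exponential of the sum splits, so the integral over pairs is the product of the two averages
   of [Phi2_integral]. Both formulas are reduced to this identity. *)
have outer : cintegral (leb R k \x leb R k)%E setT
    (fun p => cexp (vsum (mixed x y p)) * (rA p.1 * rB p.2)) = Phi2 a c x * Phi2 b d y.
  have [_ E] := cintegral_prod ieA ieB.
  rewrite -EA -EB -E; congr (cintegral _ _ _); apply/funext => p.
  by rewrite /mixed vsumD cexpD mulrACA.
(* A bound for every coordinate of x o u + y o v on the support of the densities, where the
   coordinates of u and v have modulus at most 1. *)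
pose Bd := \sum_(j < k) cabs (x 0 j) + \sum_(j < k) cabs (y 0 j).
split=> g h h0 hg F.
  have gh0 : 0 < complex.Re (g - h) by rewrite CReB subr_gt0.
  pose rH := interval_density h (g - h).
  have irH : cintegrable (@lebesgue_measure R) setT rH by exact: interval_density_intg.
  have ir3 := cintegrable_prod3 irAB irH.
  pose I01 : set (measurableTypeR R) := `[0%R, 1%R]%classic.
  have mI : measurable I01 by exact: measurable_itv.
  split.
    apply/(cintg_indic _ (measurableX mSS mI)).
    pose W (w : k.-tuple (measurableTypeR R) * k.-tuple (measurableTypeR R) * measurableTypeR R) : Cplx R :=
      (w.2 : R)%:C * vsum (mixed x y w.1).
    have mW : cmeasurable W.
      have [mr mi] := cmeasurable_vsum (cmeasurable_mixed x y).
      apply: cmeasurableM; first by apply: cmeasurable_real.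
      exact: (cmeasurable_comp (f := fun p => vsum (mixed x y p)) (phi := fst)).
    have WB w : rA w.1.1 * rB w.1.2 * rH w.2 != 0 -> cabs (W w) <= Bd *+ k.
      rewrite mulf_eq0 negb_or => /andP[/rAB0[p1 p2] r3].
      rewrite cabsM -[leRHS]mul1r ler_pM ?cabs_ge0//.
        exact: interval_density_supp r3.
      by apply: cabs_vsum_le => i; exact: cabs_mixed_le.
    (* Joint integrability: the product of the three densities is used as a single density on the
       triple product. *)
    have [i3 _] := hyp1F1_density g h0 ir3 mW WB.
    rewrite (_ : (fun _ => _) = fun w => hyp1F1 g h (W w) * (rA w.1.1 * rB w.1.2 * rH w.2))//.
    by apply/funext => w; rewrite !indic_setX; exact: mul_indic_densities.
  (* The integral is already iterated: for each pair [p] the two Dirichlet densities are constants,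
     and the integral over t is the exponential at [p]. *)
  rewrite cintegral_indic -outer; congr (cintegral _ _ _); apply/funext => p.
  have [ih eh] := hyp1F1_integral h0 hg (vsum (mixed x y p)).
  rewrite indic_setX cintegral_indic (_ : (fun _ => _) = fun t : measurableTypeR R =>
    dirichlet_density a (c - vsum a) p.1 * dirichlet_density b (d - vsum b) p.2 *
    (hyp1F1 g h ((t : R)%:C * vsum (mixed x y p)) * rH t)).
    by rewrite cintegralZ// eh; apply/esym; exact: pull_indic_densities.
  by apply/funext => t; exact: pull_indic_density.
have gh0 : 0 < complex.Re (g - vsum h) by rewrite CReB subr_gt0.
pose rH := simplex_density h (g - vsum h).
have irH : cintegrable (leb R k) setT rH by exact: simplex_density_intg.
have ir3 := cintegrable_prod3 irAB irH.
pose W (w : k.-tuple (measurableTypeR R) * k.-tuple (measurableTypeR R) *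
    k.-tuple (measurableTypeR R)) := hadamard (mixed x y w.1) (cvec w.2).
have mW i : cmeasurable (fun w => W w 0 i).
  rewrite (_ : (fun _ => _) = fun w => mixed x y w.1 0 i * ((tnth w.2 i : R)%:C : Cplx R)).
    have [mr mi] := cmeasurable_mixed x y i.
    have [cr ci] := @cmeasurable_coord R k i.
    apply: cmeasurableM.
      exact: (cmeasurable_comp (f := fun p => mixed x y p 0 i) (phi := fst)).
    exact: (cmeasurable_comp (f := fun s : k.-tuple (measurableTypeR R) =>
      ((tnth s i : R)%:C : Cplx R)) (phi := snd)).
  by apply/funext => w; rewrite !mxE.
have WB w : rA w.1.1 * rB w.1.2 * rH w.2 != 0 -> forall i, cabs (W w 0 i) <= Bd.
  rewrite mulf_eq0 negb_or => /andP[/rAB0[p1 p2] r3] i.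
  rewrite [W w 0 i]mxE cabsM (le_trans _ (cabs_mixed_le x y i p1 p2))//.
  by rewrite ler_piMr ?cabs_ge0//; exact: simplex_density_cvec r3.
have [i3 _] := hyper_sum_density ir3 mW WB (Psi2_K_ge0 g h0) (fun m => Psi2_coef_le g m h0).
have E : (fun w => (\1_((simplex R k `*` simplex R k) `*` simplex R k) w)%:C * F w.1.1 w.1.2 w.2) =
    (fun w => Psi2 g h (W w) * (rA w.1.1 * rB w.1.2 * rH w.2)).
  by apply/funext => w; rewrite !indic_setX; exact: mul_indic_densities.
split; first by apply/(cintg_indic _ (measurableX mSS mS)); rewrite E; exact: i3.
(* Here the integral is over the triple product; Fubini integrates out t first, and [Psi2_integral]
   evaluates the inner integral. *)
rewrite cintegral_indic E (cfubini3 i3) -outer; congr (cintegral _ _ _); apply/funext => p.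
have [ih eh] := Psi2_integral hk (mixed x y p) h0 hg.
rewrite -eh -cintegralZr//; congr (cintegral _ _ _); apply/funext => t.
by apply/esym; exact: etrans (mulrA _ _ _) (mulrAC _ _ _).
Qed.
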